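(* Let $\mathbb{H}$ be a separable real Hilbert space, $X$ a random element of $\mathbb{H}$ that is regularly varying with some index $\alpha>0$ and limit angular measure $P_{\Theta,\infty}$, and let $X_1,X_2,\dots$ be independent copies of $X$. For $1\le k\le n$ let $t_{n,k}\ge 0$ be the $(1-k/n)$-quantile of $\|X\|$, assumed to satisfy $\mathbb{P}(\|X\|\ge t_{n,k})=\mathbb{P}(\|X\|>t_{n,k})=k/n$. Let $\Theta=X/\|X\|$, $C_t=\mathbb{E}[\Theta\otimes\Theta\mid\|X\|>t]$, $C_\infty=\mathbb{E}[\Theta_\infty\otimes\Theta_\infty]$ with $\Theta_\infty\sim P_{\Theta,\infty}$, and $\widehat C_k=\frac1k\sum_{i=1}^k\Theta_{(i)}\otimes\Theta_{(i)}$, where $\Theta_{(i)}=X_{(i)}/\|X_{(i)}\|$ and $X_{(1)},\dots,X_{(n)}$ is the permutation of $X_1,\dots,X_n$ with $\|X_{(1)}\|\ge\dots\ge\|X_{(n)}\|$. Let $\lambda_t^1\ge\lambda_t^2\ge\dots$ and $\lambda_\infty^1\ge\lambda_\infty^2\ge\dots$ be the ordered eigenvalues of $C_t$ and $C_\infty$, and let $V_t^p$, $V_\infty^p$, $\widehat V_k^p$ be the spans of the first $p$ eigenfunctions of $C_t$, $C_\infty$, $\widehat C_k$ respectively. Let $p\ge1$ be an integer such that $\gamma_\infty^p:=(\lambda_\infty^p-\lambda_\infty^{p+1})/2>0$, set $\gamma_t^p=(\lambda_t^p-\lambda_t^{p+1})/2$, and let $n,k$ be large enough so that $\gamma_{t_{n,k}}^p>0$.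 For $\delta\in(0,1)$, with probability larger than $1-\delta$, $$\rho(\widehat V_k^p,V_{t_{n,k}}^p)\le\frac{B(n,k,\delta)}{\gamma_{t_{n,k}}^p},$$ where $$B(n,k,\delta)=\frac{1+4\sqrt{\log(2/\delta)}+\sqrt{8\log(4/\delta)}}{\sqrt k}+\frac{8\log(2/\delta)+4\log(4/\delta)}{3k}.$$ In particular, as $n,k\to\infty$ with $k/n\to0$, $\rho(\widehat V_k^p,V_\infty^p)\to0$ in probability.
   Context: In the asymptotic statement $k=k(n)$ is a deterministic sequence of integers. For $f,g\in\mathbb{H}$, $f\otimes g$ is the operator $h\mapsto\langle f,h\rangle g$. $HS(\mathbb{H})$ is the Hilbert space of Hilbert–Schmidt operators on $\mathbb{H}$ with norm $\|T\|_{HS(\mathbb{H})}=(\sum_i\|Te_i\|^2)^{1/2}$ for any orthonormal basis $(e_i)$; expectations of operators are Bochner integrals in $HS(\mathbb{H})$. For finite-dimensional subspaces $V,W$ of $\mathbb{H}$, $\rho(V,W)=\|\Pi_V-\Pi_W\|_{HS(\mathbb{H})}$, where $\Pi_V$ is the orthogonal projection onto $V$. The ''first $p$ eigenfunctions'' of a compact nonnegative self-adjoint operator are the first $p$ elements of an orthonormal system of eigenvectors sorted by nonincreasing eigenvalue (counted with multiplicity). Regular variation. Let $\mathbb{H}_0=\mathbb{H}\setminus\{0\}$. Let $\mathcal{C}_0$ be the set of bounded continuous functions $f:\mathbb{H}_0\to\mathbb{R}$ vanishing in some neighborhood of $0$, and $M_0$ the class of Borel measures on $\mathbb{H}_0$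 that are finite on every Borel subset bounded away from $0$. $\mu_n\to\mu$ in $M_0$ if $\int f\,d\mu_n\to\int f\,d\mu$ for all $f\in\mathcal{C}_0$. A measurable function $b$ is regularly varying with index $\rho$ if $b(tx)/b(t)\to x^\rho$ as $t\to\infty$ for every $x>0$. $X$ is regularly varying with index $\alpha>0$ if there exist a nonzero $\mu\in M_0$ and a regularly varying function $b$ such that $b(n)\mathbb{P}(X\in n\,\cdot)\to\mu$ in $M_0$ as $n\to\infty$, where $\mu(tA)=t^{-\alpha}\mu(A)$ for all $t>0$ and Borel $A\subset\mathbb{H}_0$. Known equivalent characterization (polar form): $X$ is regularly varying with index $\alpha$ if and only if $\|X\|$ is regularly varying in $\mathbb{R}$ with index $\alpha$ and there is a probability measure $P_{\Theta,\infty}$ on the unit sphere such that $\mathbb{P}(\Theta\in\cdot\mid\|X\|>t)\to P_{\Theta,\infty}$ weakly as $t\to\infty$; this $P_{\Theta,\infty}$ is the limit angular measure. *)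

(* Defs.v *)
From HB Require Import structures.
From mathcomp Require Import all_boot all_order all_algebra all_fingroup.
From mathcomp Require Import finmap.
From mathcomp Require Import all_classical all_reals all_analysis.

Set Implicit Arguments.
Unset Strict Implicit.
Unset Printing Implicit Defensive.

Import Order.TTheory GRing.Theory Num.Theory.
Import numFieldNormedType.Exports.

Local Open Scope classical_set_scope.
Local Open Scope ring_scope.

Notation borelType H := (g_sigma_algebraType (@open H)).

Section hilbert.
Context {R : realType} {H : completeNormedModType R}.

Definition separable := exists2 D : set H, countable D & dense D.

Definition lin_span (E : set H) : set H :=
  [set x | exists (s : seq H) (c : H -> R),
     (forall v, v \in s -> E v) /\ x = \sum_(v <- s) c v *: v].

Definition sphere : set H := [set x | `|x| = 1].

(* The projection of [x] on the unit sphere; it is [0] at [x = 0]. *)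
Definition angle (x : H) : H := `|x|^-1 *: x.

(* The operations below use only the inner product [dot] of [H]; that [dot] is
   an inner product inducing the norm is a hypothesis of the theorem. *)
Variable dot : H -> H -> R.

Definition orthonormal_family p (e : 'I_p -> H) :=
  forall i j, dot (e i) (e j) = (i == j)%:R.

Definition orthonormal_basis (E : set H) :=
  [/\ forall e, E e -> dot e e = 1,
      forall e f, E e -> E f -> e <> f -> dot e f = 0
    & dense (lin_span E)].

Definition tensor (f g : H) : H -> H := fun h => dot f h *: g.

(* The Hilbert-Schmidt norm of a bounded operator, with value [+oo] outside
   HS(H). It is computed in an arbitrarily chosen orthonormal basis; the value
   does not depend on this choice. *)
Definition hs_norm (A : H -> H) : \bar R :=
  sqrte (\esum_(e in xget set0 orthonormal_basis) (`|A e| ^+ 2)%:E)%E.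

Definition hilbert_schmidt (A : H -> H) :=
  [/\ linear A, continuous A & (hs_norm A < +oo)%E].

Definition orth_proj (V : set H) (h : H) : H :=
  xget 0 [set v | V v /\ forall u, V u -> dot (h - v) u = 0].

Definition rho (V W : set H) : \bar R :=
  hs_norm (orth_proj V \- orth_proj W).

(* The [j]-th largest eigenvalue ([j >= 1]) counted with multiplicity: the
   largest [l] such that at least [j] eigenvalues, counted with multiplicity,
   are [>= l]. Only meant for compact nonnegative self-adjoint operators, whose
   eigenspaces are mutually orthogonal. It is [0] when [j] exceeds the dimension
   of [H], since [sup set0 = 0]. *)
Definition eigval (A : H -> H) (j : nat) : R :=
  sup [set l | exists e : 'I_j -> H, orthonormal_family e /\
    forall i, exists2 a, l <= a & A (e i) = a *: e i].

Definition half_gap (A : H -> H) (p : nat) : R :=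
  (eigval A p - eigval A p.+1) / 2.

(* [V] is the span of some choice of the first [p] eigenfunctions of [A]. *)
Definition leading_eigenspace (A : H -> H) (p : nat) (V : set H) :=
  exists e : 'I_p -> H, [/\ orthonormal_family e,
    forall i, A (e i) = eigval A i.+1 *: e i & V = lin_span (range e)].

Section bochner.
Context {d : measure_display} {T : measurableType d}.
Implicit Types (mu : set T -> \bar R) (D : set T) (F : T -> H -> H).

Definition hs_simple F :=
  [/\ finite_set (range F), forall w, hilbert_schmidt (F w)
    & forall A : H -> H, measurable (F @^-1` [set A])].

Definition hs_simple_integral mu D F : H -> H :=
  \sum_(A \in range F) fine (mu (D `&` F @^-1` [set A])) *: A.

(* For finite measures [mu]. *)
Definition is_bochner_integral mu D F (C : H -> H) :=
  hilbert_schmidt C /\ exists S : nat -> T -> H -> H,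
  [/\ forall n, hs_simple (S n),
      forall w, D w -> hs_norm (F w \- S n w) @[n --> \oo] --> 0%E,
      (\int[mu]_(w in D) hs_norm (F w \- S n w)%R)%E @[n --> \oo] --> 0%E
    & hs_norm (C \- hs_simple_integral mu D (S n)) @[n --> \oo] --> 0%E].

Definition bochner_integral mu D F : H -> H :=
  xget (0 : H -> H) (is_bochner_integral mu D F).

End bochner.

Section random_elements.
Context {d : measure_display} {T : measurableType d} (P : probability T R).
Variable X : T -> H.

Definition tail (t : R) : set T := [set w | t < `|X w|].

(* C_t = E[Theta (x) Theta | ||X|| > t] *)
Definition cov_tail (t : R) : H -> H :=
  (fine (P (tail t)))^-1 *:
    bochner_integral P (tail t) (fun w => tensor (angle (X w)) (angle (X w))).

(* Quantiles of [||X||]; the restriction to [0 <= x] only matters for [q <= 0],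
   where it yields [0]. *)
Definition norm_quantile (q : R) : R :=
  inf [set x | 0 <= x /\ (q%:E <= P [set w | (`|X w| <= x)%R])%E].

Definition threshold (n k : nat) : R := norm_quantile (1 - k%:R / n%:R).

End random_elements.

Definition cov_limit (Q : probability (borelType H) R) : H -> H :=
  bochner_integral Q sphere (fun x : H => tensor x x).

Definition norm_decreasing n (x : 'I_n -> H) (s : 'S_n) :=
  forall i j : 'I_n, (i <= j)%N -> `|x (s j)| <= `|x (s i)|.

(* The empirical operator of a sample [x_0, ..., x_(n-1)] whose order statistics
   are [x (s 0), x (s 1), ...]. *)
Definition cov_emp n (x : 'I_n -> H) (s : 'S_n) (k : nat) : H -> H :=
  k%:R^-1 *: \sum_(i < n | (i < k)%N)
    tensor (angle (x (s i))) (angle (x (s i))).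

End hilbert.

Section regular_variation.
Context {R : realType} {H : completeNormedModType R}.

(* H \ {0}. A Borel measure on it is given by a Borel measure on [H] of which
   only the restriction to [punctured] is used. *)
Definition punctured : set H := ~` [set 0].

Definition class_C0 (f : H -> R) :=
  [/\ {within punctured, continuous f},
      exists M : R, forall x, punctured x -> `|f x| <= M
    & \forall x \near (0 : H), punctured x -> f x = 0].

Definition class_M0 (mu : set (borelType H) -> \bar R) :=
  forall A : set (borelType H), measurable A ->
    (exists2 r : R, 0 < r & forall x : H, A x -> r <= `|x|) -> (mu A < +oo)%E.

Definition cvg_M0 (mu_ : nat -> set (borelType H) -> \bar R)
    (mu : set (borelType H) -> \bar R) :=
  forall f : H -> R, class_C0 f ->
    (\int[mu_ n]_(x in punctured) (f x)%:E)%E @[n --> \oo] -->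
    (\int[mu]_(x in punctured) (f x)%:E)%E.

Definition regularly_varying_fun (b : R -> R) (r : R) :=
  measurable_fun (`]0, +oo[ : set R) b /\
  forall x, 0 < x -> b (t * x) / b t @[t --> +oo] --> x `^ r.

Definition scale_set (t : R) (A : set H) : set H := [set t *: x | x in A].

Context {d : measure_display} {T : measurableType d} (P : probability T R).

Definition regularly_varying (X : T -> H) (alpha : R) :=
  exists (mu : {measure set (borelType H) -> \bar R}) (b : R -> R),
  [/\ class_M0 mu,
      mu punctured != 0%E,
      exists r, regularly_varying_fun b r,
      cvg_M0 (fun n A => ((b n%:R)%:E * P (X @^-1` scale_set n%:R A))%E) mu
    & forall (t : R) (A : set (borelType H)), 0 < t -> measurable A ->
        A `<=` punctured -> mu (scale_set t A) = ((t `^ (- alpha))%:E * mu A)%E].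

(* [Q] is carried by the unit sphere and is the weak limit there of the laws of
   [X / ||X||] given [||X|| > t]. *)
Definition limit_angular_measure (X : T -> H)
    (Q : probability (borelType H) R) :=
  Q sphere = 1%E /\
  forall f : H -> R, {within sphere, continuous f} ->
    (exists M : R, forall x, sphere x -> `|f x| <= M) ->
    ((fine (P (tail X t)))^-1%:E *
      \int[P]_(w in tail X t) (f (angle (X w)))%:E)%E @[t --> +oo] -->
    (\int[Q]_(x in sphere) (f x)%:E)%E.

Definition independent_copies (X : T -> H) (X_ : nat -> T -> H) :=
  (forall i (A : set (borelType H)), measurable A ->
     P (X_ i @^-1` A) = P (X @^-1` A)) /\
  (forall (J : {fset nat}) (A : nat -> set (borelType H)),
     (forall i, measurable (A i)) ->
     P (\bigcap_(i in [set` J]) (X_ i @^-1` A i)) =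
     (\prod_(i <- J) P (X_ i @^-1` A i))%E).

(* Inner and outer probability: they agree with [P] on measurable events, and
   allow events that quantify over all admissible orderings of the sample and
   all admissible eigenspaces. *)
Definition inner_prob (E : set T) : \bar R :=
  ereal_sup [set P A | A in [set A | measurable A /\ A `<=` E]].

Definition outer_prob (E : set T) : \bar R :=
  ereal_inf [set P A | A in [set A | measurable A /\ E `<=` A]].

End regular_variation.

Definition deviation_bound {R : realType} (k : nat) (delta : R) : R :=
  (1 + 4 * Num.sqrt (ln (2 / delta)) + Num.sqrt (8 * ln (4 / delta)))
    / Num.sqrt k%:R
  + (8 * ln (2 / delta) + 4 * ln (4 / delta)) / (3 * k%:R).

(* Main.v *)
(** In coordinates with respect to an orthonormal basis, the centred vectors
    formed by the matrix of [angle X (x) angle X] on the event [`|X| > t] and by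
    the indicator of that event are i.i.d. and bounded.  Pinelis' argument, that
    [E cosh |S_n|] grows by a controlled factor at each step, gives a
    dimension-free exponential bound for their sum.  The [k] largest observations
    and those of norm [> t] are nested, so that the corresponding sums of tensors
    differ by at most [|N - k|], where [N] counts the latter; hence [cov_emp] is
    within [deviation_bound] of [cov_tail] in Hilbert-Schmidt norm.

    A perturbation [D] of an operator with positive half gap moves its leading
    eigenspace by at most [|D| / half_gap] however large [D] is: by Ky Fan's
    maximum principle [half_gap * rho ^+ 2 <= <D, P_V - P_W> <= |D| rho].  For the
    limit statement this is applied directly to [cov_limit], to which [cov_tail]
    converges in Hilbert-Schmidt norm, since the limit has trace 1.

    A Bochner integral that did not exist would be the junk value 0, whose half
    gap is 0; the gap hypotheses therefore provide the existence. *)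

Require Import Defs.
From HB Require Import structures.
From mathcomp Require Import all_boot all_order all_algebra all_fingroup.
From mathcomp Require Import finmap.
From mathcomp Require Import all_classical all_reals all_analysis.
From mathcomp Require Import measurable_realfun.
From mathcomp Require Import ring lra.

Set Implicit Arguments.
Unset Strict Implicit.
Unset Printing Implicit Defensive.

Import Order.TTheory GRing.Theory Num.Theory.
Import numFieldNormedType.Exports.

Local Open Scope classical_set_scope.
Local Open Scope ring_scope.

(** * Hyperbolic functions and finite vectors *)

Section hyperbolic.
Context {R : realType}.
Implicit Types a b c t w : R.

(** Operators enter the probabilistic part only through their finite corners, in the very basis that
    [hs_norm] chooses, with bounds uniform in the size of the corner. Measurability and integration
    of operator-valued maps are thereby reduced to real entries, but the concentration inequality
    must have constants independent of the dimension, which excludes a union bound over entries.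

    The order statistics are dependent and, with ties, not even determined by the sample. The
    observations above a deterministic level are independent again; the price is the random count of
    such observations. Recording the indicator as one more coordinate controls this count and the
    tensors on a single event, so that [delta] is not split. The cost is a factor [sqrt 2], which
    the constants of [deviation_bound] absorb.

    The spectral input is that a positive supremum of the Rayleigh quotient is attained. It comes
    from the strong convergence of the powers of a positive contraction, in place of weak
    compactness. *)

Lemma cvg_series_exp_coeff a : series (exp_coeff a) n @[n --> \oo] --> expR a.
Proof. exact: is_cvg_series_exp_coeff. Qed.

Arguments cvg_series_exp_coeff : clear implicits.

(** Since [(n+2)! >= 2 * 3^n] and [b <= 2], the terms of the exponential series from the quadratic
    one on are dominated by [b^2 / 2] times a geometric series of ratio [2 / 3], whose sum is 3. The
    restriction to [b <= 2] is what later limits the scale [l] in [pinelis]. *)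
Lemma expR_le_quadratic b : 0 <= b <= 2 -> expR b <= 1 + b + 3 / 2 * b ^+ 2.
Proof.
move=> /andP[b0 b2].
have fact3 n : 2 * 3 ^+ n <= ((n.+2)`!)%:R :> R.
  elim: n => [|n ih]; first by rewrite expr0 mulr1.
  rewrite factS natrM exprS mulrCA; apply: ler_pM => //; by rewrite ler_nat.
have partial n : series (exp_coeff b) n.+2 <=
    1 + b + 3 / 2 * b ^+ 2 * (1 - (2 / 3) ^+ n).
  elim: n => [|n ih].
    rewrite /series/= !big_nat_recr//= big_geq// /exp_coeff/=.
    by rewrite expr0 expr1 fact0 factS fact0 !divr1 subrr mulr0 addr0 add0r.
  rewrite seriesSr (le_trans (lerD ih (lexx _)))// /exp_coeff/= [X in _ + X <= _](_ : _ =
    b ^+ 2 * (b ^+ n / (n.+2)`!%:R)); last by rewrite mulrA -exprD addnC addn2.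
  have h : b ^+ n / (n.+2)`!%:R <= (2 / 3) ^+ n / 2.
    rewrite ler_pdivrMr ?ltr0n ?fact_gt0// expr_div_n.
    apply: (@le_trans _ _ (2 ^+ n)); first by rewrite lerXn2r// nnegrE.
    rewrite -mulrA -mulrA ler_peMr ?exprn_ge0//.
    rewrite mulrA -invfM mulrC ler_pdivlMr ?mul1r ?mulr_gt0 ?exprn_gt0//.
    by rewrite mulrC.
  have := ler_wpM2l (sqr_ge0 b) h; rewrite (exprS _ n).
  set x := (2 / 3) ^+ n; set y := b ^+ n / _; set z := b ^+ 2; lra.
apply: (cvgr_to_le (cvg_series_exp_coeff b)).
exists 2%N => // -[|[|n]]//= _; apply: le_trans (partial n) _.
by rewrite lerD2l ler_piMr ?mulr_ge0 ?sqr_ge0// gerBl exprn_ge0.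
Qed.

(** The series of the difference begins with [2 * b], and its later terms are nonnegative. *)
Lemma expRB_expRN_ge b : 0 <= b -> 2 * b <= expR b - expR (- b).
Proof.
move=> b0.
have ecvg : series (exp_coeff b) n - series (exp_coeff (- b)) n @[n --> \oo] -->
    expR b - expR (- b) by apply: cvgB; exact: cvg_series_exp_coeff.
apply: (cvgr_to_ge ecvg).
exists 2%N => // n /= n2; rewrite /= -(subnK n2) addn2.
elim: (n - 2)%N => [|m ih].
  rewrite /series/= !big_nat_recr//= !big_geq// /exp_coeff/=.
  by rewrite !expr0 !expr1 fact0 factS fact0 !divr1; lra.
rewrite !(seriesSr _ m.+2) opprD addrACA ler_wpDr// subr_ge0 /exp_coeff/=.
rewrite ler_pM2r ?invr_gt0 ?ltr0n ?fact_gt0//.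
by rewrite (le_trans (ler_norm _))// normrX normrN ger0_norm.
Qed.

Definition cosh a := (expR a + expR (- a)) / 2.
Definition sinh a := (expR a - expR (- a)) / 2.

Lemma cosh_gt0 a : 0 < cosh a.
Proof. by rewrite divr_gt0// addr_gt0 ?expR_gt0. Qed.

Lemma expR_le_2cosh a : expR a <= 2 * cosh a.
Proof. by rewrite /cosh mulrC divfK// lerDl expR_ge0. Qed.

Lemma cosh0 : cosh 0 = 1.
Proof. by rewrite /cosh oppr0 expR0; lra. Qed.

Lemma exprn_convex n t x y : 0 <= t <= 1 -> 0 <= x -> 0 <= y ->
  ((1 - t) * x + t * y) ^+ n <= (1 - t) * x ^+ n + t * y ^+ n.
Proof.
move=> /andP[t0 t1] x0 y0; elim: n => [|n ih]; first by rewrite !expr0; lra.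
rewrite exprS (le_trans (ler_wpM2l _ ih))//.
  by rewrite addr_ge0// mulr_ge0//; lra.
rewrite -subr_ge0 !exprS.
(* As in Chebyshev's sum inequality, the gap is [t * (1 - t)] times a product of two differences of
   equal sign. *)
have -> : (1 - t) * (x * x ^+ n) + t * (y * y ^+ n) -
   ((1 - t) * x + t * y) * ((1 - t) * x ^+ n + t * y ^+ n) =
   (t * (1 - t)) * ((x - y) * (x ^+ n - y ^+ n)) by ring.
apply: mulr_ge0; first by apply: mulr_ge0; lra.
have [xy|/ltW yx] := leP x y.
  by rewrite -mulrNN !opprB mulr_ge0// subr_ge0// lerXn2r.
by rewrite mulr_ge0// subr_ge0// lerXn2r.
Qed.

(* [cosh (sqrt z)] is a power series in [z] with nonnegative coefficients,
   hence convex on [0, +oo[. *)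
Lemma cosh_convex_sqr t w a b : 0 <= t <= 1 ->
  w ^+ 2 = (1 - t) * a ^+ 2 + t * b ^+ 2 ->
  cosh w <= (1 - t) * cosh a + t * cosh b.
Proof.
move=> t01 wE.
pose c x n : R := (exp_coeff x n + exp_coeff (- x) n) / 2.
have c_cvg x : series (c x) n @[n --> \oo] --> cosh x.
  have -> : series (c x) =
      (series (exp_coeff x) \+ series (exp_coeff (- x))) \* cst 2^-1.
    apply/funext => n; rewrite /= /series/= -big_split/= mulr_suml.
    by apply: eq_bigr.
  apply: cvgM; last exact: cvg_cst.
  exact: cvgD (cvg_series_exp_coeff _) (cvg_series_exp_coeff _).
apply: (ler_cvg_to (c_cvg w)
    (g := fun n => (1 - t) * series (c a) n + t * series (c b) n)).
  by apply: cvgD; apply: cvgM => //; exact: cvg_cst.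
near=> n; rewrite /series/= !mulr_sumr -big_split/= ler_sum// => i _.
have cE x : c x i = (x ^+ 2) ^+ i./2 / i`!%:R * (~~ odd i)%:R.
  rewrite /c /exp_coeff/= -mulrDl exprNn -signr_odd -exprM mul2n.
  case: (boolP (odd i)) => oi; first by rewrite expr1 mulN1r subrr !mul0r mulr0.
  by rewrite even_halfK// expr0 mul1r mulr1; lra.
rewrite !cE wE [leRHS](_ : _ = ((1 - t) * a ^+ 2 ^+ i./2 + t * b ^+ 2 ^+ i./2) /
  i`!%:R * (~~ odd i)%:R); last by ring.
by rewrite ler_wpM2r// ler_wpM2r ?invr_ge0// exprn_convex ?sqr_ge0.
Unshelve. all: by end_near. Qed.

(* Given [a], [b], the left-hand side is convex in [c] and the right-hand side
   is affine: it suffices to look at [c = a b] and [c = - a b]. *)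
Lemma cosh_step a b c w : 0 <= a -> 0 <= b <= 2 -> `|c| <= a * b ->
  w ^+ 2 = a ^+ 2 + b ^+ 2 + 2 * c ->
  cosh w <= cosh a * (1 + 3 / 2 * b ^+ 2) + sinh a / a * c.
Proof.
move=> a0 b02 cab wE.
have [b0 b2] := andP b02.
(* [c = s a b] with [|s| <= 1]; if [a b = 0] then [c = 0], and division by zero gives [s = 0]. *)
pose s := c / (a * b).
have cE : c = s * (a * b).
  rewrite /s; have [ab0|ab0] := eqVneq (a * b) 0; last by rewrite divfK.
  by move: cab; rewrite ab0 normr_le0 => /eqP ->; rewrite !mul0r.
have s1 : `|s| <= 1.
  rewrite normrM normfV (ger0_norm (mulr_ge0 a0 b0)).
  have [ab0|ab0] := eqVneq (a * b) 0; first by rewrite ab0 invr0 mulr0.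
  by rewrite ler_pdivrMr ?mul1r// lt_neqAle eq_sym ab0 mulr_ge0.
have [s1n s1p] : -1 <= s /\ s <= 1 by apply/andP; rewrite -ler_norml.
have sab : sinh a / a * c = s * sinh a * b.
  rewrite cE; have [->|a0'] := eqVneq a 0.
    by rewrite /sinh oppr0 subrr !(mul0r,mulr0).
  by field.
have shb : b <= sinh b by rewrite /sinh ler_pdivlMr// mulrC expRB_expRN_ge.
have sha : sinh a <= cosh a by rewrite /sinh /cosh; have := expR_ge0 (- a); lra.
have sha0 : 0 <= sinh a by rewrite /sinh divr_ge0//; have := expRB_expRN_ge a0; lra.
have conv : cosh w <= cosh a * cosh b + s * (sinh a * sinh b).
  (* [w^2] lies between [(a - b)^2] and [(a + b)^2], at the weight [(1 + s) / 2]; the addition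
     formulas then evaluate the convex combination. *)
  have : w ^+ 2 = (1 - (1 + s) / 2) * (a - b) ^+ 2 + (1 + s) / 2 * (a + b) ^+ 2.
    by rewrite wE cE; field.
  move/cosh_convex_sqr => /(_ _)/le_trans; apply; first by apply/andP; split; lra.
  rewrite le_eqVlt; apply/orP; left; apply/eqP.
  by rewrite /cosh /sinh opprB opprD !expRD; field.
apply: (le_trans conv); rewrite sab.
(* Replacing [s sinh a sinh b] by [s sinh a * b] costs at most [cosh a (sinh b - b)], because
   [s sinh a <= cosh a]. What remains is [cosh a (expR b - b)], and the quadratic bound on [expR b]
   cancels the linear term. *)
have e1 : cosh b + sinh b = expR b by rewrite /cosh /sinh; lra.
have e2 := expR_le_quadratic b02.
have ca := cosh_gt0 a.
have : cosh a * (cosh b + (sinh b - b)) <= cosh a * (1 + 3 / 2 * b ^+ 2).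
  by rewrite ler_pM2l//; lra.
have : 0 <= (sinh b - b) * (cosh a - s * sinh a).
  apply: mulr_ge0; first lra.
  have : s * sinh a <= 1 * sinh a by exact: ler_wpM2r.
  lra.
nra.
Qed.

End hyperbolic.

Section finite_vectors.
Context {R : realType} {I : finType}.
Implicit Types x y : I -> R.

Definition fdot x y : R := \sum_i x i * y i.
Definition fnorm x : R := Num.sqrt (\sum_i x i ^+ 2).

Lemma fnorm_ge0 x : 0 <= fnorm x. Proof. exact: sqrtr_ge0. Qed.

Lemma sqr_fnorm x : fnorm x ^+ 2 = \sum_i x i ^+ 2.
Proof. by rewrite sqr_sqrtr// sumr_ge0// => i _; exact: sqr_ge0. Qed.

Lemma fnorm_le x r : 0 <= r -> (fnorm x <= r) = (\sum_i x i ^+ 2 <= r ^+ 2).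
Proof. by move=> r0; rewrite -sqr_fnorm ler_sqr// nnegrE fnorm_ge0. Qed.

(** Lagrange's identity: the defect in Cauchy-Schwarz is half of a double sum of squares. *)
Lemma fdot_le x y : `|fdot x y| <= fnorm x * fnorm y.
Proof.
rewrite -ler_sqr ?nnegrE ?mulr_ge0 ?fnorm_ge0// real_normK ?num_real//.
rewrite exprMn !sqr_fnorm -subr_ge0.
have : 0 <= \sum_i \sum_j (x i * y j - x j * y i) ^+ 2.
  by apply: sumr_ge0 => i _; apply: sumr_ge0 => j _; exact: sqr_ge0.
suff -> : \sum_i \sum_j (x i * y j - x j * y i) ^+ 2 =
    2 * ((\sum_i x i ^+ 2) * (\sum_i y i ^+ 2) - fdot x y ^+ 2).
  by rewrite pmulr_rge0.
have e1 : \sum_i \sum_j (x i ^+ 2 * y j ^+ 2) =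
    (\sum_i x i ^+ 2) * (\sum_i y i ^+ 2).
  by rewrite mulr_suml; apply: eq_bigr => i _; rewrite mulr_sumr.
have e2 : \sum_i \sum_j (x i * y i * (x j * y j)) = fdot x y ^+ 2.
  by rewrite expr2 /fdot mulr_suml; apply: eq_bigr => i _; rewrite mulr_sumr.
have e3 : \sum_i \sum_j (x j ^+ 2 * y i ^+ 2) =
    (\sum_i x i ^+ 2) * (\sum_i y i ^+ 2).
  by rewrite exchange_big.
transitivity (\sum_i \sum_j (x i ^+ 2 * y j ^+ 2) +
    \sum_i \sum_j (x j ^+ 2 * y i ^+ 2) - 2 * \sum_i \sum_j (x i * y i * (x j * y j))).
  rewrite mulr_sumr -big_split/= -sumrB; apply: eq_bigr => i _.
  rewrite mulr_sumr -big_split/= -sumrB; apply: eq_bigr => j _; ring.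
by rewrite e1 e2 e3; ring.
Qed.

Lemma sqr_fnormD x y :
  fnorm (x \+ y) ^+ 2 = fnorm x ^+ 2 + fnorm y ^+ 2 + 2 * fdot x y.
Proof.
rewrite !sqr_fnorm /fdot mulr_sumr -!big_split/=.
by apply: eq_bigr => i _; ring.
Qed.

Lemma fnormD x y : fnorm (x \+ y) <= fnorm x + fnorm y.
Proof.
rewrite -ler_sqr ?nnegrE ?addr_ge0 ?fnorm_ge0// sqr_fnormD sqrrD.
have := le_trans (ler_norm _) (fdot_le x y); rewrite -mulr_natl; lra.
Qed.

Lemma fnormZ a x : fnorm (fun i => a * x i) = `|a| * fnorm x.
Proof.
rewrite /fnorm; under eq_bigr do rewrite exprMn.
by rewrite -mulr_sumr sqrtrM ?sqr_ge0// sqrtr_sqr.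
Qed.

Lemma fnorm0 : fnorm (fun=> 0) = 0.
Proof. by rewrite /fnorm big1 ?sqrtr0// => i _; rewrite expr0n. Qed.

Lemma fnorm_sum (J : Type) (s : seq J) (Q : pred J) (x : J -> I -> R) :
  fnorm (fun i => \sum_(j <- s | Q j) x j i) <= \sum_(j <- s | Q j) fnorm (x j).
Proof.
elim: s => [|j s ih]; first by rewrite big_nil; under eq_fun do rewrite big_nil; rewrite fnorm0.
rewrite big_cons; under eq_fun do rewrite big_cons.
case: (Q j) => //; exact: le_trans (fnormD _ _) (lerD (lexx _) ih).
Qed.

End finite_vectors.

Lemma cvg_sumr (R : realType) (U J : Type) (F : set_system U) (FF : Filter F)
    (s : seq J) (Q : pred J) (f : J -> U -> R) (l : J -> R) :
  (forall j, f j z @[z --> F] --> l j) ->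
  \sum_(j <- s | Q j) f j z @[z --> F] --> \sum_(j <- s | Q j) l j.
Proof.
move=> fl; elim: s => [|j s ih].
  by rewrite big_nil; under eq_fun do rewrite big_nil; exact: cvg_cst.
rewrite big_cons; under eq_fun do rewrite big_cons.
by case: (Q j) => //; apply: cvgD.
Qed.

(** * Expectation of bounded functions *)

Section bounded_expectation.
Context d (T : measurableType d) {R : realType} (P : probability T R).
Implicit Types (f g : T -> R) (A : set T).

(** A class closed under the algebraic operations in which integrability is automatic; all random
    variables below belong to it, if necessary after multiplication by an indicator. *)
Definition bounded_measurable f :=
  measurable_fun [set: T] f /\ exists M, forall w, `|f w| <= M.

Lemma bounded_measurable_cst c : bounded_measurable (fun=> c).
Proof. by split; [exact: measurable_cst | exists `|c|]. Qed.

Lemma bounded_measurableD f g :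
  bounded_measurable f -> bounded_measurable g -> bounded_measurable (f \+ g).
Proof.
move=> [mf [M fM]] [mg [N gN]]; split; first exact: measurable_funD.
by exists (M + N) => w; rewrite (le_trans (ler_normD _ _))// lerD.
Qed.

Lemma bounded_measurableM f g :
  bounded_measurable f -> bounded_measurable g -> bounded_measurable (f \* g).
Proof.
move=> [mf [M fM]] [mg [N gN]]; split; first exact: measurable_funM.
by exists (M * N) => w; rewrite normrM ler_pM.
Qed.

Lemma bounded_measurableZ c f :
  bounded_measurable f -> bounded_measurable (fun w => c * f w).
Proof. exact: bounded_measurableM (bounded_measurable_cst c). Qed.

Lemma bounded_measurableB f g :
  bounded_measurable f -> bounded_measurable g -> bounded_measurable (f \- g).
Proof.
move=> bf bg; have -> : f \- g = f \+ (fun w => -1 * g w).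
  by apply/funext => w /=; rewrite mulN1r.
exact/bounded_measurableD/bounded_measurableZ.
Qed.

Lemma bounded_measurable_sum (J : Type) (s : seq J) (Q : pred J) (f : J -> T -> R) :
  (forall j, bounded_measurable (f j)) ->
  bounded_measurable (fun w => \sum_(j <- s | Q j) f j w).
Proof.
move=> bf; elim: s => [|j s ih].
  by under eq_fun do rewrite big_nil; exact: bounded_measurable_cst.
under eq_fun do rewrite big_cons; case: (Q j) => //.
exact: bounded_measurableD.
Qed.

Lemma bounded_measurable_norm f :
  bounded_measurable f -> bounded_measurable (fun w => `|f w|).
Proof.
move=> [mf [M fM]]; split; first exact: measurableT_comp.
by exists M => w; rewrite normr_id.
Qed.

Lemma bounded_measurable_indic A : measurable A -> bounded_measurable \1_A.
Proof.
move=> mA; split; first exact: measurable_indic.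
by exists 1 => w; rewrite indicE; case: (_ \in _); rewrite /= ?normr0 ?normr1.
Qed.

Lemma bounded_measurable_integrable f : bounded_measurable f ->
  P.-integrable [set: T] (EFin \o f).
Proof.
move=> [mf [M fM]]; apply: measurable_bounded_integrable => //.
  exact: le_lt_trans (probability_le1 P measurableT) (ltry _).
exists M; split; first exact: num_real.
by move=> x Mx w _; exact: le_trans (fM w) (ltW Mx).
Qed.

Let integ := bounded_measurable_integrable.

Definition Ex f : R := \int[P]_w f w.

Lemma EFin_Ex f : bounded_measurable f -> (Ex f)%:E = (\int[P]_w (f w)%:E)%E.
Proof.
by move=> bf; rewrite /Ex /Rintegral fineK//; apply: integrable_fin_num => //; exact: integ.
Qed.

Lemma ExD f g : bounded_measurable f -> bounded_measurable g ->
  Ex (f \+ g) = Ex f + Ex g.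
Proof. by move=> bf bg; rewrite /Ex RintegralD//; exact: integ. Qed.

Lemma ExB f g : bounded_measurable f -> bounded_measurable g ->
  Ex (f \- g) = Ex f - Ex g.
Proof. by move=> bf bg; rewrite /Ex RintegralB//; exact: integ. Qed.

Lemma ExZ c f : bounded_measurable f -> Ex (fun w => c * f w) = c * Ex f.
Proof. by move=> bf; rewrite /Ex RintegralZl//; exact: integ. Qed.

Lemma Ex_cst c : Ex (fun=> c) = c.
Proof. 
rewrite /Ex Rintegral_cst// [X in fine X](_ : _ = 1%E) ?mulr1//.
exact: probability_setT. Qed.

Lemma Ex_sum (J : Type) (s : seq J) (Q : pred J) (f : J -> T -> R) :
  (forall j, bounded_measurable (f j)) ->
  Ex (fun w => \sum_(j <- s | Q j) f j w) = \sum_(j <- s | Q j) Ex (f j).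
Proof.
move=> bf; elim: s => [|j s ih].
  by under eq_fun do rewrite big_nil; rewrite Ex_cst big_nil.
rewrite big_cons; under eq_fun do rewrite big_cons; case: (Q j) => //.
rewrite -ih; apply: ExD => //; exact: bounded_measurable_sum.
Qed.

Lemma Ex_ge0 f : (forall w, 0 <= f w) -> 0 <= Ex f.
Proof. by move=> f0; apply: Rintegral_ge0. Qed.

Lemma Ex_le f g : bounded_measurable f -> bounded_measurable g ->
  (forall w, f w <= g w) -> Ex f <= Ex g.
Proof.
by move=> bf bg fg; apply: le_Rintegral => //; exact: integ.
Qed.

Lemma Ex_norm_le f : bounded_measurable f -> `|Ex f| <= Ex (fun w => `|f w|).
Proof. by move=> bf; apply: le_normr_Rintegral => //; exact: integ. Qed.

Lemma EFin_Ex_indic A f : bounded_measurable (fun w => \1_A w * f w) ->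
  (Ex (fun w => \1_A w * f w))%:E = (\int[P]_(w in A) (f w)%:E)%E.
Proof.
move=> bf; rewrite EFin_Ex// [RHS]integral_mkcond; apply: eq_integral => w _.
by rewrite /patch indicE; case: ifPn => wA; rewrite ?mul1r ?mul0r.
Qed.

Lemma Ex_indic A : measurable A -> Ex \1_A = fine (P A).
Proof. by move=> mA; rewrite /Ex /Rintegral integral_indic// setIT. Qed.

Lemma sqr_Ex_le f : bounded_measurable f -> Ex f ^+ 2 <= Ex (f \* f).
Proof.
move=> bf; rewrite -subr_ge0.
have bc := bounded_measurable_cst (Ex f).
have -> : Ex (f \* f) - Ex f ^+ 2 = Ex ((f \- cst (Ex f)) \* (f \- cst (Ex f))).
  have -> : (f \- cst (Ex f)) \* (f \- cst (Ex f)) =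
     (f \* f \- (fun w => (2 * Ex f) * f w)) \+ cst (Ex f ^+ 2).
    by apply/funext => w /=; ring.
  rewrite ExD ?ExB ?ExZ ?Ex_cst//; [ring|exact: bounded_measurableM|
    exact: bounded_measurableZ| |exact: bounded_measurable_cst].
  apply: bounded_measurableB; [exact: bounded_measurableM|exact: bounded_measurableZ].
by apply: Ex_ge0 => w /=; rewrite -expr2 sqr_ge0.
Qed.

Lemma Ex_markov f A c : bounded_measurable f -> measurable A -> 0 < c ->
  (forall w, 0 <= f w) -> (forall w, A w -> c <= f w) ->
  fine (P A) <= Ex f / c.
Proof.
move=> bf mA c0 f0 fc; rewrite ler_pdivlMr// mulrC -Ex_indic// -ExZ; last first.
  exact: bounded_measurable_indic.
apply: Ex_le => //; first exact/bounded_measurableZ/bounded_measurable_indic.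
move=> w; rewrite indicE; case: (boolP (w \in A)) => [/set_mem wA|_].
  by rewrite mulr1 fc.
by rewrite mulr0.
Qed.

(** The law of the pair agrees with the product of the marginal laws on rectangles, hence
    everywhere; Fubini's theorem then factors the integral. *)
Lemma Ex_indep (U V : T -> R) : bounded_measurable U -> bounded_measurable V ->
  (forall A B : set R, measurable A -> measurable B ->
    P (U @^-1` A `&` V @^-1` B) = (P (U @^-1` A) * P (V @^-1` B))%E) ->
  Ex (U \* V) = Ex U * Ex V.
Proof.
move=> bU bV UV.
have [mU _] := bU; have [mV _] := bV.
pose U' : {RV P >-> R} := HB.pack U (isMeasurableFun.Build _ _ _ _ U mU).
pose V' : {RV P >-> R} := HB.pack V (isMeasurableFun.Build _ _ _ _ V mV).
have mW : measurable_fun setT (fun w => (U w, V w)) by exact: measurable_fun_pair.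
pose W : {RV P >-> (R * R)%type} :=
  HB.pack (fun w => (U w, V w)) (isMeasurableFun.Build _ _ _ _ _ mW).
pose m1 := distribution P U'; pose m2 := distribution P V'.
have E X : measurable X -> (m1 \x m2)%E X = distribution P W X.
  by apply: product_measure_unique => A B mA mB; rewrite -UV.
pose g := fun z : R * R => (z.1 * z.2)%:E.
have mg : measurable_fun setT g.
  by apply/measurable_EFinP; apply: measurable_funM; [exact: measurable_fst|exact: measurable_snd].
have iW : (distribution P W).-integrable setT g.
  apply: integrable_pushforward => //; rewrite preimage_setT.
  by apply: integ; exact: bounded_measurableM.
have iP : (m1 \x m2)%E.-integrable setT g.
  apply/integrableP; split=> //; move/integrableP : iW => [_]; apply: le_lt_trans.
  by rewrite le_eqVlt (@eq_measure_integral _ _ _ _ (distribution P W)) ?eqxx// => A mA _; exact: E.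
have := integral12_prod_meas1 iP.
have -> : (\int[distribution P U' \x distribution P V']_z g z)%E = (Ex (U \* V))%:E.
  rewrite (@eq_measure_integral _ _ _ _ (distribution P W)); last by move=> A mA _; exact: E.
  rewrite integral_distribution//; first by rewrite EFin_Ex//; exact: bounded_measurableM.
  by apply: integ; exact: bounded_measurableM.
have -> : fubini_F (distribution P V') g = fun x => (Ex V * x)%:E.
  apply/funext => x; rewrite /fubini_F/= integral_distribution//=.
  - rewrite -(EFin_Ex (f := fun w => x * V w)) ?ExZ// 1?mulrC//.
    exact: bounded_measurableZ.
  - by apply/measurable_EFinP; exact: mulrl_measurable.
  - by apply: (integ (f := fun w => x * V w)); exact: bounded_measurableZ.
rewrite integral_distribution//=; last 2 first.
  - by apply/measurable_EFinP; exact: mulrl_measurable.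
  - by apply: (integ (f := fun w => Ex V * U w)); exact: bounded_measurableZ.
rewrite -(EFin_Ex (f := fun w => Ex V * U w)) ?ExZ//; last exact: bounded_measurableZ.
by move=> [<-]; rewrite mulrC.
Qed.

End bounded_expectation.

(** * Pinelis' inequality *)

Section past.
Context d d' (T : measurableType d) (E : measurableType d') {R : realType}.
Variables (P : probability T R) (X_ : nat -> T -> E).
Hypothesis mX : forall i, measurable_fun [set: T] (X_ i).
Hypothesis indepX : forall (J : {fset nat}) (A : nat -> set E),
  (forall i, measurable (A i)) ->
  P (\bigcap_(i in [set` J]) (X_ i @^-1` A i)) =
  (\prod_(i <- J) P (X_ i @^-1` A i))%E.

(** A pi-system generating the sigma-algebra of [X_ 0, ..., X_ (m-1)]. Measurability of a map on
    [g_sigma_algebraType (past_cylinders m)] expresses that it depends on the past only. *)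
Definition past_cylinders m : set (set T) :=
  [set C | exists2 A : nat -> set E, (forall i, measurable (A i)) &
    C = \bigcap_(i in [set i | (i < m)%N]) X_ i @^-1` A i].

Lemma measurable_past_cylinders m : past_cylinders m `<=` measurable.
Proof.
move=> _ [A mA ->]; apply: fin_bigcap_measurable; first exact: finite_II.
by move=> i _; rewrite -[_ @^-1` _]setTI; exact: mX.
Qed.

Lemma measurable_past m d2 (T2 : measurableType d2) (f : T -> T2) :
  measurable_fun [set: g_sigma_algebraType (past_cylinders m)] f ->
  measurable_fun [set: T] f.
Proof.
move=> mf _ A mA; have := mf measurableT A mA.
exact: (smallest_sub (@sigma_algebra_measurable _ T) (@measurable_past_cylinders m)).
Qed.

Lemma measurable_present m i : (i < m)%N ->
  measurable_fun [set: g_sigma_algebraType (past_cylinders m)] (X_ i).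
Proof.
move=> im _ A mA; rewrite setTI; apply: sub_sigma_algebra.
exists (fun j => if j == i then A else setT); first by move=> j; case: ifP.
apply/seteqP; split=> [w Aw j /= _|w /(_ i im)/=]; last by rewrite eqxx.
by case: eqP => [->|].
Qed.

(** Both sides are finite measures in [A], namely a restriction and a multiple of [P]. They agree on
    the pi-system of cylinders, hence on the sigma-algebra it generates. *)
Lemma past_indep m (A : set T) (B : set E) :
  <<s past_cylinders m >> A -> measurable B ->
  P (A `&` X_ m @^-1` B) = (P A * P (X_ m @^-1` B))%E.
Proof.
move=> pA mB.
have mXB : measurable (X_ m @^-1` B) by rewrite -[_ @^-1` _]setTI; exact: mX.
have P01 := fin_num_measure P _ mXB.
have c0 : 0 <= fine (P (X_ m @^-1` B)) by rewrite fine_ge0.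
rewrite -[X in (_ * X)%E](fineK P01) muleC.
apply: (g_sigma_algebra_measure_unique (past_cylinders m)
  (@measurable_past_cylinders m) (fun=> setT) _ _ (mrestr P mXB) (mscale (NngNum c0) P)) => //.
- move=> _; exists (fun=> setT) => //; apply/seteqP; split=> //.
- by rewrite bigcup_const.
- move=> _ _ [A1 mA1 ->] [A2 mA2 ->]; exists (fun i => A1 i `&` A2 i).
    by move=> i; exact: measurableI.
  by rewrite -bigcapI.
- move=> _ [C mC ->].
  pose J := [fset i in iota 0 m]%fset.
  have mJ : m \notin J by rewrite !inE mem_iota add0n ltnn andbF.
  have capE (C' : nat -> set E) : \bigcap_(i in [set i | (i < m)%N]) X_ i @^-1` C' i =
     \bigcap_(i in [set` J]) X_ i @^-1` C' i.
    suff -> : [set` J] = [set i | (i < m)%N] by [].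
    by apply/seteqP; split=> i /=; rewrite !inE mem_iota add0n.
  (* Placing [B] at the index [m], which is not in [J], makes the intersection a cylinder over [J]
     and [m], to which [indepX] applies. *)
  pose C' i := if i == m then B else C i.
  have CC' i : i \in J -> C' i = C i.
    by rewrite /C'; case: eqP => // -> mJ'; rewrite mJ' in mJ.
  transitivity (P (\bigcap_(i in [set` (m |` J)%fset]) (X_ i @^-1` C' i))).
    rewrite /= /mrestr capE; congr (P _); apply/seteqP; split=> w /=.
      move=> [Cw Bw] i /=; rewrite in_fset1U => /orP[/eqP ->|iJ].
        by rewrite /C' eqxx.
      by rewrite CC'//; exact: Cw.
    move=> Cw; split.
      by move=> i /= iJ; rewrite -CC'//; apply: Cw; rewrite /= in_fset1U iJ orbT.
    by have := Cw m; rewrite /= fset1U1 /C' eqxx; exact.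
  have mC' i : measurable (C' i) by rewrite /C'; case: ifP.
  rewrite indepX// big_fsetU1//= /mscale/= fineK// capE indepX//.
  rewrite {1}/C' eqxx; congr (_ * _)%E; apply: eq_fbigr => i iJ _.
  by rewrite CC'.
- move=> _; rewrite /= /mrestr setTI.
  exact: le_lt_trans (probability_le1 P mXB) (ltry _).
Qed.

Lemma Ex_past_indep m (f : T -> R) (g : E -> R) :
  measurable_fun [set: g_sigma_algebraType (past_cylinders m)] f ->
  measurable_fun [set: E] g -> bounded_measurable f -> bounded_measurable (g \o X_ m) ->
  Ex P (f \* (g \o X_ m)) = Ex P f * Ex P (g \o X_ m).
Proof.
move=> mf mg bf bg; apply: Ex_indep => // A B mA mB.
have mgB : measurable (g @^-1` B) by rewrite -[_ @^-1` _]setTI; exact: mg.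
rewrite comp_preimage; apply: past_indep => //.
by have := mf measurableT A mA; rewrite setTI.
Qed.

Section pinelis.
Variables (I : finType) (f : I -> E -> R) (s2 : R).
Hypothesis mf : forall i, measurable_fun [set: E] (f i).
Hypothesis f_le2 : forall x, fnorm (fun i => f i x) <= 2.
Hypothesis f_centered : forall m i, Ex P (f i \o X_ m) = 0.
Hypothesis f_var : forall m, \sum_i Ex P ((f i \* f i) \o X_ m) <= s2.

Let S m w i := \sum_(k < m) f i (X_ k w).

Let f_le i x : `|f i x| <= 2.
Proof.
apply: le_trans (f_le2 x); rewrite -ler_sqr ?nnegrE ?fnorm_ge0//.
rewrite real_normK ?num_real// sqr_fnorm (bigD1 i)//= lerDl sumr_ge0// => j _.
exact: sqr_ge0.
Qed.

Let bf m i : bounded_measurable (f i \o X_ m).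
Proof. by split; [exact: measurableT_comp | exists 2 => w; exact: f_le]. Qed.

Let bff m i : bounded_measurable ((f i \* f i) \o X_ m).
Proof. exact: bounded_measurableM (bf m i) (bf m i). Qed.

Let S_le m w : fnorm (S m w) <= 2 * m%:R.
Proof.
rewrite (le_trans (fnorm_sum _ _ _))// (le_trans (ler_sum _ (G := fun=> 2) _))//.
by rewrite sumr_const card_ord mulr_natr.
Qed.

Let mS m i : measurable_fun [set: g_sigma_algebraType (past_cylinders m)] (S m ^~ i).
Proof.
apply: measurable_sum => k; apply: measurableT_comp => //.
exact: measurable_present.
Qed.

Let mnS m : measurable_fun [set: g_sigma_algebraType (past_cylinders m)] (fnorm \o S m).
Proof.
apply: (measurableT_comp (f := @Num.sqrt R)).
  by apply: continuous_measurable_fun; exact: sqrt_continuous.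
apply: measurable_sum => i; exact: measurable_funX.
Qed.

Let mcosh : measurable_fun setT (@cosh R).
Proof.
apply: measurable_funM; last exact: measurable_cst.
apply: measurable_funD; first exact: measurable_expR.
by apply: measurableT_comp; [exact: measurable_expR|exact: oppr_measurable].
Qed.

Let msinh : measurable_fun setT (@sinh R).
Proof.
apply: measurable_funM; last exact: measurable_cst.
apply: measurable_funB; first exact: measurable_expR.
by apply: measurableT_comp; [exact: measurable_expR|exact: oppr_measurable].
Qed.

Let cosh_le m w : `|cosh (fnorm (S m w))| <= expR (2 * m%:R).
Proof.
rewrite gtr0_norm ?cosh_gt0// /cosh ler_pdivrMr//.
rewrite [leRHS](_ : _ = expR (2 * m%:R) + expR (2 * m%:R)); last by ring.
rewrite lerD// ler_expR//.
by rewrite (le_trans _ (S_le m w))// lerNl (le_trans _ (fnorm_ge0 _))// oppr_le0 fnorm_ge0.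
Qed.

(** The gradient of [cosh (fnorm x)] at [x = S m w], that is, the coefficient of the linear term in
    [cosh_step]. At [S m w = 0] it is 0, by the convention on division. *)
Let psi m i w := sinh (fnorm (S m w)) / fnorm (S m w) * S m w i.

Let mpsi m i : measurable_fun [set: g_sigma_algebraType (past_cylinders m)] (psi m i).
Proof.
apply: measurable_funM => //; apply: measurable_funM.
  exact: measurableT_comp.
have -> : (fun w => (fnorm (S m w))^-1) = (fun w => (fnorm (S m w)) `^ (-1)).
  by apply/funext => w; rewrite powR_inv1// fnorm_ge0.
by apply: (measurableT_comp (f := (@powR R) ^~ (-1))) => //; exact: measurable_powR.
Qed.

Lemma bounded_measurable_cosh_sum m : bounded_measurable (cosh \o (fnorm \o S m)).
Proof.
split; last by exists (expR (2 * m%:R)) => w; exact: cosh_le.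
by apply: (@measurable_past m); exact: measurableT_comp.
Qed.

Let bpsi m i : bounded_measurable (psi m i).
Proof.
split; first by apply: (@measurable_past m).
exists (expR (2 * m%:R)) => w; rewrite (le_trans _ (cosh_le m w))//.
rewrite /psi; set a := fnorm _; have a0 : 0 <= a := fnorm_ge0 _.
have Sa : `|S m w i| <= a.
  rewrite -ler_sqr ?nnegrE// real_normK ?num_real// sqr_fnorm (bigD1 i)//=.
  by rewrite lerDl sumr_ge0// => j _; exact: sqr_ge0.
have sh0 : 0 <= sinh a.
  by apply: divr_ge0 => //; have := expRB_expRN_ge a0; lra.
have [a00|a00] := eqVneq a 0; first by rewrite a00 invr0 mulr0 mul0r normr0.
have a_gt0 : 0 < a by rewrite lt_neqAle eq_sym a00.
rewrite normrM (normrM (sinh a)) normfV (ger0_norm sh0) (ger0_norm a0) (gtr0_norm (cosh_gt0 _)).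
apply: (@le_trans _ _ (sinh a / a * a)).
  by apply: ler_wpM2l => //; exact: divr_ge0.
by rewrite divfK// /sinh /cosh ler_pM2r ?invr_gt0//; have := expR_ge0 (- a); lra.
Qed.

(** [cosh_step] is applied pointwise with [a] the norm of [S m], [b] the norm of the new vector and
    [c] their inner product. The linear term has mean 0, since [psi m] depends on the past and the
    new vector is centred and independent of it. By the same independence the quadratic term factors
    and contributes at most [3 / 2 * s2]. *)
Lemma Ex_cosh_sum_le m : Ex P (cosh \o (fnorm \o S m)) <= (1 + 3 / 2 * s2) ^+ m.
Proof.
elim: m => [|m ih].
  have -> : cosh \o (fnorm \o S 0) = fun=> 1.
    apply/funext => w /=; rewrite (_ : S 0 w = fun=> 0) ?fnorm0 ?cosh0//.
    by apply/funext => i; rewrite /S big_ord0.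
  by rewrite Ex_cst expr0.
pose C := cosh \o (fnorm \o S m).
pose D := C \+ (fun w => 3 / 2 * \sum_i (C \* ((f i \* f i) \o X_ m)) w) \+
          (fun w => \sum_i (psi m i \* (f i \o X_ m)) w).
have bC : bounded_measurable C by exact: bounded_measurable_cosh_sum.
have b1 i : bounded_measurable (C \* ((f i \* f i) \o X_ m)) by exact: bounded_measurableM.
have b2 i : bounded_measurable (psi m i \* (f i \o X_ m)) by exact: bounded_measurableM.
have b1s : bounded_measurable (fun w => \sum_i (C \* ((f i \* f i) \o X_ m)) w).
  exact: bounded_measurable_sum.
have b2s : bounded_measurable (fun w => \sum_i (psi m i \* (f i \o X_ m)) w).
  exact: bounded_measurable_sum.
have b1z := bounded_measurableZ (3 / 2) b1s.
have bD : bounded_measurable D by apply: bounded_measurableD => //; exact: bounded_measurableD.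
have le_D w : (cosh \o (fnorm \o S m.+1)) w <= D w.
  pose Y i := f i (X_ m w).
  have SE : S m.+1 w = S m w \+ Y by apply/funext => i; rewrite /S big_ord_recr.
  rewrite /= SE; apply: (le_trans (cosh_step (fnorm_ge0 (S m w)) _ (fdot_le _ Y) _)).
  - by rewrite fnorm_ge0 f_le2.
  - exact: sqr_fnormD.
  rewrite /D /C /= sqr_fnorm mulrDr mulr1 -!addrA lerD2l lerD//.
    by rewrite mulrCA ler_pM2l// mulr_sumr ler_sum.
  rewrite /fdot mulr_sumr ler_sum// => i _.
  by rewrite /psi /Y mulrA.
apply: (le_trans (Ex_le P (bounded_measurable_cosh_sum m.+1) bD le_D)).
rewrite /D !ExD//; last exact: bounded_measurableD.
rewrite ExZ// !Ex_sum// [X in _ + X <= _]big1 ?addr0; last first.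
  by move=> i _; rewrite (@Ex_past_indep m)// f_centered mulr0.
have -> : \sum_i Ex P (C \* ((f i \* f i) \o X_ m)) =
    Ex P C * \sum_i Ex P ((f i \* f i) \o X_ m).
  rewrite mulr_sumr; apply: eq_bigr => i _; apply: Ex_past_indep => //.
  - exact: measurableT_comp.
  - exact: measurable_funM.
have C0 : 0 <= Ex P C by apply: Ex_ge0 => w; exact/ltW/cosh_gt0.
have s20 : 0 <= s2.
  apply: le_trans (f_var 0); apply: sumr_ge0 => i _; apply: Ex_ge0 => w /=.
  by rewrite -expr2 sqr_ge0.
rewrite exprSr; apply: (@le_trans _ _ (Ex P C * (1 + 3 / 2 * s2))).
  by rewrite mulrDr mulr1 lerD2l mulrCA; apply: ler_wpM2l => //; exact: ler_wpM2l.
apply: ler_wpM2r => //; apply: addr_ge0 => //; exact: mulr_ge0.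
Qed.

End pinelis.

(** Markov's inequality for the hyperbolic cosine of [l] times the norm. Multiplying the vectors by
    [l] brings them into the ball of radius 2; the prefactor 2 comes from [expR a <= 2 * cosh a],
    and the exponent from [1 + x <= expR x]. The scale [l] is left free, to be optimized in
    [deviation_bound_spec]. *)
Lemma pinelis (I : finType) (f : I -> E -> R) (b s2 l r : R) m :
  (forall i, measurable_fun [set: E] (f i)) ->
  (forall x, fnorm (fun i => f i x) <= b) ->
  (forall m i, Ex P (f i \o X_ m) = 0) ->
  (forall m, \sum_i Ex P ((f i \* f i) \o X_ m) <= s2) ->
  0 <= l -> l * b <= 2 ->
  fine (P [set w | r < fnorm (fun i => \sum_(k < m) f i (X_ k w))]) <=
    2 * expR (- (l * r) + 3 / 2 * (l ^+ 2 * (m%:R * s2))).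
Proof.
move=> mf fb f0 f2 l0 lb.
have bf k i : bounded_measurable (f i \o X_ k).
  split; first exact: measurableT_comp.
  exists b => w; apply: le_trans (fb (X_ k w)).
  rewrite -ler_sqr ?nnegrE ?fnorm_ge0// real_normK ?num_real// sqr_fnorm.
  by rewrite (bigD1 i)//= lerDl sumr_ge0// => j _; exact: sqr_ge0.
pose g i x := l * f i x.
have mg i : measurable_fun setT (g i) by exact: measurable_funM.
have gb x : fnorm (fun i => g i x) <= 2.
  by rewrite fnormZ ger0_norm// (le_trans _ lb)// ler_wpM2l.
have g0 k i : Ex P (g i \o X_ k) = 0 by rewrite ExZ ?f0 ?mulr0//; exact: bf.
have g2 k : \sum_i Ex P ((g i \* g i) \o X_ k) <= l ^+ 2 * s2.
  apply: le_trans (ler_wpM2l (sqr_ge0 l) (f2 k)).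
  rewrite mulr_sumr ler_sum// => i _.
  rewrite -ExZ; last exact: bounded_measurableM (bf k i) (bf k i).
  rewrite (_ : (g i \* g i) \o X_ k = fun w => l ^+ 2 * ((f i \* f i) \o X_ k) w)//.
  by apply/funext => w; rewrite /g/=; ring.
have := Ex_cosh_sum_le mg gb g0 g2 m.
set S := fun w i => \sum_(k < m) g i (X_ k w) => coshS.
have SE w : fnorm (S w) = l * fnorm (fun i => \sum_(k < m) f i (X_ k w)).
  rewrite -[X in X * _](ger0_norm l0) -fnormZ; congr fnorm; apply/funext => i.
  by rewrite /S /g mulr_sumr.
have bC := bounded_measurable_cosh_sum mg gb m.
have mf' : measurable_fun setT (fun w => fnorm (fun i => \sum_(k < m) f i (X_ k w))).
  apply: (measurableT_comp (f := @Num.sqrt R)).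
    by apply: continuous_measurable_fun; exact: sqrt_continuous.
  apply: measurable_sum => i; apply: measurable_funX; apply: measurable_sum => k.
  exact: measurableT_comp.
have mA : measurable [set w | r < fnorm (fun i => \sum_(k < m) f i (X_ k w))].
  have := mf' measurableT _ (measurable_itv `]r, +oo[); rewrite setTI.
  by congr measurable; apply/seteqP; split=> w /=; rewrite in_itv/= andbT.
have c0 : 0 < expR (l * r) / 2 by rewrite divr_gt0// expR_gt0.
have lS w : r < fnorm (fun i => \sum_(k < m) f i (X_ k w)) ->
    expR (l * r) / 2 <= cosh (fnorm (S w)).
  move=> rS; rewrite ler_pdivrMr// (mulrC (cosh _)) (le_trans _ (expR_le_2cosh _))//.
  by rewrite ler_expR SE ler_wpM2l// ltW.
have := Ex_markov P bC mA c0 (fun w => ltW (cosh_gt0 _)) lS.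
move=> /le_trans; apply; rewrite ler_pdivrMr//.
rewrite [leRHS](_ : _ = expR (3 / 2 * (l ^+ 2 * (m%:R * s2)))); last first.
  by rewrite expRD expRN; field; rewrite gt_eqF// expR_gt0.
apply: (le_trans coshS); rewrite [X in expR X](_ : _ = m%:R * (3 / 2 * (l ^+ 2 * s2)));
  last by ring.
have s20 : 0 <= s2.
  apply: le_trans (f2 0); apply: sumr_ge0 => i _; apply: Ex_ge0 => w /=.
  by rewrite -expr2 sqr_ge0.
rewrite expRM_natl lerXn2r ?nnegrE ?expR_ge0 ?expR_ge1Dx//.
apply: addr_ge0 => //; apply: mulr_ge0 => //; apply: mulr_ge0 => //; exact: sqr_ge0.
Qed.

End past.

(** * Hilbert spaces and Hilbert-Schmidt norms *)

Section inner_product.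
Context {R : realType} {H : completeNormedModType R} (dot : {dot H for idfun}).
Hypothesis dot_norm : forall x : H, dot x x = `|x| ^+ 2.
Implicit Types x y z : H.

Lemma dotC x y : dot x y = dot y x.
Proof. by rewrite (hermC dot) expr0 mul1r. Qed.

Lemma dotDl x y z : dot (x + y) z = dot x z + dot y z.
Proof. exact: linearDl. Qed.

Lemma dotBl x y z : dot (x - y) z = dot x z - dot y z.
Proof. exact: linearBl. Qed.

Lemma dotZl a x z : dot (a *: x) z = a * dot x z.
Proof. exact: linearZl_LR. Qed.

Lemma dot0l z : dot 0 z = 0. Proof. exact: linear0l. Qed.

Lemma dotDr x y z : dot z (x + y) = dot z x + dot z y.
Proof. by rewrite !(dotC z) dotDl. Qed.

Lemma dotBr x y z : dot z (x - y) = dot z x - dot z y.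
Proof. by rewrite !(dotC z) dotBl. Qed.

Lemma dotZr a x z : dot z (a *: x) = a * dot z x.
Proof. by rewrite !(dotC z) dotZl. Qed.

Lemma dot0r z : dot z 0 = 0. Proof. by rewrite dotC dot0l. Qed.

Lemma dot_suml (J : Type) (s : seq J) (Q : pred J) (f : J -> H) z :
  dot (\sum_(j <- s | Q j) f j) z = \sum_(j <- s | Q j) dot (f j) z.
Proof. exact: linear_sumlz. Qed.

Lemma dot_sumr (J : Type) (s : seq J) (Q : pred J) (f : J -> H) z :
  dot z (\sum_(j <- s | Q j) f j) = \sum_(j <- s | Q j) dot z (f j).
Proof. by rewrite dotC dot_suml; apply: eq_bigr => j _; rewrite dotC. Qed.

Lemma sqr_normD x y : `|x + y| ^+ 2 = `|x| ^+ 2 + 2 * dot x y + `|y| ^+ 2.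
Proof. by rewrite -!dot_norm dotDl !dotDr (dotC y x); ring. Qed.

Lemma sqr_normB x y : `|x - y| ^+ 2 = `|x| ^+ 2 - 2 * dot x y + `|y| ^+ 2.
Proof. by rewrite -!dot_norm dotBl !dotBr (dotC y x); ring. Qed.

Lemma dot_polar x y : dot x y = (`|x + y| ^+ 2 - `|x - y| ^+ 2) / 4.
Proof. by rewrite sqr_normD sqr_normB; field. Qed.

Lemma cvg_dot (U : Type) (F : set_system U) (FF : Filter F) (u v : U -> H) x y :
  u z @[z --> F] --> x -> v z @[z --> F] --> y -> dot (u z) (v z) @[z --> F] --> dot x y.
Proof.
move=> ux vy; under eq_fun do rewrite dot_polar.
rewrite dot_polar; apply: cvgMl; apply: cvgB.
  rewrite expr2; under eq_fun do rewrite expr2.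
  by apply: cvgM; apply: cvg_norm; apply: cvgD.
rewrite expr2; under eq_fun do rewrite expr2.
by apply: cvgM; apply: cvg_norm; apply: cvgB.
Qed.

Lemma continuous_dotl y : continuous (dot ^~ y).
Proof. by move=> x; apply: cvg_dot => //; exact: cvg_cst. Qed.

Lemma dot_le x y : `|dot x y| <= `|x| * `|y|.
Proof.
have [->|y0] := eqVneq y 0; first by rewrite dot0r !normr0 mulr0.
have yy : 0 < dot y y by rewrite dot_norm exprn_gt0// normr_gt0.
rewrite -ler_sqr ?nnegrE ?mulr_ge0// real_normK ?num_real// exprMn -!dot_norm.
have : 0 <= dot y y * `|x - (dot x y / dot y y) *: y| ^+ 2.
  by rewrite mulr_ge0 ?sqr_ge0// ltW.
rewrite sqr_normB dotZr normrZ exprMn real_normK ?num_real// -!dot_norm.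
set q := dot y y in yy *; rewrite (_ : q * _ = dot x x * q - dot x y ^+ 2) ?subr_ge0//.
by field; rewrite gt_eqF.
Qed.

Lemma norm_le_dot x c : 0 <= c -> (forall y, `|dot x y| <= c * `|y|) -> `|x| <= c.
Proof.
move=> c0 /(_ x); rewrite dot_norm ger0_norm ?sqr_ge0// expr2.
have [->|x0] := eqVneq x 0; first by rewrite normr0.
by rewrite ler_pM2r// normr_gt0.
Qed.

Section orthonormal_padded.
Context {I : finType}.
Variable b : I -> H.
(* An orthonormal family in which some of the vectors may be [0]. *)
Hypothesis onb : forall i j, dot (b i) (b j) = ((i == j) && (b i != 0))%:R.

Definition fproj x := \sum_i dot x (b i) *: b i.

Lemma dot_fproj x y : dot (fproj x) y = \sum_i dot x (b i) * dot y (b i).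
Proof.
by rewrite dot_suml; apply: eq_bigr => i _; rewrite dotZl (dotC y).
Qed.

Lemma dot_fprojC x y : dot (fproj x) y = dot x (fproj y).
Proof.
by rewrite (dotC x) !dot_fproj; apply: eq_bigr => i _; rewrite mulrC.
Qed.

Lemma fprojP a x y : fproj (a *: x + y) = a *: fproj x + fproj y.
Proof.
rewrite /fproj scaler_sumr -big_split/=; apply: eq_bigr => i _.
by rewrite dotDl dotZl scalerDl scalerA.
Qed.

Lemma dot_fproj_id x i : dot (fproj x) (b i) = dot x (b i).
Proof.
rewrite dot_fproj (bigD1 i)//= big1 ?addr0 => [|j ji]; last first.
  by rewrite (onb i j) eq_sym (negbTE ji) mulr0.
rewrite onb eqxx/=; have [->|_] := eqVneq (b i) 0; first by rewrite dot0r mulr0.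
by rewrite mulr1.
Qed.

Lemma sqr_norm_fproj x : `|fproj x| ^+ 2 = \sum_i dot x (b i) ^+ 2.
Proof.
rewrite -dot_norm dot_fproj; apply: eq_bigr => i _.
by rewrite dot_fproj_id expr2.
Qed.

Lemma dotB_fproj x i : dot (x - fproj x) (b i) = 0.
Proof. by rewrite dotBl dot_fproj_id subrr. Qed.

Lemma sqr_normB_fproj x : `|x - fproj x| ^+ 2 = `|x| ^+ 2 - \sum_i dot x (b i) ^+ 2.
Proof.
rewrite sqr_normB sqr_norm_fproj (dotC x) dot_fproj.
under eq_bigr do rewrite -expr2; ring.
Qed.

Lemma bessel x : \sum_i dot x (b i) ^+ 2 <= `|x| ^+ 2.
Proof. by rewrite -subr_ge0 -sqr_normB_fproj sqr_ge0. Qed.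

Lemma fproj_best x (c : I -> R) : `|x - fproj x| <= `|x - \sum_i c i *: b i|.
Proof.
set v := \sum_i _.
rewrite -ler_sqr ?nnegrE//.
have -> : x - v = (x - fproj x) + (fproj x - v) by rewrite addrA subrK.
rewrite [leRHS]sqr_normD dotBr dotC dot_suml big1; last first.
  by move=> i _; rewrite dotZl (dotC (b i)) dotB_fproj mulr0.
rewrite dotC dot_suml big1 ?subr0 ?mulr0 ?addr0 ?lerDl ?sqr_ge0// => i _.
by rewrite dotZl (dotC (b i)) dotB_fproj mulr0.
Qed.

End orthonormal_padded.
End inner_product.

(** * Coordinates in the basis chosen by [hs_norm] *)

Section basis.
Context {R : realType} {H : completeNormedModType R} (dot : {dot H for idfun}).
Hypothesis dot_norm : forall x : H, dot x x = `|x| ^+ 2.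
Implicit Types x y z : H.

(** Padding with zeros lets one sequence indexed by [nat] serve in every dimension, and lets a
    countable basis be numbered by an injection that is not onto. *)
Definition padded_basis (b : nat -> H) :=
  (forall i j, dot (b i) (b j) = ((i == j) && (b i != 0))%:R) /\
  (forall x, fproj dot (fun i : 'I_n => b i) x @[n --> \oo] --> x).

(** The second clause ties [b] to the basis that [hs_norm] picks, so that Hilbert-Schmidt norms are
    sums along [b]. The condition [A 0 = 0] removes the contribution of the padding. *)
Definition hs_basis (b : nat -> H) := padded_basis b /\
  forall A : H -> H, A 0 = 0 ->
    hs_norm dot A = sqrte (\sum_(i <oo) (`|A (b i)| ^+ 2)%:E)%E.

(** If the choice of a basis fails, [xget] returns [set0] and the sum is empty; then [rho] vanishes
    identically, and both claims of the theorem hold trivially. *)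
Lemma hs_norm_junk (A : H -> H) :
  ~ orthonormal_basis dot (xget set0 (orthonormal_basis dot)) -> hs_norm dot A = 0%E.
Proof.
move=> nE; rewrite /hs_norm; case: xgetP nE => [E -> //|_ _].
by rewrite esum_set0 /= sqrtr0.
Qed.

(** Distinct elements of [E] are at distance [sqrt 2], so points of the countable dense set chosen
    within [1 / 2] of them are distinct. *)
Lemma orthonormal_countable (E : set H) : @separable R H ->
  (forall e, E e -> dot e e = 1) ->
  (forall e f, E e -> E f -> e <> f -> dot e f = 0) -> countable E.
Proof.
move=> [D cD dD] E1 E0.
pose g e := xget 0 [set v | D v /\ `|e - v| < 2^-1].
have gP e : D (g e) /\ `|e - g e| < 2^-1.
  rewrite /g; case: xgetP => [v _ []//|no].
  have [] := dD (ball e 2^-1) _ (ball_open _ _); first by exists e; exact: ballxx.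
  by move=> v []; rewrite -ball_normE /= => ev Dv; have := no v; case.
have /countable_injP[f finj] := cD.
apply/countable_injP; exists (f \o g) => e1 e2 /set_mem Ee1 /set_mem Ee2 /= fg.
have {fg} gg : g e1 = g e2 by apply: finj => //; apply: mem_set; have [] := gP e1; have [] := gP e2.
apply: contrapT => ne.
have [_ h1] := gP e1; have [_ h2] := gP e2.
have : `|e1 - e2| < 1.
  have -> : e1 - e2 = (e1 - g e1) - (e2 - g e2) by rewrite gg opprB addrA subrK.
  by rewrite (le_lt_trans (ler_normB _ _))//; lra.
apply/negP; rewrite -leNgt -ler_sqr ?nnegrE// (sqr_normB dot_norm).
by rewrite E0// -!dot_norm !E1//; lra.
Qed.

Lemma exists_hs_basis : @separable R H ->
  orthonormal_basis dot (xget set0 (orthonormal_basis dot)) ->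
  exists b, hs_basis b.
Proof.
move=> sepH; set E := xget _ _ => -[E1 E0 Edense].
have /countable_injP[f finj] := orthonormal_countable sepH E1 E0.
(* The basis vector with number [n], and 0 if no vector has that number. *)
pose b n := xget 0 [set e | E e /\ f e = n].
have bf e : E e -> b (f e) = e.
  move=> Ee; rewrite /b; case: xgetP => [v _ [Ev fv]|/(_ e)]; last by case.
  by apply: finj => //; exact: mem_set.
have bP n : b n != 0 -> E (b n) /\ f (b n) = n.
  by rewrite /b; case: xgetP => [v _ //|_]; rewrite eqxx.
have onb i j : dot (b i) (b j) = ((i == j) && (b i != 0))%:R.
  have [->|bi] := eqVneq (b i) 0; first by rewrite dot0l andbF.
  have [bj0|bj] := eqVneq (b j) 0.
    rewrite bj0 dot0r; have [ij|//] := eqVneq i j.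
    by move: bi; rewrite ij bj0 eqxx.
  have [Ebi fbi] := bP _ bi; have [Ebj fbj] := bP _ bj.
  have [<-|ij] := eqVneq i j; first by rewrite E1.
  by rewrite E0// => bij; move: ij; rewrite -fbi -fbj bij eqxx.
have onbn n (i j : 'I_n) : dot (b i) (b j) = ((i == j) && (b i != 0))%:R by exact: onb.
exists b; split; first split=> //.
- move=> x; apply/cvgrPdist_le => /= eps eps0.
  have [] := Edense (ball x eps) _ (ball_open _ _); first by exists x; exact: ballxx.
  move=> v []; rewrite -ball_normE/= => xv [s [c [sE vE]]].
  near=> n.
  have fn e : e \in s -> (f e < n)%N.
    move=> es; apply: (@leq_ltn_trans (\max_(e <- s) f e)).
      exact: leq_bigmax_seq.
    by near: n; exact: nbhs_infty_gt.
  apply: le_trans (ltW xv).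
  (* Once [n] exceeds the numbers of all vectors in [s], the approximant [v] is a combination of the
     first [n] vectors, and the projection is at least as close to [x]. Repeated entries of [s] have
     their coefficients collected. *)
  suff -> : v = \sum_(i < n) (\sum_(e <- s | f e == i) c e) *: b i by exact: fproj_best.
  under eq_bigr do rewrite scaler_suml.
  rewrite (exchange_big_dep predT)//= vE big_seq [RHS]big_seq.
  apply: eq_bigr => e es.
  by rewrite (big_pred1 (Ordinal (fn e es))) /= ?bf//; exact: sE.
- move=> A A0; rewrite /hs_norm -/E; congr sqrte.
  pose J := [set n | b n != 0].
  have EJ : E = b @` J.
    apply/seteqP; split=> [e Ee|_ [n bn <-]]; last by have [] := bP _ bn.
    exists (f e); rewrite ?bf//; rewrite /J/= bf//.
    by apply/eqP => e0; have := E1 _ Ee; rewrite e0 dot0l => /esym/eqP; rewrite oner_eq0.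
  have bJ : set_inj J b.
    move=> i j /set_mem bi /set_mem bj bij; have [_ <-] := bP _ bi.
    by have [_ <-] := bP _ bj; rewrite bij.
  rewrite EJ esum_image// esum_mkcond nneseries_esumT; last by move=> n; rewrite lee_fin sqr_ge0.
  apply: eq_esum => n _; case: ifPn => // /negP bn.
  have [->|bn0] := eqVneq (b n) 0; first by rewrite A0 normr0 expr0n.
  by exfalso; apply: bn; exact: mem_set.
Unshelve. all: by end_near. Qed.

Section linear_map.
Variables (A : H -> H) (linA : linear A).

Lemma lin0 : A 0 = 0.
Proof. by have := linA (-1) 0 0; rewrite scaler0 addr0 scaleN1r addNr. Qed.

Lemma linD x y : A (x + y) = A x + A y.
Proof. by have := linA 1 x y; rewrite !scale1r. Qed.

Lemma linZ a x : A (a *: x) = a *: A x.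
Proof. by have := linA a x 0; rewrite !addr0 lin0 addr0. Qed.

Lemma linB x y : A (x - y) = A x - A y.
Proof. by rewrite -scaleN1r linD linZ scaleN1r. Qed.

Lemma lin_sum (J : Type) (s : seq J) (Q : pred J) (f : J -> H) :
  A (\sum_(j <- s | Q j) f j) = \sum_(j <- s | Q j) A (f j).
Proof. exact: (big_morph A linD lin0). Qed.
End linear_map.

Section coordinates.
Variables (b : nat -> H) (hb : hs_basis b).

Let onb n (i j : 'I_n) : dot (b i) (b j) = ((i == j) && (b i != 0))%:R.
Proof. by case: hb => -[onb _] _; exact: onb. Qed.

Let fproj_cvg x : fproj dot (fun i : 'I_n => b i) x @[n --> \oo] --> x.
Proof. by case: hb => -[_ cvgb] _; exact: cvgb. Qed.

Lemma parseval x y : \sum_(i < n) dot x (b i) * dot y (b i) @[n --> \oo] --> dot x y.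
Proof.
under eq_fun do rewrite -dot_fproj.
by apply: cvg_dot => //; exact: cvg_cst.
Qed.

Lemma parseval_norm x : \sum_(i < n) dot x (b i) ^+ 2 @[n --> \oo] --> `|x| ^+ 2.
Proof.
by rewrite -dot_norm; under eq_fun do under eq_bigr do rewrite expr2; exact: parseval.
Qed.

Lemma bessel_nat n x : \sum_(i < n) dot x (b i) ^+ 2 <= `|x| ^+ 2.
Proof. exact: bessel. Qed.

(** The finite sections of the matrix of [A]. A bound on their Frobenius norms, uniform in [n],
    plays the role of a bound on the Hilbert-Schmidt norm throughout. *)
Definition corner n (A : H -> H) (ij : 'I_n * 'I_n) := dot (A (b ij.1)) (b ij.2).

Lemma fnorm_prod n (u v : 'I_n -> R) : fnorm (fun ij : 'I_n * 'I_n => u ij.1 * v ij.2) =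
  fnorm u * fnorm v.
Proof.
rewrite /fnorm -sqrtrM ?sumr_ge0// => [|i _]; last exact: sqr_ge0.
congr Num.sqrt; rewrite mulr_suml; under [RHS]eq_bigr do rewrite mulr_sumr.
by rewrite pair_bigA/=; apply: eq_bigr => i _; rewrite exprMn.
Qed.

Lemma fnorm_coord_le n x : fnorm (fun i : 'I_n => dot x (b i)) <= `|x|.
Proof. by rewrite fnorm_le// bessel_nat. Qed.

(** On the projections of [x] and [y] to the first [n] basis vectors the bilinear form is a
    Frobenius product of the corner with a rank-one matrix; Cauchy-Schwarz and continuity do the
    rest. *)
Lemma op_le (A : H -> H) h x : linear A -> continuous A ->
  (forall n, fnorm (@corner n A) <= h) -> `|A x| <= h * `|x|.
Proof.
move=> linA cA Ah.
have h0 : 0 <= h := le_trans (fnorm_ge0 _) (Ah 0%N).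
apply: (norm_le_dot dot_norm); first by rewrite mulr_ge0.
move=> y.
have cvgA : dot (A (fproj dot (fun i : 'I_n => b i) x)) (fproj dot (fun i : 'I_n => b i) y)
    @[n --> \oo] --> dot (A x) y.
  by apply: cvg_dot => //; apply: continuous_cvg; [exact: cA|exact: fproj_cvg].
apply: (cvgr_to_le (cvg_norm cvgA)); near=> n.
rewrite /fproj lin_sum// dot_suml.
under eq_bigr => i _ do rewrite linZ// dotZl dot_sumr.
rewrite [X in `|X|](_ : _ = fdot (@corner n A)
    (fun ij => dot x (b ij.1) * dot y (b ij.2))); last first.
  rewrite /fdot -(pair_bigA _ (fun i j => corner A (i, j) * (dot x (b i) * dot y (b j))))/=.
  apply: eq_bigr => i _; rewrite mulr_sumr; apply: eq_bigr => j _.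
  by rewrite dotZr /corner/=; ring.
apply: (le_trans (fdot_le _ _)).
rewrite (@fnorm_prod n (fun i => dot x (b i)) (fun j => dot y (b j))) -mulrA.
apply: ler_pM; rewrite ?mulr_ge0 ?fnorm_ge0//.
by apply: ler_pM; rewrite ?fnorm_ge0 ?fnorm_coord_le.
Unshelve. all: by end_near. Qed.

Lemma fnorm_corner_le n (A : H -> H) :
  fnorm (@corner n A) ^+ 2 <= \sum_(i < n) `|A (b i)| ^+ 2.
Proof.
rewrite sqr_fnorm -(pair_bigA _ (fun i j => corner A (i, j) ^+ 2))/=.
by apply: ler_sum => i _; exact: (bessel_nat n (A (b i))).
Qed.

Let sum_le_hs n (A : H -> H) : A 0 = 0 ->
  ((Num.sqrt (\sum_(i < n) `|A (b i)| ^+ 2))%:E <= hs_norm dot A)%E.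
Proof.
move=> A0; have [_ ->//] := hb.
rewrite -[X in (X <= _)%E]/(sqrte (\sum_(i < n) `|A (b i)| ^+ 2)%:E).
rewrite lee_sqrt; last by apply: nneseries_ge0 => i _ _; rewrite lee_fin sqr_ge0.
rewrite -sumEFin -(big_mkord xpredT (fun i => (`|A (b i)| ^+ 2)%:E)).
by apply: nneseries_lim_ge => i _; rewrite lee_fin sqr_ge0.
Qed.

Lemma corner_le_hs n (A : H -> H) : A 0 = 0 ->
  ((fnorm (@corner n A))%:E <= hs_norm dot A)%E.
Proof.
move=> A0; apply: le_trans (sum_le_hs n A0); rewrite lee_fin.
by rewrite -[leLHS]ger0_norm ?fnorm_ge0// -sqrtr_sqr ler_sqrt ?sumr_ge0 ?fnorm_corner_le.
Qed.

Lemma hs_norm_finite_bound (A : H -> H) : A 0 = 0 -> (hs_norm dot A < +oo)%E ->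
  exists2 h, 0 <= h & forall n, \sum_(i < n) `|A (b i)| ^+ 2 <= h ^+ 2.
Proof.
move=> A0 Aoo; exists (fine (hs_norm dot A)); first by rewrite fine_ge0// sqrte_ge0.
move=> n; have := sum_le_hs n A0.
rewrite -[X in (_ <= X)%E]fineK; last by rewrite ge0_fin_numE// sqrte_ge0.
rewrite lee_fin -ler_sqr ?nnegrE ?fine_ge0 ?sqrtr_ge0 ?sqrte_ge0// sqr_sqrtr//.
by apply: sumr_ge0 => i _; exact: sqr_ge0.
Qed.

(** For a fixed number [n] of basis vectors, Parseval recovers [|A (b i)|^2] from [m] columns as [m]
    grows. The [n] by [m] block lies in the corner of size [m] as soon as [n <= m]. *)
Lemma hs_norm_le (A : H -> H) h : A 0 = 0 ->
  (forall n, fnorm (@corner n A) <= h) -> (hs_norm dot A <= h%:E)%E.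
Proof.
move=> A0 Ah; have [_ ->//] := hb.
have h0 : 0 <= h := le_trans (fnorm_ge0 _) (Ah 0%N).
rewrite (_ : h%:E = sqrte (h ^+ 2)%:E); last by rewrite /= sqrtr_sqr ger0_norm.
rewrite lee_sqrt ?lee_fin ?sqr_ge0//.
apply: lime_le; first by apply: is_cvg_nneseries => i _ _; rewrite lee_fin sqr_ge0.
apply: nearW => n; rewrite sumEFin lee_fin big_mkord.
have cvgn : \sum_(i < n) \sum_(j < m) dot (A (b i)) (b j) ^+ 2 @[m --> \oo] -->
    \sum_(i < n) `|A (b i)| ^+ 2.
  apply: cvg_sumr => i; exact: parseval_norm.
apply: (cvgr_to_le cvgn); near=> m.
have nm : (n <= m)%N by near: m; exact: nbhs_infty_ge.
have := Ah m; rewrite fnorm_le// => /(le_trans _); apply.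
rewrite -(pair_bigA _ (fun i j => corner A (i, j) ^+ 2))/=.
rewrite -(big_mkord xpredT (fun i => \sum_(j < m) dot (A (b i)) (b j) ^+ 2)).
rewrite -(big_mkord xpredT (fun i => \sum_(j < m) dot (A (b i)) (b j) ^+ 2)).
by rewrite [leRHS](big_cat_nat _ nm)//= lerDl !sumr_ge0// => i _; rewrite sumr_ge0// => j _;
  exact: sqr_ge0.
Unshelve. all: by end_near. Qed.

End coordinates.
End basis.

(** * Spectral theory of nonnegative Hilbert-Schmidt operators *)

Section spectral.
Context {R : realType} {H : completeNormedModType R} (dot : {dot H for idfun}).
Hypothesis dot_norm : forall x : H, dot x x = `|x| ^+ 2.
Variables (b : nat -> H) (hb : hs_basis dot b).
Implicit Types (x y z : H) (A B : H -> H).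

(** The last clause is the Hilbert-Schmidt condition in the basis [b]; it is the substitute for
    compactness in the spectral arguments. *)
Definition psd_hs A := [/\ linear A, continuous A,
  forall x y, dot (A x) y = dot x (A y), forall x, 0 <= dot (A x) x &
  exists2 h, 0 <= h & forall n, \sum_(i < n) `|A (b i)| ^+ 2 <= h ^+ 2].

Lemma psd_hs_bounded A : psd_hs A -> exists2 h, 0 <= h & forall x, `|A x| <= h * `|x|.
Proof.
move=> [linA cA _ _ [h h0 Ah]]; exists h => // x.
apply: (op_le dot_norm hb) => // n; rewrite -ler_sqr ?nnegrE ?fnorm_ge0//.
exact: le_trans (fnorm_corner_le dot_norm hb n A) (Ah n).
Qed.

Section contraction.
Variable B : H -> H.
Hypotheses (psdB : psd_hs B) (B1 : forall x, dot (B x) x <= `|x| ^+ 2).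

Let linB' : linear B. Proof. by case: psdB. Qed.
Let cB : continuous B. Proof. by case: psdB. Qed.
Let symB x y : dot (B x) y = dot x (B y). Proof. by case: psdB. Qed.
Let posB x : 0 <= dot (B x) x. Proof. by case: psdB. Qed.

(** The operator inequality [B^2 <= B]: positivity of [B] at [x - B x], combined with [B <= 1] at
    [B x]. *)
Lemma psd_sqr_norm_le x : `|B x| ^+ 2 <= dot (B x) x.
Proof.
have := posB (x - B x); rewrite (linB linB') !dotBl !dotBr (symB (B x) x) !dot_norm.
have := B1 (B x); lra.
Qed.

Lemma contraction_norm x : `|B x| <= `|x|.
Proof.
by rewrite -ler_sqr ?nnegrE// (le_trans (psd_sqr_norm_le x)).
Qed.

Let u n x := iter n B x.

Let linu n : linear (u n).
Proof. 
elim: n => [|n ih] // a x y.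
by rewrite [LHS](_ : _ = B (u n (a *: x + y)))// ih linB'.
 Qed.

Let cu n : continuous (u n).
Proof.
elim: n => [|n ih]; first by move=> x; exact: cvg_id.
rewrite [u n.+1](_ : _ = B \o u n); last exact/funext.
by move=> x; apply: continuous_comp; [exact: ih|exact: cB].
Qed.

Let dot_iter n m x : dot (u n x) (u m x) = dot (u (n + m) x) x.
Proof.
elim: m n => [|m ih] n; first by rewrite addn0.
rewrite [u m.+1 x](_ : _ = B (u m x))// -symB -addSnnS -ih.
by [].
Qed.

Let iter_norm n x : `|u n x| <= `|x|.
Proof. by elim: n => [//|n ih]; exact: le_trans (contraction_norm _) ih. Qed.

Let a x n := dot (u n x) x.

Let a_half x n : a x (n + n) = `|u n x| ^+ 2.
Proof. by rewrite /a -dot_iter dot_norm. Qed.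

Let a_half1 x n : a x (n + n).+1 = dot (B (u n x)) (u n x).
Proof. by rewrite /a -addSn -dot_iter. Qed.

Let a_ge0 x n : 0 <= a x n.
Proof.
rewrite -(odd_double_half n) -addnn; case: (odd n) => /=.
  by rewrite add1n a_half1.
by rewrite add0n a_half sqr_ge0.
Qed.

(** At the half iterate, the step from an even index is [B <= 1] and the step from an odd index is
    [B^2 <= B]. *)
Let a_nincr x : nonincreasing_seq (a x).
Proof.
apply/nonincreasing_seqP => n; rewrite -(odd_double_half n) -addnn; case: (odd n) => /=.
  rewrite add1n (_ : (n./2 + n./2).+2 = n./2.+1 + n./2.+1)%N; last by rewrite addSn addnS.
  rewrite a_half1 a_half; exact: psd_sqr_norm_le.
by rewrite add0n a_half1 a_half; exact: B1.
Qed.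

(** By symmetry [|B^k x - B^n x|^2 = a (2k) - 2 a (k+n) + a (2n)], and the monotone sequence [a]
    converges, so the iterates are Cauchy. Continuity of [B] makes their limit a fixed point. *)
Lemma iter_cvg x : exists2 v, iter n B x @[n --> \oo] --> v & B v = v.
Proof.
have a_cvg : cvgn (a x).
  by apply: nonincreasing_is_cvgn; [exact: a_nincr|exists 0 => _ [n _ <-]].
have a_ge n := nonincreasing_cvgn_ge (@a_nincr x) a_cvg n.
have : cvg (u n x @[n --> \oo]).
  apply: cauchy_cvg; apply: cauchy_exP => eps eps0.
  have e2 : 0 < eps ^+ 2 by rewrite exprn_gt0.
  have /cvgrPdist_lt/(_ _ e2)[k _ ak] := a_cvg.
  exists (u k x); exists k => // n /= kn; rewrite -ball_normE /=.
  rewrite -ltr_sqr ?nnegrE ?(ltW eps0)// (sqr_normB dot_norm) -!a_half dot_iter -/(a x (k + n)).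
  have h1 : a x (n + n) <= a x (k + n) by apply: a_nincr; rewrite leq_add2r.
  have h2 := ak (k + k)%N (leq_addr _ _).
  have := a_ge (k + n)%N; have := a_ge (k + k)%N.
  move: h2; rewrite distrC ltr_norml => /andP[_]; lra.
move=> /cvg_ex[v uv]; exists v => //.
have cBu : B (u n x) @[n --> \oo] --> B v by apply: continuous_cvg => //; exact: cB.
have uS : u n.+1 x @[n --> \oo] --> v by rewrite (cvg_shiftS (fun n => u n x)).
exact: (cvg_unique _ cBu uS).
Qed.

(* If all the iterates tend to [0], then by dominated convergence so does
   the Hilbert-Schmidt norm of [B^n]; but [B^n] almost fixes a vector that [B]
   almost fixes. *)
Lemma fixpoint_of_sup1 : (forall eps, 0 < eps -> exists2 x, `|x| = 1 & 1 - eps < dot (B x) x) ->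
  exists2 v, v != 0 & B v = v.
Proof.
move=> sup1; apply: contrapT => nofix.
have u0 x : u n x @[n --> \oo] --> (0 : H).
  have [v uv Bv] := iter_cvg x; have [<-//|v0] := eqVneq v 0.
  by exfalso; apply: nofix; exists v.
have [h h0 Bh] : exists2 h, 0 <= h & forall n, \sum_(i < n) `|B (b i)| ^+ 2 <= h ^+ 2.
  by case: psdB.
pose t n := \sum_(i < n) `|B (b i)| ^+ 2.
have t_nd : nondecreasing_seq t.
  by apply/nondecreasing_seqP => n; rewrite /t big_ord_recr/= lerDl sqr_ge0.
have t_cvg : cvgn t.
  by apply: nondecreasing_is_cvgn => //; exists (h ^+ 2) => _ [n _ <-]; exact: Bh.
(* The first [N] terms and the remaining ones are each given [1 / 8]. The remaining ones are
   dominated by those of [B], whatever the power; the squared Hilbert-Schmidt norm of [B^(M+1)] is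
   then at most [1 / 4], and its operator norm at most [1 / 2]. *)
have e8 : 0 < 8^-1 :> R by lra.
have t_le n := nondecreasing_cvgn_le t_nd t_cvg n.
have /cvgrPdist_lt/(_ _ e8)[N _ tN] := t_cvg.
have {}tN : limn t - t N < 8^-1.
  by have := tN N (leqnn _); rewrite ltr_norml => /andP[_].
have s_cvg : \sum_(i < N) `|u n (b i)| ^+ 2 @[n --> \oo] --> (0 : R).
  rewrite [X in _ --> X](_ : _ = \sum_(i < N) `|(0 : H)| ^+ 2); last first.
    by rewrite big1// => i _; rewrite normr0 expr0n.
  apply: cvg_sumr => i; rewrite expr2; under eq_fun do rewrite expr2.
  by apply: cvgM; apply: cvg_norm; exact: u0.
have /cvgrPdist_lt/(_ _ e8)[M _ sM] := s_cvg.
have {}sM : \sum_(i < N) `|u M.+1 (b i)| ^+ 2 < 8^-1.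
  have := sM M.+1 (leqnSn _); rewrite sub0r normrN.
  exact: le_lt_trans (ler_norm _).
have uM n : \sum_(i < n) `|u M.+1 (b i)| ^+ 2 <= 4^-1.
  have uB i : `|u M.+1 (b i)| ^+ 2 <= `|B (b i)| ^+ 2.
    by rewrite ler_sqr ?nnegrE// /u iterSr; exact: iter_norm.
  have [nN|Nn] := leqP n N.
    apply: (@le_trans _ _ (\sum_(i < N) `|u M.+1 (b i)| ^+ 2)); last lra.
    rewrite -(big_mkord xpredT (fun i => `|u M.+1 (b i)| ^+ 2)).
    rewrite -[leRHS](big_mkord xpredT (fun i => `|u M.+1 (b i)| ^+ 2)).
    by rewrite [leRHS](big_cat_nat _ nN)//= lerDl sumr_ge0.
  rewrite -(big_mkord xpredT (fun i => `|u M.+1 (b i)| ^+ 2)) (big_cat_nat _ (ltnW Nn))//=.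
  rewrite big_mkord; apply: (@le_trans _ _ (8^-1 + 8^-1)); last lra.
  apply: lerD; first exact: ltW.
  apply: (@le_trans _ _ (\sum_(N <= i < n) `|B (b i)| ^+ 2));
    first by apply: ler_sum => i _; exact: uB.
  have : t n <= limn t := t_le n.
  rewrite /t -(big_mkord xpredT (fun i => `|B (b i)| ^+ 2)) (big_cat_nat _ (ltnW Nn))//=.
  rewrite big_mkord -/(t N); lra.
have uM_le x : `|u M.+1 x| <= 2^-1 * `|x|.
  apply: (op_le dot_norm hb) => // n.
  rewrite -ler_sqr ?nnegrE ?fnorm_ge0// (le_trans (fnorm_corner_le dot_norm hb _ _))//.
  by rewrite (le_trans (uM n))//; lra.
(* If [B] moves the unit vector [x] by at most [e], then [B^(M+1)] moves it by at most [1 / 4],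
   which contradicts [|B^(M+1) x| <= 1 / 2]. A Rayleigh quotient within [e^2] of 1 suffices, since
   [|x - B x|^2 <= 1 - <B x, x>]. *)
pose e : R := (4 * M.+1%:R)^-1.
have e0 : 0 < e by rewrite invr_gt0 mulr_gt0.
have [x x1 xB] := sup1 (e ^+ 2) (exprn_gt0 _ e0).
have xBe : `|x - B x| <= e.
  rewrite -ler_sqr ?nnegrE ?(ltW e0)// (sqr_normB dot_norm) x1 (dotC dot).
  have := psd_sqr_norm_le x; lra.
have tele n : `|x - u n x| <= n%:R * e.
  elim: n => [|n ih]; first by rewrite subrr normr0 mul0r.
  rewrite [x - _](_ : _ = (x - u n x) + u n (x - B x)); last first.
    by rewrite (linB (linu n)) addrA subrK -/(u n (B x)) /u -iterSr.
  rewrite (le_trans (ler_normD _ _))// mulrSr mulrDl mul1r lerD//.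
  exact: le_trans (iter_norm _ _) xBe.
have := tele M.+1; rewrite /e invfM mulrCA divff// mulr1 => h1.
have := uM_le x; rewrite x1 mulr1 => h2.
have : `|x| <= `|x - u M.+1 x| + `|u M.+1 x| by rewrite -{1}(subrK (u M.+1 x) x) ler_normD.
rewrite x1; lra.
Qed.

End contraction.

Lemma psd_hsZ (c : R) A : 0 <= c -> psd_hs A -> psd_hs (fun x => c *: A x).
Proof.
move=> c0 [linA cA symA posA [h h0 Ah]]; split.
- by move=> a x y; rewrite linA scalerDr !scalerA mulrC.
- by move=> x; apply: cvgZr; exact: cA.
- by move=> x y; rewrite dotZl dotZr symA.
- by move=> x; rewrite dotZl mulr_ge0.
- exists (c * h) => [|n]; first exact: mulr_ge0.
  rewrite exprMn (le_trans _ (ler_wpM2l (sqr_ge0 c) (Ah n)))// mulr_sumr.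
  by apply: ler_sum => i _; rewrite normrZ exprMn real_normK ?num_real.
Qed.

Lemma psd_le_norm A c x : linear A -> (forall y, `|y| = 1 -> dot (A y) y <= c) ->
  dot (A x) x <= c * `|x| ^+ 2.
Proof.
move=> linA Ac; have [->|x0] := eqVneq x 0.
  by rewrite dot0r normr0 expr0n mulr0.
have nx : 0 < `|x| by rewrite normr_gt0.
have := Ac (`|x|^-1 *: x).
rewrite normrZ normfV normr_id mulVf ?gt_eqF// => /(_ erefl).
rewrite (linZ linA) dotZl dotZr mulrA -expr2 exprVn mulrC.
by rewrite ler_pdivrMr ?exprn_gt0.
Qed.

Lemma bounded_linear_continuous A h : linear A -> (forall x, `|A x| <= h * `|x|) -> continuous A.
Proof.
move=> linA Ah x; apply/cvgrPdist_le => /= eps eps0.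
have h1 : 0 < `|h| + 1 by rewrite ltr_wpDl.
near=> y; rewrite -(linB linA) (le_trans (Ah _))//.
rewrite (@le_trans _ _ ((`|h| + 1) * `|x - y|))//.
  by rewrite ler_wpM2r// (le_trans (ler_norm _))// lerDl.
rewrite mulrC -ler_pdivlMr//; near: y.
by apply: cvgr_dist_le; [exact: cvg_id|rewrite divr_gt0].
Unshelve. all: by end_near. Qed.

(** Dividing [A] by the supremum [mu] of its Rayleigh quotient gives a positive contraction whose
    quotient has supremum 1; a fixed vector of it is an eigenvector of [A] for [mu]. *)
Lemma top_eigen A : psd_hs A -> (exists x, 0 < dot (A x) x) ->
  exists mu v, [/\ 0 < mu, `|v| = 1, A v = mu *: v & forall x, dot (A x) x <= mu * `|x| ^+ 2].
Proof.
move=> psdA [x xA]; have [linA cA symA posA _] := psdA.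
have [h h0 Ah] := psd_hs_bounded psdA.
pose S := [set dot (A y) y | y in [set y | `|y| = 1]].
have x0 : `|x| != 0.
  by rewrite normr_eq0; apply/eqP => x0; move: xA; rewrite x0 dot0r ltxx.
have hasS : has_sup S.
  split; first by exists (dot (A (`|x|^-1 *: x)) (`|x|^-1 *: x)); exists (`|x|^-1 *: x) => //=;
    rewrite normrZ normfV normr_id mulVf.
  exists h => _ [y /= y1 <-].
  by rewrite (le_trans (ler_norm _))// (le_trans (dot_le dot_norm _ _))// y1 mulr1
    (le_trans (Ah _))// y1 mulr1.
pose mu := sup S.
have Amu y : dot (A y) y <= mu * `|y| ^+ 2.
  apply: psd_le_norm => // z z1; apply: ub_le_sup; first by case: hasS.
  by exists z.
have mu0 : 0 < mu.
  rewrite ltNge; apply/negP => mu0; have := Amu x.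
  by rewrite leNgt (le_lt_trans _ xA)// mulr_le0_ge0// sqr_ge0.
pose B y := mu^-1 *: A y.
have psdB : psd_hs B by apply: psd_hsZ => //; rewrite invr_ge0 ltW.
have B1 y : dot (B y) y <= `|y| ^+ 2 by rewrite dotZl mulrC ler_pdivrMr// mulrC.
have [eps eps0|v v0 Bv] := fixpoint_of_sup1 psdB B1.
  have [_ [y y1 <-]] := sup_adherent (mulr_gt0 mu0 eps0) hasS.
  rewrite -/mu => muy; exists y => //.
  by rewrite dotZl mulrC ltr_pdivlMr//; lra.
have Av : A v = mu *: v by rewrite -{2}Bv scalerA divff ?gt_eqF// scale1r.
exists mu, (`|v|^-1 *: v); split=> //.
  by rewrite normrZ normfV normr_id mulVf// normr_eq0.
by rewrite (linZ linA) Av !scalerA mulrC.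
Qed.

(** The set whose supremum defines [eigval] is bounded above by the operator norm, hence its
    supremum is a true upper bound. *)
Lemma eigval_ge A j (e : 'I_j.+1 -> H) c : psd_hs A -> orthonormal_family dot e ->
  (forall i, exists2 a, c <= a & A (e i) = a *: e i) -> c <= eigval dot A j.+1.
Proof.
move=> psdA one eA; have [h h0 Ah] := psd_hs_bounded psdA.
apply: ub_le_sup; last by exists e.
exists h => l [f [onf fA]]; have [a la Afa] := fA ord0.
have f1 : `|f ord0| = 1.
  apply/eqP; rewrite -sqrp_eq1// -dot_norm onf eqxx//.
rewrite (le_trans la)// (_ : a = dot (A (f ord0)) (f ord0)); last first.
  by rewrite Afa dotZl onf eqxx mulr1.
rewrite (le_trans (ler_norm _))// (le_trans (dot_le dot_norm _ _))// f1 mulr1.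
by rewrite (le_trans (Ah _))// f1 mulr1.
Qed.

Section leading.
Variables (A : H -> H) (p : nat) (e : 'I_p -> H).
Hypotheses (psdA : psd_hs A) (one : orthonormal_family dot e)
  (eA : forall i, A (e i) = eigval dot A i.+1 *: e i).

Lemma orthonormal_neq0 q (f : 'I_q -> H) i : orthonormal_family dot f -> f i != 0.
Proof.
by move=> /(_ i i); rewrite eqxx => fi; apply/eqP => f0; move: fi; rewrite f0 dot0l => /esym/eqP;
  rewrite oner_eq0.
Qed.

Lemma orthonormal_padded q (f : 'I_q -> H) : orthonormal_family dot f ->
  forall i j, dot (f i) (f j) = ((i == j) && (f i != 0))%:R.
Proof. by move=> onf i j; rewrite onf orthonormal_neq0// andbT. Qed.

(** Otherwise take the least [k] with [eigval A k.+1 < mu]. By minimality the first [k] vectors of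
    [e] have eigenvalues at least [mu], and with [v] they form [k + 1] such eigenvectors, a
    contradiction. *)
Lemma extend_leading_eigval mu v j : (j <= p)%N -> `|v| = 1 ->
  (forall i, dot v (e i) = 0) -> A v = mu *: v -> mu <= eigval dot A j.+1.
Proof.
move=> jp v1 ve Av; rewrite leNgt; apply/negP => lt_mu.
have ex_j : exists j, (j <= p)%N && (eigval dot A j.+1 < mu) by exists j; rewrite jp.
case: (ex_minnP ex_j) => k /andP[kp kmu kmin].
move: kmu; rewrite ltNge => /negP; apply.
pose f (i : 'I_k.+1) := if unlift ord_max i is Some i' then e (widen_ord kp i') else v.
apply: (@eigval_ge _ _ f) => //.
  move=> i i'; rewrite /f; case: unliftP => [l ->|->]; case: unliftP => [l' ->|->].
  - by rewrite one (inj_eq lift_inj).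
  - by rewrite dotC ve eq_sym (negbTE (neq_lift _ _)).
  - by rewrite ve (negbTE (neq_lift _ _)).
  - by rewrite dot_norm v1 expr1n eqxx.
move=> i; rewrite /f; case: unliftP => [l _|_]; last by exists mu.
exists (eigval dot A l.+1); last exact: eA.
rewrite leNgt; apply/negP => lmu.
have := kmin l; rewrite lmu (leq_trans (ltnW (ltn_ord l)) kp) => /(_ isT).
by rewrite leqNgt ltn_ord.
Qed.

Lemma dot_leading x i : dot (A x) (e i) = eigval dot A i.+1 * dot x (e i).
Proof. by case: psdA => _ _ symA _ _; rewrite symA eA dotZr. Qed.

Lemma dot_residual x (r := x - fproj dot e x) :
  dot (A r) r = dot (A x) x - \sum_(i < p) eigval dot A i.+1 * dot x (e i) ^+ 2.
Proof.
have [linA _ symA _ _] := psdA; have onp := orthonormal_padded one.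
rewrite /r (linB linA) dotBl !dotBr.
have h1 : dot (A x) (fproj dot e x) = \sum_(i < p) eigval dot A i.+1 * dot x (e i) ^+ 2.
  by rewrite dotC dot_fproj; apply: eq_bigr => i _; rewrite dot_leading; ring.
have -> : dot (A (fproj dot e x)) (fproj dot e x) =
    \sum_(i < p) eigval dot A i.+1 * dot x (e i) ^+ 2.
  rewrite dotC dot_fproj; apply: eq_bigr => i _.
  by rewrite dot_leading (dot_fproj_id onp); ring.
by rewrite (symA (fproj _ _ _)) (dotC _ (fproj _ _ _)) h1 subrr subr0.
Qed.

(** Deflation: [A'] is [A] followed by the projection off the span of [e], and is again nonnegative
    and Hilbert-Schmidt. A top eigenvector of [A'] is orthogonal to [e] and is an eigenvector of
    [A], so its eigenvalue is at most [eigval A j.+1]. *)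
Lemma residual_le u j : (j <= p)%N -> (forall i, dot u (e i) = 0) ->
  dot (A u) u <= eigval dot A j.+1 * `|u| ^+ 2.
Proof.
move=> jp ue.
have [->|u0] := eqVneq u 0; first by rewrite dot0r normr0 expr0n mulr0.
have [linA cA symA posA [h h0 Ah]] := psdA.
have fprojA x : (forall i, dot x (e i) = 0) -> fproj dot e (A x) = 0.
  by move=> xe; rewrite /fproj big1// => i _; rewrite dot_leading xe mulr0 scale0r.
pose A' x := A x - fproj dot e (A x).
have onp := orthonormal_padded one.
have A'A x : `|A' x| <= `|A x|.
  rewrite -ler_sqr ?nnegrE// (sqr_normB_fproj dot_norm onp) lerBlDr lerDl.
  by apply: sumr_ge0 => i _; exact: sqr_ge0.
have linA' : linear A'.
  by move=> a x y; rewrite /A' linA fprojP scalerBr opprD addrACA.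
have dotA' x y : dot (A' x) y =
  dot (A x) y - \sum_(i < p) eigval dot A i.+1 * dot x (e i) * dot y (e i).
  by rewrite dotBl dot_fproj; congr (_ - _); apply: eq_bigr => i _; rewrite dot_leading.
have A'u : dot (A' u) u = dot (A u) u.
  by rewrite dotA' big1 ?subr0// => i _; rewrite ue mulr0.
have psdA' : psd_hs A'.
  split=> //.
  - have [c c0 Ac] := psd_hs_bounded psdA.
    by apply: (@bounded_linear_continuous _ c) => // x; exact: le_trans (A'A _) (Ac _).
  - move=> x y; rewrite dotA' (dotC _ x) dotA' symA (dotC _ x); congr (_ - _).
    by apply: eq_bigr => i _; rewrite mulrAC.
  - move=> x; suff -> : dot (A' x) x =
    dot (A (x - fproj dot e x)) (x - fproj dot e x) by exact: posA.
    by rewrite dot_residual dotA'; congr (_ - _); apply: eq_bigr => i _; ring.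
  - by exists h => // n; apply: le_trans (Ah n); apply: ler_sum => i _; rewrite ler_sqr ?nnegrE.
have [pos|npos] := pselect (exists x, 0 < dot (A' x) x).
  have [mu [v [mu0 v1 A'v A'mu]]] := top_eigen psdA' pos.
  have ve i : dot v (e i) = 0.
    apply: (mulfI (lt0r_neq0 mu0)); rewrite -dotZl -A'v mulr0.
    exact: (dotB_fproj onp).
  have Av : A v = mu *: v by rewrite -A'v /A' fprojA// subr0.
  rewrite -A'u (le_trans (A'mu u))// ler_wpM2r ?sqr_ge0//.
  exact: (extend_leading_eigval jp v1 ve Av).
(* If the form of [A'] is never positive, [u] lies in the kernel of [A]; normalized, it is an
   eigenvector for 0 orthogonal to [e], which forces [eigval A j.+1] to be nonnegative. *)
have A'u0 : A' u = 0.
  apply/eqP; rewrite -normr_eq0 -sqrf_eq0 eq_le sqr_ge0 andbT.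
  have A'1 x : dot (A' x) x <= `|x| ^+ 2.
    by rewrite (le_trans _ (sqr_ge0 _))// leNgt; apply/negP => ?; apply: npos; exists x.
  rewrite (le_trans (psd_sqr_norm_le psdA' A'1 u))//.
  by rewrite leNgt; apply/negP => ?; apply: npos; exists u.
have Au0 : A u = 0 by move: A'u0; rewrite /A' fprojA// subr0.
rewrite Au0 dot0l mulr_ge0 ?sqr_ge0//.
apply: (@extend_leading_eigval 0 (`|u|^-1 *: u)) => //.
- by rewrite normrZ normfV normr_id mulVf// normr_eq0.
- by move=> i; rewrite dotZl ue mulr0.
- by rewrite (linZ linA) Au0 scaler0 scale0r.
Qed.

Lemma leading_eigval_ge0 (i : 'I_p) : 0 <= eigval dot A i.+1.
Proof.
have [_ _ _ posA _] := psdA.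
by have := posA (e i); rewrite eA dotZl one eqxx mulr1.
Qed.

Lemma leading_eigval_antitone i j : (i <= j)%N -> (j < p)%N ->
  eigval dot A j.+1 <= eigval dot A i.+1.
Proof.
move=> ij jp; apply: ge_sup.
  (* The supremum is over a nonempty set: the leading vectors themselves, with the bound 0. *)
  exists 0, (e \o widen_ord jp); split.
    by move=> k l; rewrite /= one.
  move=> k; exists (eigval dot A k.+1); last exact: eA.
  exact: (leading_eigval_ge0 (widen_ord jp k)).
move=> l [f [onf fA]].
apply: (@eigval_ge _ _ (f \o widen_ord (ij : (i < j.+1)%N))) => //.
  by move=> k k'; rewrite /= onf.
by move=> k; have [a la fa] := fA (widen_ord (ij : (i < j.+1)%N) k); exists a.
Qed.

(* A quantitative form of Ky Fan's maximum principle. *)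
Lemma ky_fan (f : 'I_p -> H) c : orthonormal_family dot f ->
  (forall u, (forall i, dot u (e i) = 0) -> dot (A u) u <= c * `|u| ^+ 2) ->
  \sum_(j < p) dot (A (f j)) (f j) <= \sum_(i < p) eigval dot A i.+1 -
    \sum_(i < p) (eigval dot A i.+1 - c) * (1 - \sum_(j < p) dot (f j) (e i) ^+ 2).
Proof.
move=> onf Ac; have onp := orthonormal_padded one.
(* Split [f j] into its projection on the span of [e], where [A] is diagonal, and a residual, where
   the form is at most [c] times the squared norm. *)
have le1 (j : 'I_p) : dot (A (f j)) (f j) <=
    \sum_(i < p) (eigval dot A i.+1 - c) * dot (f j) (e i) ^+ 2 + c.
  have := Ac _ (dotB_fproj onp (f j)); rewrite dot_residual (sqr_normB_fproj dot_norm onp).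
  rewrite -dot_norm onf eqxx lerBlDr => /le_trans; apply.
  rewrite mulrBr mulr1 mulr_sumr -addrA addrC lerD2r addrC -sumrB.
  by apply: ler_sum => i _; rewrite mulrBl.
apply: (le_trans (ler_sum _ (fun j _ => le1 j))).
rewrite big_split/= exchange_big/= sumr_const card_ord -[X in c *+ X](card_ord p) -sumr_const.
rewrite -sumrB -big_split/= ler_sum// => i _.
by rewrite -mulr_sumr le_eqVlt; apply/orP; left; apply/eqP; ring.
Qed.

End leading.
End spectral.

(** * Perturbation of leading eigenspaces *)

Section davis_kahan.
Context {R : realType} {H : completeNormedModType R} (dot : {dot H for idfun}).
Hypothesis dot_norm : forall x : H, dot x x = `|x| ^+ 2.
Variables (b : nat -> H) (hb : hs_basis dot b).
Implicit Types (x y z : H) (A B : H -> H).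

Lemma lin_span_fproj p (e : 'I_p -> H) v : orthonormal_family dot e ->
  lin_span (range e) v -> fproj dot e v = v.
Proof.
move=> one [s [c [se ->]]]; have onp := orthonormal_padded one.
have linP : linear (fproj dot e) by move=> a x y; exact: fprojP.
rewrite (lin_sum linP) big_seq [RHS]big_seq; apply: eq_bigr => w /se[i _ <-].
rewrite (linZ linP); congr (_ *: _).
rewrite /fproj (bigD1 i)//= one eqxx scale1r big1 ?addr0// => j ji.
by rewrite one eq_sym (negbTE ji) scale0r.
Qed.

Lemma orth_proj_span p (e : 'I_p -> H) x : orthonormal_family dot e ->
  orth_proj dot (lin_span (range e)) x = fproj dot e x.
Proof.
move=> one; have onp := orthonormal_padded one.
have inV i : lin_span (range e) (e i).
  exists [:: e i], (fun=> 1); split; first by move=> v /[!inE] /eqP ->; exists i.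
  by rewrite big_seq1 scale1r.
rewrite /orth_proj; case: xgetP => [v _ [Vv vx]|/(_ (fproj dot e x)) no].
  rewrite -(lin_span_fproj one Vv) /fproj; apply: eq_bigr => i _.
  by congr (_ *: _); apply/esym/eqP; rewrite -subr_eq0 -dotBl vx.
exfalso; apply: no; split.
  exists (codom e), (dot x); split; first by move=> v /codomP[i ->]; exists i.
  by rewrite /fproj /codom big_image/=.
move=> u /(lin_span_fproj one) <-; rewrite -dot_fprojC.
rewrite (linB (A := fproj dot e)); last by move=> a y z; exact: fprojP.
rewrite [X in _ - X](_ : _ = fproj dot e x) ?subrr ?dot0l//.
apply: eq_bigr => i _; by rewrite dot_fproj_id.
Qed.

Section signed_projections.
Variables (K : finType) (s : K -> R) (g : K -> H).

(** With the sign 1 on one orthonormal family and -1 on another, this is the difference of the two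
    projections; [sproj_sqr] is its squared Hilbert-Schmidt norm. *)
Definition sproj x := \sum_k (s k * dot x (g k)) *: g k.

Definition sproj_sqr := \sum_k \sum_l s k * s l * dot (g k) (g l) ^+ 2.

Let G n (ab : 'I_n * 'I_n) : R :=
  \sum_k s k * (dot (g k) (b ab.1) * dot (g k) (b ab.2)).

Let corner_sproj n : @corner _ _ dot b n sproj = @G n.
Proof.
apply/funext => -[i j]; rewrite /corner /sproj /G /= dot_suml; apply: eq_bigr => k _.
by rewrite dotZl (dotC dot (b i)) mulrA.
Qed.

Let sqr_fnorm_G n : fnorm (@G n) ^+ 2 =
  \sum_k \sum_l s k * s l * (\sum_(a < n) dot (g k) (b a) * dot (g l) (b a)) ^+ 2.
Proof.
rewrite sqr_fnorm /G.
transitivity (\sum_(ab : 'I_n * 'I_n) \sum_k \sum_l s k * s l *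
   ((dot (g k) (b ab.1) * dot (g l) (b ab.1)) * (dot (g k) (b ab.2) * dot (g l) (b ab.2)))).
  apply: eq_bigr => ab _; rewrite expr2 mulr_suml; apply: eq_bigr => k _.
  by rewrite mulr_sumr; apply: eq_bigr => l _; ring.
rewrite exchange_big/=; apply: eq_bigr => k _.
rewrite exchange_big/=; apply: eq_bigr => l _.
rewrite -mulr_sumr expr2 mulr_suml; congr (_ * _).
rewrite -(pair_bigA _ (fun i j : 'I_n =>
  (dot (g k) (b i) * dot (g l) (b i)) * (dot (g k) (b j) * dot (g l) (b j))))/=.
by apply: eq_bigr => i _; rewrite mulr_sumr.
Qed.

(** The squared norms of the corners increase with [n], and by Parseval they tend to [sproj_sqr]. *)
Lemma fnorm_corner_sproj n : fnorm (@corner _ _ dot b n sproj) ^+ 2 <= sproj_sqr.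
Proof.
rewrite corner_sproj.
have G_cvg : fnorm (@G n) ^+ 2 @[n --> \oo] --> sproj_sqr.
  under eq_fun do rewrite sqr_fnorm_G.
  apply: cvg_sumr => k; apply: cvg_sumr => l; apply: cvgMr.
  rewrite expr2; under eq_fun do rewrite expr2.
  by apply: cvgM; exact: (parseval dot_norm hb).
have G_nd : nondecreasing_seq (fun n => fnorm (@G n) ^+ 2).
  apply/nondecreasing_seqP => m; rewrite !sqr_fnorm.
  pose F i j := (\sum_k s k * (dot (g k) (b i) * dot (g k) (b j))) ^+ 2.
  rewrite -(pair_bigA _ (fun i j : 'I_m => F i j)) -(pair_bigA _ (fun i j : 'I_m.+1 => F i j))/=.
  rewrite big_ord_recr/= ler_wpDr ?sumr_ge0// => [i _|]; first exact: sqr_ge0.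
  by apply: ler_sum => i _; rewrite big_ord_recr/= lerDl sqr_ge0.
rewrite -(cvg_lim _ G_cvg)//; apply: (nondecreasing_cvgn_le G_nd).
by apply: cvgP G_cvg.
Qed.

(** The left-hand side is the Hilbert-Schmidt inner product of [D] with [sproj]; Cauchy-Schwarz is
    applied to corners before passing to the limit. *)
Lemma sum_dot_le_sproj D h : linear D -> continuous D ->
  (forall n, fnorm (@corner _ _ dot b n D) <= h) ->
  \sum_k s k * dot (D (g k)) (g k) <= h * Num.sqrt sproj_sqr.
Proof.
move=> linD cD Dh.
have P_cvg x := hb.1.2 x.
have L : \sum_k s k * dot (D (fproj dot (fun i : 'I_n => b i) (g k)))
    (fproj dot (fun i : 'I_n => b i) (g k)) @[n --> \oo] -->
    \sum_k s k * dot (D (g k)) (g k).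
  apply: cvg_sumr => k; apply: cvgMr; apply: cvg_dot => //.
  by apply: continuous_cvg; [exact: cD|exact: P_cvg].
apply: (cvgr_to_le L); near=> n.
rewrite [leLHS](_ : _ = fdot (@corner _ _ dot b n D) (@corner _ _ dot b n sproj)); last first.
  rewrite corner_sproj /fdot /G; under [RHS]eq_bigr do rewrite mulr_sumr.
  rewrite exchange_big/=; apply: eq_bigr => k _.
  rewrite -(pair_bigA _ (fun i j : 'I_n => corner dot b D (i, j) *
    (s k * (dot (g k) (b i) * dot (g k) (b j)))))/=.
  rewrite /fproj (lin_sum linD) dot_suml mulr_sumr; apply: eq_bigr => i _.
  rewrite (linZ linD) dotZl dot_sumr !mulr_sumr; apply: eq_bigr => j _.
  by rewrite dotZr /corner/=; ring.
rewrite (le_trans (ler_norm _))// (le_trans (fdot_le _ _))//.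
apply: ler_pM; rewrite ?fnorm_ge0//.
by rewrite -[leLHS]ger0_norm ?fnorm_ge0// -sqrtr_sqr ler_wsqrtr// fnorm_corner_sproj.
Unshelve. all: by end_near. Qed.

End signed_projections.

Section two_subspaces.
Variables (p : nat) (e f : 'I_p -> H).
Hypotheses (one : orthonormal_family dot e) (onf : orthonormal_family dot f).

Let s (k : 'I_p + 'I_p) : R := if k is inl _ then 1 else -1.
Let g (k : 'I_p + 'I_p) := match k with inl i => e i | inr j => f j end.
(** The trace of the product of the two projections; their squared distance is [2 * (p - c)]. *)
Let c := \sum_i \sum_j dot (f j) (e i) ^+ 2.

Let sproj_sqrE : sproj_sqr s g = 2 * (p%:R - c).
Proof.
rewrite /sproj_sqr; under eq_bigr do rewrite big_sumType/=.
rewrite big_split/= !big_sumType/=.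
have diag (u : 'I_p -> H) (r : R) : orthonormal_family dot u -> r = 1 ->
    \sum_i \sum_j r * dot (u i) (u j) ^+ 2 = p%:R.
  move=> onu ->; rewrite -[p in RHS]card_ord -sumr_const; apply: eq_bigr => i _.
  rewrite (bigD1 i)//= onu eqxx expr1n mulr1 big1 ?addr0// => j ji.
  by rewrite onu eq_sym (negbTE ji) expr0n mulr0.
rewrite !diag//; [|by rewrite mulrNN mulr1|by rewrite mulr1].
have -> : \sum_i \sum_j 1 * -1 * dot (e i) (f j) ^+ 2 = - c.
  rewrite /c -sumrN; apply: eq_bigr => i _; rewrite -sumrN; apply: eq_bigr => j _.
  by rewrite (dotC dot (e i)); ring.
have -> : \sum_i \sum_j -1 * 1 * dot (f i) (e j) ^+ 2 = - c.
  rewrite /c exchange_big/= -sumrN; apply: eq_bigr => i _; rewrite -sumrN; apply: eq_bigr => j _.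
  by ring.
ring.
Qed.

Lemma rho_le : (rho dot (lin_span (range f)) (lin_span (range e)) <=
  (Num.sqrt (2 * (p%:R - \sum_i \sum_j dot (f j) (e i) ^+ 2)))%:E)%E.
Proof.
rewrite -/c -sproj_sqrE /rho.
have E : orth_proj dot (lin_span (range f)) \- orth_proj dot (lin_span (range e)) =
    fun x => - sproj s g x.
  apply/funext => x; rewrite /= !orth_proj_span// /sproj big_sumType/= opprD [RHS]addrC.
  congr (_ + _).
    by rewrite /fproj -sumrN; apply: eq_bigr => i _; rewrite mulN1r scaleNr opprK.
  by congr (- _); apply: eq_bigr => i _; rewrite mul1r.
have E0 : (orth_proj dot (lin_span (range f)) \- orth_proj dot (lin_span (range e))) 0 = 0.
  rewrite E /sproj big1 ?oppr0// => k _.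
  by rewrite dot0l mulr0 scale0r.
apply: (hs_norm_le dot_norm hb) => // n.
have -> : fnorm (@corner _ _ dot b n
    (orth_proj dot (lin_span (range f)) \- orth_proj dot (lin_span (range e)))) =
    fnorm (@corner _ _ dot b n (sproj s g)).
  rewrite /fnorm; congr Num.sqrt; apply: eq_bigr => ij _.
  by rewrite E /corner -scaleN1r dotZl mulN1r sqrrN.
by rewrite -[leLHS]ger0_norm ?fnorm_ge0// -sqrtr_sqr ler_wsqrtr// fnorm_corner_sproj.
Qed.

Lemma sum_dotB_le (D : H -> H) h : linear D -> continuous D ->
  (forall n, fnorm (@corner _ _ dot b n D) <= h) ->
  \sum_i dot (D (e i)) (e i) - \sum_j dot (D (f j)) (f j) <=
    h * Num.sqrt (2 * (p%:R - \sum_i \sum_j dot (f j) (e i) ^+ 2)).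
Proof.
move=> linD cD Dh; have := @sum_dot_le_sproj _ s g D h linD cD Dh.
rewrite sproj_sqrE big_sumType/= => /(le_trans _); apply.
rewrite -sumrN le_eqVlt; apply/orP; left; apply/eqP.
by congr (_ + _); apply: eq_bigr => i _; rewrite ?mul1r ?mulN1r.
Qed.

End two_subspaces.

(* Comparing the traces of [A] and [A'] on both subspaces with [ky_fan] gives
   [half_gap A p * rho V W ^+ 2 <= <A - A', P_V - P_W>] and no smallness of
   [A - A'] is needed. *)
Theorem davis_kahan A A' p V W h : (0 < p)%N ->
  psd_hs dot b A -> psd_hs dot b A' -> 0 < half_gap dot A p ->
  leading_eigenspace dot A p V -> leading_eigenspace dot A' p W ->
  (forall n, fnorm (@corner _ _ dot b n (A \- A')) <= h) ->
  (rho dot W V <= (h / half_gap dot A p)%:E)%E.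
Proof.
move=> p0 psdA psdA' gap0 [e [one eA ->]] [f [onf fA' ->]] Dh.
apply: (le_trans (rho_le one onf)); rewrite lee_fin.
have [linA cA _ _ _] := psdA; have [linA' cA' _ _ _] := psdA'.
have linD : linear (A \- A').
  by move=> a x y; rewrite /= linA linA' scalerBr opprD addrACA.
have cD : continuous (A \- A') by move=> x; apply: cvgB; [exact: cA|exact: cA'].
have := sum_dotB_le one onf linD cD Dh.
set c := \sum_i \sum_j _; set r := Num.sqrt _ => Dr.
have h0 : 0 <= h := le_trans (fnorm_ge0 _) (Dh 0%N).
have k1 := ky_fan dot_norm psdA one eA onf
  (fun u => residual_le dot_norm hb psdA one eA (leqnn p)).
(* Nothing is known about the gap of [A']. The constant in [ky_fan] is therefore its [p]-th
   eigenvalue, for which every correction term is nonnegative. *)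
have p1 : (p.-1 <= p)%N by exact: leq_pred.
have k2 := ky_fan dot_norm psdA' onf fA' one
  (fun u => residual_le dot_norm hb psdA' onf fA' p1).
have s_le1 (u v : 'I_p -> H) i : orthonormal_family dot u -> orthonormal_family dot v ->
    0 <= 1 - \sum_j dot (u j) (v i) ^+ 2.
  move=> onu onv; have := bessel dot_norm (orthonormal_padded onu) (v i).
  rewrite -dot_norm onv eqxx subr_ge0 => /(le_trans _); apply.
  by apply: ler_sum => j _; rewrite dotC.
have lb1 : 2 * half_gap dot A p * (p%:R - c) <=
    \sum_(i < p) (eigval dot A i.+1 - eigval dot A p.+1) * (1 - \sum_j dot (f j) (e i) ^+ 2).
  have -> : p%:R - c = \sum_(i < p) (1 - \sum_j dot (f j) (e i) ^+ 2).
    by rewrite sumrB sumr_const card_ord.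
  rewrite mulr_sumr; apply: ler_sum => i _; apply: ler_wpM2r; first exact: s_le1.
  rewrite /half_gap mulrC divfK// lerD2r.
  have := leading_eigval_antitone dot_norm hb psdA one eA (i := i) (j := p.-1).
  by rewrite prednK//; apply => //; rewrite -ltnS prednK.
have lb2 : 0 <= \sum_(i < p) (eigval dot A' i.+1 - eigval dot A' p.-1.+1) *
    (1 - \sum_j dot (e j) (f i) ^+ 2).
  apply: sumr_ge0 => i _; apply: mulr_ge0; last exact: s_le1.
  rewrite subr_ge0; apply: (leading_eigval_antitone dot_norm hb psdA' onf fA');
    last by rewrite prednK.
  by rewrite -ltnS prednK.
have trE : \sum_i dot ((A \- A') (e i)) (e i) =
    \sum_(i < p) eigval dot A i.+1 - \sum_i dot (A' (e i)) (e i).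
  rewrite -sumrB; apply: eq_bigr => i _.
  by rewrite /= dotBl eA dotZl one eqxx mulr1.
have trF : \sum_i dot ((A \- A') (f i)) (f i) =
    \sum_i dot (A (f i)) (f i) - \sum_(i < p) eigval dot A' i.+1.
  rewrite -sumrB; apply: eq_bigr => i _.
  by rewrite /= dotBl fA' dotZl onf eqxx mulr1.
(* The sums of eigenvalues and the traces cancel, leaving only the corrections of [k1] and [k2]. As
   [2 * (p - c) = r^2], one factor [r] can then be divided out. *)
have key : half_gap dot A p * (2 * (p%:R - c)) <= h * r.
  by move: Dr; rewrite trE trF; lra.
have pc0 : 0 <= 2 * (p%:R - c).
  rewrite mulr_ge0// -[X in X%:R](card_ord p) -sumr_const -sumrB.
  by apply: sumr_ge0 => i _; exact: s_le1.
rewrite ler_pdivlMr// mulrC.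
have [r0|r0] := eqVneq r 0; first by rewrite r0 mulr0.
have r_gt0 : 0 < r by rewrite lt_neqAle eq_sym r0 sqrtr_ge0.
by rewrite -(ler_pM2r r_gt0) -mulrA -expr2 sqr_sqrtr.
Qed.

End davis_kahan.

(** * Covariance operators *)

(** Meant for integrands such as [hs_norm (F w \- S w)], whose measurability is not at hand: the
    integral of a nonnegative function is a supremum over the simple functions below it, which is
    monotone for arbitrary functions. *)
Lemma ge0_le_integral_nomeas d (T : measurableType d) (R : realType)
    (mu : {measure set T -> \bar R}) (D : set T) (f g : T -> \bar R) :
  (forall w, D w -> 0 <= f w)%E -> (forall w, D w -> f w <= g w)%E ->
  (\int[mu]_(w in D) f w <= \int[mu]_(w in D) g w)%E.
Proof.
move=> f0 fg; rewrite !ge0_integralE//; last first.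
  by move=> w Dw; exact: le_trans (f0 w Dw) (fg w Dw).
apply: le_ereal_sup => _ [h hf <-]; exists h => // w.
apply: (le_trans (hf w)); rewrite /patch; case: ifPn => // /set_mem Dw; exact: fg.
Qed.

Lemma cvge0_lt (R : realType) (f : nat -> \bar R) (eps : R) :
  f n @[n --> \oo] --> 0%E -> 0 < eps -> \forall n \near \oo, (f n < eps%:E)%E.
Proof.
move=> /fine_cvgP[ffin /cvgrPdist_lt f0] eps0; near=> n.
rewrite -(@fineK _ (f n)); last by near: n.
rewrite lte_fin (le_lt_trans (ler_norm _))// -normrN -[X in `|X|]add0r.
by near: n; exact: f0.
Unshelve. all: by end_near. Qed.

Lemma continuous_borel_measurable (R : realType) (H : completeNormedModType R) (f : H -> R) :
  continuous f -> measurable_fun [set: borelType H] (f : borelType H -> R).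
Proof.
move=> /continuousP cf; apply: (measurability _ (RGenOpens.measurableE R)).
move=> _ [_ [a [c ->] <-]]; rewrite setTI; apply: sub_sigma_algebra.
by apply: cf; exact: interval_open.
Qed.

Section bochner_coordinates.
Context {R : realType} {H : completeNormedModType R} (dot : {dot H for idfun}).
Hypothesis dot_norm : forall x : H, dot x x = `|x| ^+ 2.
Variables (b : nat -> H) (hb : hs_basis dot b).
Context d (T : measurableType d) (P : probability T R).
Variables (D : set T) (mD : measurable D).

Lemma entry_le_hs (A : H -> H) i j : A 0 = 0 ->
  (`|dot (A (b i)) (b j)|%:E <= hs_norm dot A)%E.
Proof.
move=> A0; apply: le_trans (corner_le_hs dot_norm hb (maxn i j).+1 A0).
have im : (i < (maxn i j).+1)%N by rewrite ltnS leq_maxl.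
have jm : (j < (maxn i j).+1)%N by rewrite ltnS leq_maxr.
rewrite lee_fin -ler_sqr ?nnegrE ?fnorm_ge0// real_normK ?num_real// sqr_fnorm.
rewrite (bigD1 (Ordinal im, Ordinal jm))//= lerDl; apply: sumr_ge0 => k _; exact: sqr_ge0.
Qed.

Lemma hs_simple_entry (S : T -> H -> H) i j : hs_simple dot S ->
  bounded_measurable (fun w => \1_D w * dot (S w (b i)) (b j)) /\
  dot (hs_simple_integral P D S (b i)) (b j) =
    Ex P (fun w => \1_D w * dot (S w (b i)) (b j)).
Proof.
move=> [fS hsS mS].
pose r := fset_set (range S).
have E : (fun w => \1_D w * dot (S w (b i)) (b j)) =
    fun w => \sum_(A <- r) dot (A (b i)) (b j) * \1_(D `&` S @^-1` [set A]) w.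
  apply/funext => w.
  have Sr : S w \in r by rewrite in_fset_set// inE; exists w.
  rewrite (big_fsetD1 (S w))//= big1_fset ?addr0.
    rewrite mulrC; congr (_ * _); rewrite indicE indicE; congr ((nat_of_bool _)%:R).
    by apply/idP/idP; rewrite !inE => //; case.
  move=> A; rewrite in_fsetD1 => /andP[ASw _] _.
  rewrite indicE memNset ?mulr0// => -[_ /= SA].
  by rewrite SA eqxx in ASw.
have bm A : bounded_measurable (\1_(D `&` S @^-1` [set A]) : T -> R).
  by apply: bounded_measurable_indic; exact: measurableI.
have bmA A : bounded_measurable (fun w => dot (A (b i)) (b j) * \1_(D `&` S @^-1` [set A]) w).
  exact: bounded_measurableZ.
split; first by rewrite E; exact: bounded_measurable_sum.
rewrite E Ex_sum// /hs_simple_integral fsbig_finite//= -/r fct_sumE dot_suml.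
apply: eq_bigr => A _; rewrite ExZ// Ex_indic; last exact: measurableI.
by rewrite /= dotZl mulrC.
Qed.

(** A matrix entry is a functional bounded by [hs_norm]. It commutes with the integral of simple
    functions, and the two approximation errors are at most [eps / 2] each. *)
Lemma bochner_entry (F : T -> H -> H) C i j :
  (forall w, F w 0 = 0) ->
  bounded_measurable (fun w => \1_D w * dot (F w (b i)) (b j)) ->
  is_bochner_integral dot P D F C ->
  dot (C (b i)) (b j) = Ex P (fun w => \1_D w * dot (F w (b i)) (b j)).
Proof.
move=> F0 bF [[linC _ _] [S [hsS _ SF SC]]].
apply/eqP; rewrite -subr_eq0 -normr_le0; apply/ler_addgt0Pl => eps eps0; rewrite addr0.
have e2 : 0 < eps / 2 by rewrite divr_gt0.
have [n [SCn SFn]] : exists n,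
  (hs_norm dot (C \- hs_simple_integral P D (S n))%R < (eps / 2)%:E)%E /\
    (\int[P]_(w in D) hs_norm dot (F w \- S n w)%R < (eps / 2)%:E)%E.
  near \oo%classic => n; exists n; split; near: n; exact: cvge0_lt.
have [bS ES] := hs_simple_entry i j (hsS n).
have I0 : hs_simple_integral P D (S n) 0 = 0.
  rewrite /hs_simple_integral fsbig_finite//=; last by case: (hsS n).
  rewrite fct_sumE big_seq big1// => A; rewrite in_fset_set; last by case: (hsS n).
  rewrite inE => -[w _ <-]; have [_ /(_ w)[linS _ _] _] := hsS n.
  by rewrite [LHS](_ : _ = fine (P (D `&` S n @^-1` [set S n w])) *: S n w 0)// (lin0 linS) scaler0.
have h1 : `|dot (C (b i)) (b j) - dot (hs_simple_integral P D (S n) (b i)) (b j)| <= eps / 2.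
  rewrite -dotBl -lee_fin (le_trans _ (ltW SCn))//.
  apply: (@entry_le_hs (C \- hs_simple_integral P D (S n))) => /=.
  by rewrite (lin0 linC) I0 subr0.
have h2 : `|Ex P (fun w => \1_D w * dot (S n w (b i)) (b j)) -
    Ex P (fun w => \1_D w * dot (F w (b i)) (b j))| <= eps / 2.
  rewrite -ExB//; apply: (le_trans (Ex_norm_le P (bounded_measurableB bS bF))).
  pose g w := `|dot (F w (b i)) (b j) - dot (S n w (b i)) (b j)|.
  have gE : (fun w => `|((fun w => \1_D w * dot (S n w (b i)) (b j)) \-
      (fun w => \1_D w * dot (F w (b i)) (b j))) w|) = fun w => \1_D w * g w.
    apply/funext => w; rewrite /g /= distrC -mulrBr normrM; congr (_ * _).
    by rewrite indicE; case: (_ \in _); rewrite /= ?normr1 ?normr0.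
  have bg := bounded_measurable_norm (bounded_measurableB bS bF).
  rewrite gE in bg *; rewrite -lee_fin EFin_Ex_indic// (le_trans _ (ltW SFn))//.
  apply: ge0_le_integral_nomeas => w Dw; rewrite ?lee_fin ?normr_ge0// /g -dotBl.
  have [_ /(_ w)[linS _ _] _] := hsS n.
  apply: (@entry_le_hs (F w \- S n w)) => /=.
  by rewrite F0 (lin0 linS) subr0.
rewrite (_ : _ - _ = (dot (C (b i)) (b j) - dot (hs_simple_integral P D (S n) (b i)) (b j)) +
   (Ex P (fun w => \1_D w * dot (S n w (b i)) (b j)) -
    Ex P (fun w => \1_D w * dot (F w (b i)) (b j)))); last by rewrite ES addrA subrK.
by rewrite (le_trans (ler_normD _ _))//; lra.
Unshelve. all: by end_near. Qed.
Lemma cvg_entries (A : H -> H) x y : linear A -> continuous A ->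
  \sum_(i < n) \sum_(j < n) dot x (b i) * dot y (b j) * dot (A (b i)) (b j) @[n --> \oo] -->
  dot (A x) y.
Proof.
move=> linA cA; have P_cvg z := hb.1.2 z.
have : dot (A (fproj dot (fun i : 'I_n => b i) x)) (fproj dot (fun i : 'I_n => b i) y)
    @[n --> \oo] --> dot (A x) y.
  by apply: cvg_dot => //; apply: continuous_cvg; [exact: cA|exact: P_cvg].
apply: cvg_trans; apply: near_eq_cvg; near=> n.
rewrite /fproj (lin_sum linA) dot_suml; apply: eq_bigr => i _.
rewrite (linZ linA) dotZl dot_sumr mulr_sumr; apply: eq_bigr => j _.
by rewrite dotZr mulrA.
Unshelve. all: by end_near. Qed.

Section bochner_tensor.
Variables (phi : T -> H) (C : H -> H).
Hypotheses (mphi : forall i, measurable_fun setT (fun w => dot (phi w) (b i)))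
  (phi1 : forall w, D w -> `|phi w| <= 1)
  (intC : is_bochner_integral dot P D (fun w => tensor dot (phi w) (phi w)) C).

Lemma bounded_measurable_tensor i j :
  bounded_measurable (fun w => \1_D w * (dot (phi w) (b i) * dot (phi w) (b j))).
Proof.
split.
  by apply: measurable_funM; [exact: measurable_indic|exact: measurable_funM].
exists 1 => w; rewrite indicE; have [/set_mem Dw|_] := boolP (w \in D).
  have bw k : `|dot (phi w) (b k)| <= 1.
    rewrite (le_trans (dot_le dot_norm _ _))// mulr_ile1 ?phi1//.
    rewrite -ler_sqr ?nnegrE// -dot_norm hb.1.1 eqxx expr1n; by case: (b k != 0).
  by rewrite mul1r normrM mulr_ile1.
by rewrite mul0r normr0.
Qed.

Lemma bochner_tensor_entry i j : dot (C (b i)) (b j) =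
  Ex P (fun w => \1_D w * (dot (phi w) (b i) * dot (phi w) (b j))).
Proof.
have E w : dot (tensor dot (phi w) (phi w) (b i)) (b j) = dot (phi w) (b i) * dot (phi w) (b j).
  by rewrite dotZl.
have EE : (fun w => \1_D w * dot (tensor dot (phi w) (phi w) (b i)) (b j)) =
    fun w => \1_D w * (dot (phi w) (b i) * dot (phi w) (b j)).
  by apply/funext => w; rewrite E.
rewrite -EE; apply: bochner_entry intC => [w|]; first by rewrite /tensor dot0r scale0r.
by rewrite EE; exact: bounded_measurable_tensor.
Qed.

(** Symmetry and positivity are limits of statements about finitely many entries, where the
    quadratic form is the expectation of a square. *)
Lemma bochner_tensor_psd : psd_hs dot b C.
Proof.
have [[linC cC Coo] _] := intC; split=> //.
- move=> x y; apply: (cvg_unique _ (cvg_entries (x := x) (y := y) linC cC)) => //.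
  rewrite (dotC dot x); have := cvg_entries (x := y) (y := x) linC cC.
  apply: cvg_trans; apply: near_eq_cvg; near=> n.
  rewrite exchange_big/=; apply: eq_bigr => i _; apply: eq_bigr => j _.
  rewrite (mulrC (dot y _)) !bochner_tensor_entry; congr (_ * _); congr Ex.
  by apply/funext => w; rewrite (mulrC (dot _ (b i))).
- move=> x; apply: (cvgr_to_ge (cvg_entries (x := x) (y := x) linC cC)); near=> n.
  pose g w := \sum_(i < n) dot x (b i) * dot (phi w) (b i).
  rewrite [leRHS](_ : _ = Ex P (fun w => \sum_(i < n) \sum_(j < n)
      dot x (b i) * dot x (b j) * (\1_D w * (dot (phi w) (b i) * dot (phi w) (b j))))).
    apply: Ex_ge0 => w; rewrite [leRHS](_ : _ = \1_D w * g w ^+ 2).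
      by rewrite mulr_ge0 ?sqr_ge0.
    rewrite expr2 /g mulr_suml mulr_sumr; apply: eq_bigr => i _.
    by rewrite !mulr_sumr; apply: eq_bigr => j _; ring.
  have bt i j := bounded_measurableZ (dot x (b i) * dot x (b j)) (bounded_measurable_tensor i j).
  rewrite Ex_sum; last by move=> i; apply: bounded_measurable_sum => j; exact: bt.
  apply: eq_bigr => i _; rewrite Ex_sum; last by move=> j; exact: bt.
  apply: eq_bigr => j _; rewrite ExZ; last exact: bounded_measurable_tensor.
  by rewrite bochner_tensor_entry.
- by apply: (hs_norm_finite_bound hb) => //; exact: lin0.
Unshelve. all: by end_near. Qed.

End bochner_tensor.
End bochner_coordinates.

(** All eigenvalues of the zero operator are 0, also beyond the dimension, where the supremum is
    over the empty set. *)
Lemma half_gap0 (R : realType) (H : completeNormedModType R) (dot : {dot H for idfun}) p :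
  (0 < p)%N -> half_gap dot (0 : H -> H) p = 0.
Proof.
suff eig0 j : eigval dot (0 : H -> H) j.+1 = 0.
  by case: p => // p _; rewrite /half_gap !eig0 subrr mul0r.
rewrite /eigval; set S := [set _ | _].
have [[l [e [one _]]]|S0] := pselect (S !=set0); last first.
  by rewrite (_ : S = set0) ?sup0//; apply/seteqP; split=> // l Sl; case: S0; exists l.
have e0 : e ord0 != 0 by exact: orthonormal_neq0 one.
have ub : ubound S 0.
  move=> {e one e0} c [e [one ce]]; have [a ca /esym/eqP] := ce ord0.
  by rewrite scaler_eq0 (negbTE (orthonormal_neq0 _ one)) orbF => /eqP <-.
have S0 : S 0 by exists e; split=> // i; exists 0 => //; rewrite scale0r.
apply/eqP; rewrite eq_le ub_le_sup ?andbT//; last by exists 0.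
by apply: ge_sup => //; exists 0.
Qed.

Section covariance_operators.
Context {R : realType} {H : completeNormedModType R} (dot : {dot H for idfun}).
Hypothesis dot_norm : forall x : H, dot x x = `|x| ^+ 2.
Variables (b : nat -> H) (hb : hs_basis dot b).
Implicit Types (x y z : H) (A B : H -> H).

Lemma psd_hs0 : psd_hs dot b (0 : H -> H).
Proof.
split.
- by move=> a x y; rewrite scaler0 addr0.
- by move=> x; exact: cvg_cst.
- by move=> x y; rewrite dot0l dot0r.
- by move=> x; rewrite dot0l.
- by exists 0 => // n; rewrite big1 ?expr0n// => i _; rewrite normr0 expr0n.
Qed.

Lemma psd_hsD A B : psd_hs dot b A -> psd_hs dot b B -> psd_hs dot b (A + B).
Proof.
move=> [linA cA symA posA [h h0 Ah]] [linB cB symB posB [k k0 Bk]]; split.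
- move=> a x y; rewrite [LHS](_ : _ = A (a *: x + y) + B (a *: x + y))// linA linB.
  by rewrite addrACA -scalerDr.
- by move=> x; apply: cvgD; [exact: cA|exact: cB].
- by move=> x y; rewrite [LHS]dotDl [RHS]dotDr symA symB.
- by move=> x; rewrite [leRHS]dotDl addr_ge0.
- exists (Num.sqrt (2 * h ^+ 2 + 2 * k ^+ 2)); first exact: sqrtr_ge0.
  move=> n; rewrite sqr_sqrtr; last by rewrite addr_ge0// mulr_ge0// sqr_ge0.
  rewrite (le_trans _ (lerD (ler_wpM2l _ (Ah n)) (ler_wpM2l _ (Bk n))))//.
  rewrite !mulr_sumr -big_split/=; apply: ler_sum => i _.
  rewrite [leLHS](_ : _ = `|A (b i) + B (b i)| ^+ 2)// (sqr_normD dot_norm).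
  by have := sqr_ge0 `|A (b i) - B (b i)|; rewrite (sqr_normB dot_norm); lra.
Qed.

Lemma psd_hs_tensor x : psd_hs dot b (tensor dot x x).
Proof.
split.
- by move=> a y z; rewrite /tensor dotDr dotZr scalerDl scalerA.
- move=> y; apply: cvgZl; apply: cvg_dot => //; exact: cvg_cst.
- by move=> y z; rewrite dotZl dotZr mulrC (dotC dot y).
- by move=> y; rewrite dotZl -expr2 sqr_ge0.
- exists (`|x| ^+ 2) => [|n]; first exact: sqr_ge0.
  rewrite [leRHS]expr2; under eq_bigr do rewrite normrZ exprMn real_normK ?num_real//.
  by rewrite -mulr_suml ler_wpM2r ?sqr_ge0// (bessel_nat dot_norm hb).
Qed.

Lemma psd_hs_cov_emp n (x : 'I_n -> H) (s : 'S_n) k : psd_hs dot b (cov_emp dot x s k).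
Proof.
apply: psd_hsZ; first by rewrite invr_ge0.
apply: (big_ind (psd_hs dot b)) => [||i _]; [exact: psd_hs0|exact: psd_hsD|].
exact: psd_hs_tensor.
Qed.

Lemma cov_emp_entry n (x : 'I_n -> H) (s : 'S_n) k i j :
  dot (cov_emp dot x s k (b i)) (b j) = k%:R^-1 *
    \sum_(l < n | (l < k)%N) dot (angle (x (s l))) (b i) * dot (angle (x (s l))) (b j).
Proof.
rewrite /cov_emp [LHS]dotZl; congr (_ * _); rewrite fct_sumE dot_suml.
by apply: eq_bigr => l _; rewrite dotZl.
Qed.

Lemma normr_angle_le1 x : `|angle x| <= 1.
Proof.
rewrite normrZ normfV normr_id; have [->|x0] := eqVneq x 0; first by rewrite normr0 mulr0.
by rewrite mulVf// normr_eq0.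
Qed.

Lemma measurable_norm_borel : measurable_fun [set: borelType H] (fun x : borelType H => `|x : H|).
Proof. exact: (continuous_borel_measurable (@norm_continuous _ H)). Qed.

Lemma measurable_dot_borel y :
  measurable_fun [set: borelType H] (fun x : borelType H => dot (x : H) y).
Proof. exact: (continuous_borel_measurable (@continuous_dotl _ _ dot dot_norm y)). Qed.

Lemma measurable_dot_angle y :
  measurable_fun [set: borelType H] (fun x : borelType H => dot (angle (x : H)) y).
Proof.
rewrite [X in measurable_fun _ X](_ : _ = fun x : borelType H => `|x : H| `^ (-1) * dot (x : H) y).
  apply: measurable_funM; last exact: measurable_dot_borel.
  by apply: (measurableT_comp (f := (@powR R) ^~ (-1)));
    [exact: measurable_powR|exact: measurable_norm_borel].
by apply/funext => x; rewrite powR_inv1// -dotZl.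
Qed.

Lemma measurable_tail_borel t : measurable ([set x | t < `|x : H|] : set (borelType H)).
Proof.
have := measurable_norm_borel measurableT (measurable_itv `]t, +oo[); rewrite setTI.
by congr measurable; apply/seteqP; split=> x /=; rewrite in_itv/= andbT.
Qed.

Lemma measurable_sphere : measurable (@sphere R H : set (borelType H)).
Proof.
have := measurable_norm_borel measurableT (measurable_set1 (1 : R)); rewrite setTI.
by congr measurable; apply/seteqP; split=> x.
Qed.

Lemma bochner_integral_spec d (T : measurableType d) (P : probability T R) D F c p :
  (0 < p)%N -> 0 < half_gap dot (c *: bochner_integral dot P D F) p ->
  is_bochner_integral dot P D F (bochner_integral dot P D F).
Proof.
move=> p0; rewrite /bochner_integral; case: xgetP => [C _ intC _ //|_].
by rewrite scaler0 half_gap0// ltxx.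
Qed.

Section tail_and_limit.
Context d (T : measurableType d) (P : probability T R) (X : {RV P >-> borelType H}).

Lemma measurable_tail t : measurable (tail X t).
Proof. by rewrite -[tail X t]setTI; exact: (measurable_funP X) (measurable_tail_borel t). Qed.

Lemma measurable_dot_angle_RV y : measurable_fun setT (fun w => dot (angle (X w : H)) y).
Proof. exact: (measurableT_comp (measurable_dot_angle y)). Qed.

(* The matrix of [cov_tail] in the basis [b]; unlike [cov_tail], it does not
   depend on the existence of the Bochner integral. *)
Definition tail_entry t i j : R := (fine (P (tail X t)))^-1 *
  Ex P (fun w => \1_(tail X t) w * (dot (angle (X w : H)) (b i) * dot (angle (X w : H)) (b j))).

Lemma cov_tail_spec t p : (0 < p)%N -> 0 < half_gap dot (cov_tail dot P X t) p ->
  psd_hs dot b (cov_tail dot P X t) /\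
  forall i j, dot (cov_tail dot P X t (b i)) (b j) = tail_entry t i j.
Proof.
move=> p0 gap; have intC := bochner_integral_spec p0 gap.
have mphi i := measurable_dot_angle_RV (b i).
have phi1 (w : T) : tail X t w -> `|angle (X w : H)| <= 1 by move=> _; exact: normr_angle_le1.
have mD := measurable_tail t.
split.
  apply: psd_hsZ; first by rewrite invr_ge0 fine_ge0.
  exact: (bochner_tensor_psd dot_norm hb mD mphi phi1 intC).
move=> i j; rewrite /cov_tail [LHS]dotZl; congr (_ * _).
exact: (bochner_tensor_entry dot_norm hb mD mphi phi1 intC).
Qed.

End tail_and_limit.

Definition limit_entry (Q : probability (borelType H) R) i j : R :=
  Ex Q (fun x => \1_(@sphere R H : set (borelType H)) x * (dot (x : H) (b i) * dot (x : H) (b j))).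

Lemma cov_limit_spec (Q : probability (borelType H) R) p :
  (0 < p)%N -> 0 < half_gap dot (cov_limit dot Q) p ->
  psd_hs dot b (cov_limit dot Q) /\
  forall i j, dot (cov_limit dot Q (b i)) (b j) = limit_entry Q i j.
Proof.
move=> p0 gap.
have intC : is_bochner_integral dot Q (@sphere R H) (fun x : H => tensor dot x x) (cov_limit dot Q).
  rewrite /cov_limit in gap *; apply: (@bochner_integral_spec _ _ _ _ _ 1 p p0).
  by rewrite scale1r.
have mphi i := measurable_dot_borel (b i).
have phi1 (x : borelType H) : @sphere R H x -> `|x : H| <= 1 by rewrite /sphere /= => ->.
split; first exact: (bochner_tensor_psd dot_norm hb measurable_sphere mphi phi1 intC).
move=> i j.
exact: (bochner_tensor_entry dot_norm hb measurable_sphere mphi phi1 intC).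
Qed.

End covariance_operators.

(** * Concentration *)

Section order_statistics.
Context {R : realType} {H : completeNormedModType R}.

Lemma card_ord_lt n m : (m <= n)%N -> #|[pred j : 'I_n | (j < m)%N]| = m.
Proof.
by move=> mn; rewrite -sum1_card -(big_ord_widen _ (fun=> 1%N) mn) sum1_card card_ord.
Qed.

Lemma down_closed_ord n (Q : pred 'I_n) :
  (forall i j : 'I_n, (i <= j)%N -> Q j -> Q i) -> forall l : 'I_n, Q l = (l < #|Q|)%N.
Proof.
move=> dQ l; apply/idP/idP => [Ql|].
  rewrite -[X in (X <= _)%N](card_ord_lt (ltn_ord l)); apply: subset_leq_card.
  by apply/fintype.subsetP => j; rewrite !inE ltnS => /dQ; apply.
apply: contraTT => nQl; rewrite -leqNgt -[X in (_ <= X)%N](card_ord_lt (ltnW (ltn_ord l))).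
apply: subset_leq_card; apply/fintype.subsetP => j Qj; rewrite inE ltnNge.
by apply: contra nQl => lj; exact: dQ lj Qj.
Qed.

(* The sample points of norm [> t] are the first ones in any decreasing order,
   hence differ from the [k] first ones by as many points as their number
   differs from [k]. *)
Lemma order_statistics_sum (I : finType) (Y : H -> I -> R) n k (x : 'I_n -> H) (s : 'S_n) (t : R) :
  (k <= n)%N -> norm_decreasing x s -> (forall y, fnorm (Y y) <= 1) ->
  fnorm (fun a => \sum_(l < n | (l < k)%N) Y (x (s l)) a -
                  \sum_(i < n) (t < `|x i|)%R%:R * Y (x i) a) <=
  `|\sum_(i < n) (t < `|x i|)%R%:R - k%:R|.
Proof.
move=> kn sx Y1.
pose Q (l : 'I_n) := t < `|x (s l)|; pose c := #|Q|.
have Qc l : Q l = (l < c)%N.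
  apply: down_closed_ord => i j ij; rewrite /Q => /lt_le_trans; apply; exact: sx.
have sumc (m : nat) : (m <= n)%N -> \sum_(l < n) (l < m)%:R = m%:R :> R.
  move=> mn; rewrite -[in RHS](card_ord_lt mn) -sum1_card natr_sum [RHS]big_mkcond/=.
  by apply: eq_bigr => l _; rewrite inE; case: (l < m)%N.
have cn : (c <= n)%N by rewrite /c -[leqRHS]card_ord max_card.
have -> : \sum_(i < n) (t < `|x i|)%R%:R = c%:R :> R.
  rewrite -(sumc _ cn) [LHS](reindex_inj (@perm_inj _ s))/=.
  by apply: eq_bigr => l _; rewrite -Qc.
have -> : (fun a => \sum_(l < n | (l < k)%N) Y (x (s l)) a -
    \sum_(i < n) (t < `|x i|)%R%:R * Y (x i) a) =
    fun a => \sum_(l < n) ((l < k)%:R - (l < c)%:R) * Y (x (s l)) a.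
  apply/funext => a; rewrite [X in _ - X](reindex_inj (@perm_inj _ s))/=.
  rewrite [X in X - _]big_mkcond/= -sumrB; apply: eq_bigr => l _.
  by rewrite mulrBl -Qc /Q; case: (l < k)%N; rewrite ?mul1r ?mul0r.
apply: (le_trans (fnorm_sum _ _ _)).
apply: (@le_trans _ _ (\sum_(l < n) `|(l < k)%:R - (l < c)%:R : R|)).
  by apply: ler_sum => l _; rewrite fnormZ ler_piMr.
rewrite distrC -(sumc _ cn) -(sumc _ kn) -sumrB.
(* Both index sets are initial segments, so the differences of indicators have a constant sign and
   the sum of their absolute values is the absolute value of their sum. *)
have [ck|/ltnW kc] := leqP c k.
  rewrite ger0_norm; last first.
    apply: sumr_ge0 => l _; rewrite subr_ge0 ler_nat.
    by case: (ltnP l c) => // lc; rewrite (leq_trans lc ck).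
  apply: ler_sum => l _; rewrite ger0_norm// subr_ge0 ler_nat.
  by case: (ltnP l c) => // lc; rewrite (leq_trans lc ck).
rewrite ler0_norm; last first.
  apply: sumr_le0 => l _; rewrite subr_le0 ler_nat.
  by case: (ltnP l k) => // lc; rewrite (leq_trans lc kc).
rewrite -sumrN; apply: ler_sum => l _; rewrite ler0_norm// subr_le0 ler_nat.
by case: (ltnP l k) => // lc; rewrite (leq_trans lc kc).
Qed.

End order_statistics.

(* With [q = sqrt k], [v = sqrt (ln (2 / delta))] and [w = sqrt 2], the choice
   [l = v / (2 q)] is admissible as long as [v <= 1.4 q]; otherwise take
   [l = 0.7]. *)
Lemma deviation_bound_spec (R : realType) (k : nat) (delta : R) :
  (0 < k)%N -> 0 < delta < 1 ->
  exists l : R, [/\ 0 <= l, l * (2 * Num.sqrt 2) <= 2 &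
    2 * expR (- (l * (k%:R * deviation_bound k delta / Num.sqrt 2)) + 3 * (l ^+ 2 * k%:R)) < delta].
Proof.
move=> k0 /andP[d0 d1].
pose u := ln (2 / delta); pose u' := ln (4 / delta).
have u_gt0 : 0 < u by rewrite ln_gt0// ltr_pdivlMr// mul1r; lra.
have uu' : u <= u' by rewrite ler_ln ?posrE ?divr_gt0// ler_pM2r ?invr_gt0//; lra.
pose q : R := Num.sqrt k%:R; pose v := Num.sqrt u; pose v' := Num.sqrt (8 * u');
  pose w : R := Num.sqrt 2.
have k_gt0 : 0 < k%:R :> R by rewrite ltr0n.
have q0 : 0 < q by rewrite sqrtr_gt0.
have v0 : 0 < v by rewrite sqrtr_gt0.
have w0 : 0 < w by rewrite sqrtr_gt0.
have q2 : q * q = k%:R by rewrite -expr2 sqr_sqrtr// ltW.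
have v2 : v * v = u by rewrite -expr2 sqr_sqrtr// ltW.
have w2 : w * w = 2 by rewrite -expr2 sqr_sqrtr.
have w142 : w <= 142 / 100.
  by rewrite -ler_sqr ?nnegrE ?(ltW w0)// sqr_sqrtr//; lra.
have v'v : 28 / 10 * v <= v'.
  have -> : 28 / 10 * v = Num.sqrt ((28 / 10) ^+ 2 * u).
    by rewrite sqrtrM ?sqr_ge0// sqrtr_sqr ger0_norm.
  by rewrite ler_wsqrtr//; lra.
pose kB := k%:R * deviation_bound k delta.
have kBE : kB = q * (1 + 4 * v + v') + (8 * u + 4 * u') / 3.
  have E (x y z : R) : x != 0 -> x * x * (y / x + z / (3 * (x * x))) = x * y + z / 3.
    by move=> x0; field.
  by rewrite /kB /deviation_bound -/q -/u -/u' -/v -/v' -q2 E ?gt_eqF.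
(* [6.8 = 4 + 2.8] with [2.8 <= sqrt 8], and [4 u <= (8 u + 4 u') / 3] because [u <= u']. *)
have kBge : 68 / 10 * (q * v) + 4 * u <= kB.
  have : 0 <= q * (1 + (v' - 28 / 10 * v)) by rewrite mulr_ge0 ?(ltW q0)//; lra.
  rewrite kBE; lra.
pose r := kB / w.
have rw : r * w = kB by rewrite divfK// gt_eqF.
have r0 : 0 <= r.
  by rewrite divr_ge0 ?(ltW w0)// (le_trans _ kBge)// addr_ge0 ?mulr_ge0 ?(ltW u_gt0) ?(ltW q0)
    ?(ltW v0).
have rge : 68 / 10 * (q * v) + 4 * u <= 142 / 100 * r.
  by rewrite (le_trans kBge)// -rw mulrC ler_wpM2r.
suff [l [l0 lw lr]] : exists l,
  [/\ 0 <= l, l * (2 * w) <= 2 & - (l * r) + 3 * (l ^+ 2 * k%:R) < - u].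
  exists l; split=> //; rewrite -/kB -/w -/r.
  have -> : delta = 2 * expR (- u).
    by rewrite expRN lnK ?posrE ?divr_gt0// invf_div; field.
  by rewrite ltr_pM2l// ltr_expR.
have [vq|qv] := leP v (14 / 10 * q).
  (* Here [3 l^2 k = 0.75 u], whereas [l r >= 3.4 u / 1.42 > 2.39 u]. *)
  exists (v / (2 * q)); split; first by rewrite divr_ge0 ?(ltW v0) ?mulr_ge0 ?(ltW q0).
    have E (x y z : R) : x != 0 -> y / (2 * x) * (2 * z) = (y / x) * z by move=> x0; field.
    rewrite E ?gt_eqF//.
    apply: (@le_trans _ _ (14 / 10 * w)); last lra.
    by apply: ler_wpM2r; [exact: ltW|rewrite ler_pdivrMr].
  have h : v / (2 * q) * (68 / 10 * (q * v) + 4 * u) <= v / (2 * q) * (142 / 100 * r).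
    by apply: ler_wpM2l => //; rewrite divr_ge0 ?(ltW v0) ?mulr_ge0 ?(ltW q0).
  have e1 : v / (2 * q) * (68 / 10 * (q * v) + 4 * u) = 34 / 10 * u + 2 * (v / q * u).
    have E (x y z : R) : x != 0 -> y / (2 * x) * (68 / 10 * (x * y) + 4 * z) =
      34 / 10 * (y * y) + 2 * (y / x * z) by move=> x0; field.
    by rewrite E ?gt_eqF// v2.
  have e2 : (v / (2 * q)) ^+ 2 * k%:R = u / 4.
    have E (x y : R) : x != 0 -> (y / (2 * x)) ^+ 2 * (x * x) = (y * y) / 4 by move=> x0; field.
    by rewrite -q2 E ?gt_eqF// v2.
  have : 0 <= v / q * u by rewrite mulr_ge0 ?divr_ge0 ?(ltW v0) ?(ltW q0) ?(ltW u_gt0).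
  rewrite e2; lra.
(* Now [1.96 k < u], so that [3 l^2 k = 1.47 k < 0.75 u], whereas [l r >= 2.8 u / 1.42 > 1.97 u]. *)
exists (7 / 10); split; [lra|lra|].
have : 14 / 10 * q * (14 / 10 * q) < v * v.
  by apply: ltr_pM => //; rewrite mulr_ge0// ltW.
have : 0 <= q * v by rewrite mulr_ge0 ?ltW.
rewrite v2 -q2; nra.
Qed.

Lemma Ex_ident d d' (T : measurableType d) (E : measurableType d') (R : realType)
    (P : probability T R) (X Y : {RV P >-> E}) (g : E -> R) :
  (forall A, measurable A -> P (Y @^-1` A) = P (X @^-1` A)) ->
  bounded_measurable g -> Ex P (g \o Y) = Ex P (g \o X).
Proof.
move=> XY [mg [M gM]].
have mEg : measurable_fun setT (EFin \o g) by exact/measurable_EFinP.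
have bg (Z : {RV P >-> E}) : bounded_measurable (g \o Z).
  by split; [exact: measurableT_comp|exists M => w; exact: gM].
have intE (Z : {RV P >-> E}) : (Ex P (g \o Z))%:E = (\int[distribution P Z]_x (g x)%:E)%E.
  rewrite EFin_Ex ?integral_distribution//.
  exact: (bounded_measurable_integrable P (bg Z)).
apply: EFin_inj; rewrite !intE; apply: eq_measure_integral => A mA _; exact: XY.
Qed.

Lemma sum_option (R : realType) (I : finType) (F : option I -> R) :
  \sum_o F o = F None + \sum_i F (Some i).
Proof.
rewrite (bigD1 None)//=; congr (_ + _).
by rewrite (reindex_omap Some id) => [|[i|]//]; apply: eq_bigl => i; rewrite /= eqxx.
Qed.

(** Bounds the error in the count ([None]) and the error in the tensors ([Some]) together, through
    one application of [pinelis]. *)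
Lemma fnorm_option (R : realType) (I : finType) (x : option I -> R) :
  `|x None| + fnorm (fun i => x (Some i)) <= Num.sqrt 2 * fnorm x.
Proof.
rewrite -ler_sqr ?nnegrE ?addr_ge0 ?mulr_ge0 ?fnorm_ge0// exprMn sqr_sqrtr// sqr_fnorm.
rewrite sum_option sqrrD !sqr_fnorm real_normK ?num_real//.
have := sqr_fnorm (fun i => x (Some i)).
have := sqr_ge0 (`|x None| - fnorm (fun i => x (Some i))).
rewrite sqrrB real_normK ?num_real// => h <-; lra.
Qed.

Lemma ler_sum_square (R : realType) (F : nat -> nat -> R) N N' :
  (forall i j, 0 <= F i j) -> (N <= N')%N ->
  \sum_(ij : 'I_N * 'I_N) F ij.1 ij.2 <= \sum_(ij : 'I_N' * 'I_N') F ij.1 ij.2.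
Proof.
move=> F0 NN'.
rewrite -(pair_bigA _ (fun i j : 'I_N => F i j)) -(pair_bigA _ (fun i j : 'I_N' => F i j))/=.
have widen (f : nat -> R) : (forall i, 0 <= f i) -> \sum_(i < N) f i <= \sum_(i < N') f i.
  move=> f0; rewrite (big_ord_widen _ f NN') big_mkcond/=.
  by apply: ler_sum => i _; case: ifP.
apply: (@le_trans _ _ (\sum_(i < N) \sum_(j < N') F i j)).
  by apply: ler_sum => i _; exact: widen.
by apply: (widen (fun i => \sum_(j < N') F i j)) => i; exact: sumr_ge0.
Qed.

(** * Deviation of the empirical operator from the tail entries *)

Section concentration.
Context {R : realType} {H : completeNormedModType R} (dot : {dot H for idfun}).
Hypothesis dot_norm : forall x : H, dot x x = `|x| ^+ 2.
Variables (b : nat -> H) (hb : hs_basis dot b).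
Context d (T : measurableType d) (P : probability T R).
Variables (X : {RV P >-> borelType H}) (X_ : nat -> {RV P >-> borelType H}).
Hypothesis X_copies : independent_copies P X (fun i => X_ i).
Variables (n k : nat) (t : R).
Hypotheses (k0 : (0 < k)%N) (kn : (k <= n)%N) (t0 : 0 <= t).
Hypothesis Pt : P (tail X t) = (k%:R / n%:R)%:E.

Section feature.
Variable N : nat.
Let I := option ('I_N * 'I_N).

Let entry (x : H) (ij : 'I_N * 'I_N) := dot (angle x) (b ij.1) * dot (angle x) (b ij.2).

Let gr (i : I) (x : borelType H) : R :=
  (t < `|x : H|)%R%:R * (if i is Some ij then entry x ij else 1).

Let mean i := Ex P (gr i \o X).

Definition feature (i : I) (x : borelType H) : R := gr i x - mean i.

Lemma fnorm_entry_le1 (x : H) : fnorm (entry x) <= 1.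
Proof.
rewrite (@fnorm_prod _ N (fun i => dot (angle x) (b i)) (fun i => dot (angle x) (b i))).
have h : fnorm (fun i : 'I_N => dot (angle x) (b i)) <= 1.
  exact: le_trans (fnorm_coord_le dot_norm hb N (angle x)) (normr_angle_le1 x).
by rewrite mulr_ile1 ?fnorm_ge0.
Qed.

Let sum_gr x : \sum_i gr i x ^+ 2 <= 2 * (t < `|x : H|)%R%:R.
Proof.
rewrite sum_option /gr mulr1; case: (t < _)%R => /=; last first.
  by rewrite mulr0 big1 ?expr0n ?addr0// => i _; rewrite mul0r expr0n.
have := fnorm_entry_le1 x; rewrite fnorm_le// expr1n => h.
under eq_bigr do rewrite mul1r; lra.
Qed.

Let mgr i : measurable_fun setT (gr i).
Proof.
apply: measurable_funM.
  rewrite (_ : (fun x : borelType H => _) = \1_([set x | t < `|x : H|] : set (borelType H))).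
    by apply: measurable_indic; exact: measurable_tail_borel.
  by apply/funext => x; rewrite indicE; congr (nat_of_bool _)%:R; apply/idP/idP; rewrite inE.
case: i => [ij|]; last exact: measurable_cst.
by apply: measurable_funM; exact: measurable_dot_angle.
Qed.

Let gr_le i x : `|gr i x| <= Num.sqrt 2.
Proof.
rewrite -ler_sqr ?nnegrE// sqr_sqrtr// real_normK ?num_real//.
apply: (@le_trans _ _ (2 * (t < `|x : H|)%R%:R)); last by case: (t < _)%R => /=; lra.
by apply: le_trans (sum_gr x); rewrite (bigD1 i)//= lerDl sumr_ge0// => j _; exact: sqr_ge0.
Qed.

Let bgr i : bounded_measurable (gr i).
Proof. by split; [exact: mgr|exists (Num.sqrt 2) => x; exact: gr_le]. Qed.

Let bgrX (Y : {RV P >-> borelType H}) i : bounded_measurable (gr i \o Y).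
Proof.
split; first by apply: measurableT_comp => //; exact: mgr.
by exists (Num.sqrt 2) => x; exact: gr_le.
Qed.

(** The vectors vanish off the tail event, so their second moment is of order [k / n]. Summed over
    [n] observations it is [2 k], whence a rate in [k] instead of [n]. *)
Let sum_mean_sqr : \sum_i Ex P ((gr i \o X) \* (gr i \o X)) <= 2 * (k%:R / n%:R).
Proof.
rewrite -Ex_sum; last by move=> i; exact: bounded_measurableM.
have mt := measurable_tail X t.
have -> : 2 * (k%:R / n%:R) = Ex P (fun w => 2 * \1_(tail X t) w).
  rewrite ExZ ?Ex_indic ?Pt//; exact: bounded_measurable_indic.
apply: Ex_le.
- by apply: bounded_measurable_sum => i; exact: bounded_measurableM.
- exact/bounded_measurableZ/bounded_measurable_indic.
move=> w; apply: le_trans (sum_gr (X w)) _.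
rewrite le_eqVlt; apply/orP; left; apply/eqP; congr (_ * (nat_of_bool _)%:R).
by apply/idP/idP; rewrite inE.
Qed.

Let fnorm_mean : fnorm mean <= Num.sqrt 2.
Proof.
rewrite fnorm_le// sqr_sqrtr//.
apply: (@le_trans _ _ (2 * (k%:R / n%:R))); last first.
  by rewrite ler_piMr// ler_pdivrMr ?mul1r ?ler_nat// ltr0n (leq_trans k0).
apply: le_trans sum_mean_sqr; apply: ler_sum => i _; exact: sqr_Ex_le.
Qed.

Lemma measurable_feature i : measurable_fun setT (feature i).
Proof. by apply: measurable_funB => //; exact: mgr. Qed.

Lemma fnorm_feature x : fnorm (fun i => feature i x) <= 2 * Num.sqrt 2.
Proof.
rewrite (_ : (fun i => _) = (fun i => gr i x) \+ (fun i => -1 * mean i)); last first.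
  by apply/funext => i; rewrite /= mulN1r.
rewrite (le_trans (fnormD _ _))// (fnormZ (-1)) normrN normr1 mul1r
  (_ : 2 * _ = Num.sqrt 2 + Num.sqrt 2); last by ring.
apply: lerD => //; rewrite fnorm_le// sqr_sqrtr//.
by apply: (le_trans (sum_gr x)); case: (t < _)%R => /=; lra.
Qed.

Let Ex_gr m i : Ex P (gr i \o X_ m) = mean i.
Proof. by apply: Ex_ident; [case: X_copies => XE _; exact: XE|exact: bgr]. Qed.

Lemma feature_centered m i : Ex P (feature i \o X_ m) = 0.
Proof.
rewrite (_ : feature i \o X_ m = (gr i \o X_ m) \- (fun=> mean i))//.
by rewrite ExB ?Ex_cst ?Ex_gr ?subrr//; exact: bounded_measurable_cst.
Qed.

Lemma feature_var m : \sum_i Ex P ((feature i \* feature i) \o X_ m) <= 2 * (k%:R / n%:R).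
Proof.
apply: le_trans sum_mean_sqr; apply: ler_sum => i _.
have b2 (Y : {RV P >-> borelType H}) := bounded_measurableM (bgrX Y i) (bgrX Y i).
have bZ := bounded_measurableZ (2 * mean i) (bgrX (X_ m) i).
rewrite (_ : (feature i \* feature i) \o X_ m = ((gr i \o X_ m) \* (gr i \o X_ m)) \-
  (fun w => 2 * mean i * (gr i \o X_ m) w) \+ (fun=> mean i ^+ 2)); last first.
  by apply/funext => w; rewrite /feature /=; ring.
rewrite ExD; [|exact: bounded_measurableB|exact: bounded_measurable_cst].
rewrite ExB// ExZ// Ex_cst Ex_gr.
have -> : Ex P ((gr i \o X_ m) \* (gr i \o X_ m)) = Ex P ((gr i \o X) \* (gr i \o X)).
  apply: (@Ex_ident _ _ _ _ _ P X (X_ m) (gr i \* gr i));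
    first by case: X_copies => XE _; exact: XE.
  exact: bounded_measurableM (bgr i) (bgr i).
by have := sqr_ge0 (mean i); lra.
Qed.

Let S w i := \sum_(m < n) feature i (X_ m w).

Lemma feature_sum_measurable : measurable_fun setT (fun w => fnorm (S w)).
Proof.
apply: (measurableT_comp (f := @Num.sqrt R)).
  by apply: continuous_measurable_fun; exact: sqrt_continuous.
apply: measurable_sum => i; apply: measurable_funX; apply: measurable_sum => m.
by apply: measurableT_comp => //; exact: measurable_feature.
Qed.

Lemma feature_sum_tail l r : 0 <= l -> l * (2 * Num.sqrt 2) <= 2 ->
  fine (P [set w | r < fnorm (S w)]) <= 2 * expR (- (l * r) + 3 * (l ^+ 2 * k%:R)).
Proof.
move=> l0 lb; have [_ ind] := X_copies.
have mX i : measurable_fun setT (X_ i) by [].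
have := pinelis (P := P) mX ind r n measurable_feature fnorm_feature feature_centered feature_var
  l0 lb.
move=> /le_trans; apply; rewrite le_eqVlt; apply/orP; left; apply/eqP.
have n0 : n%:R != 0 :> R by rewrite pnatr_eq0 -lt0n (leq_trans k0).
by congr (_ * expR (_ + _)); field.
Qed.

Let k_neq0 : k%:R != 0 :> R.
Proof. by rewrite pnatr_eq0 -lt0n. Qed.

Let n_neq0 : n%:R != 0 :> R.
Proof. by rewrite pnatr_eq0 -lt0n (leq_trans k0). Qed.

(** The sum over the first [k] order statistics is compared with the sum over the observations above
    [t]; by [order_statistics_sum] this costs the absolute value of the coordinate [None]. The
    centred sum over the latter observations gives the coordinates [Some]. *)
Lemma cov_emp_deviation w (s : 'S_n) :
  norm_decreasing (fun i : 'I_n => X_ i w : H) s ->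
  k%:R * fnorm (fun ij : 'I_N * 'I_N =>
      dot (cov_emp dot (fun i : 'I_n => X_ i w : H) s k (b ij.1)) (b ij.2) -
      tail_entry dot b X t ij.1 ij.2) <= Num.sqrt 2 * fnorm (S w).
Proof.
move=> sdec; pose x (i : 'I_n) : H := X_ i w.
apply: le_trans (fnorm_option (S w)).
have meanE ij : mean (Some ij) = k%:R / n%:R * tail_entry dot b X t ij.1 ij.2.
  rewrite /tail_entry Pt mulrA divff ?mul1r; last by rewrite mulf_neq0 ?invr_eq0.
  congr Ex; apply/funext => w'; rewrite /gr /entry /= indicE.
  by congr ((nat_of_bool _)%:R * _); apply/idP/idP; rewrite inE.
have mean0 : mean None = k%:R / n%:R.
  rewrite /mean (_ : gr None \o X = \1_(tail X t)) ?Ex_indic ?Pt//; first exact: measurable_tail.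
  by apply/funext => w'; rewrite /gr /= mulr1 indicE; congr (nat_of_bool _)%:R;
    apply/idP/idP; rewrite inE.
have S0 : S w None = \sum_(i < n) (t < `|x i|)%R%:R - k%:R.
  rewrite /S /feature sumrB sumr_const card_ord mean0 -[X in _ - X]mulr_natr divfK//; congr (_ - _).
  by apply: eq_bigr => i _; rewrite /gr mulr1.
have SS ij : S w (Some ij) = \sum_(i < n) (t < `|x i|)%R%:R * entry (x i) ij -
    k%:R * tail_entry dot b X t ij.1 ij.2.
  rewrite /S /feature sumrB sumr_const card_ord meanE -[X in _ - X]mulr_natr mulrAC divfK//.
have := order_statistics_sum t kn sdec fnorm_entry_le1; rewrite -S0 => os.
rewrite -[X in X * _](ger0_norm (ler0n R k)) -fnormZ.
rewrite (_ : (fun ij : 'I_N * 'I_N => _) = (fun a => \sum_(l < n | (l < k)%N) entry (x (s l)) a -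
      \sum_(i < n) (t < `|x i|)%R%:R * entry (x i) a) \+ (fun ij => S w (Some ij))).
  by apply: (le_trans (fnormD _ _)); rewrite lerD2r.
apply/funext => ij; rewrite /= SS mulrBr cov_emp_entry mulrA divff// mul1r.
by rewrite addrA subrK.
Qed.

End feature.

Let S N w (i : option ('I_N * 'I_N)) := \sum_(m < n) feature i (X_ m w).

Lemma feature_sum_homo w (N N' : nat) : (N <= N')%N -> fnorm (@S N w) <= fnorm (@S N' w).
Proof.
move=> NN'; rewrite -ler_sqr ?nnegrE ?fnorm_ge0// !sqr_fnorm !sum_option lerD2l.
pose g a c (x : H) := (t < `|x|)%R%:R * (dot (angle x) (b a) * dot (angle x) (b c)).
pose F a c := (\sum_(m < n) (g a c (X_ m w) - Ex P (fun w => g a c (X w)))) ^+ 2.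
by apply: (@ler_sum_square R F) => // i j; exact: sqr_ge0.
Qed.

(** The bad events increase with [N] and their probabilities have a common bound, which therefore
    holds for their union. Its complement is fixed before the ordering [s], so any resolution of
    ties is allowed. *)
Lemma concentration delta : 0 < delta < 1 -> exists A : set T,
  [/\ measurable A, ((1 - delta)%:E < P A)%E &
    forall w, A w -> forall s : 'S_n, norm_decreasing (fun i : 'I_n => X_ i w : H) s ->
    forall N, fnorm (fun ij : 'I_N * 'I_N =>
      dot (cov_emp dot (fun i : 'I_n => X_ i w : H) s k (b ij.1)) (b ij.2) -
      tail_entry dot b X t ij.1 ij.2) <= deviation_bound k delta].
Proof.
move=> d01; have [l [l0 lb]] := deviation_bound_spec k0 d01.
set r := k%:R * _ / _; set eps := 2 * expR _ => eps_delta.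
pose bad N := [set w | r < fnorm (@S N w)].
have mbad N : measurable (bad N).
  have := feature_sum_measurable N measurableT (measurable_itv `]r, +oo[); rewrite setTI.
  by congr measurable; apply/seteqP; split=> x /=; rewrite in_itv/= andbT.
have mB : measurable (\bigcup_N bad N) by exact: bigcupT_measurable.
have Pbad N : (P (bad N) <= eps%:E)%E.
  by rewrite -[leLHS]fineK ?fin_num_measure// lee_fin; exact: feature_sum_tail.
have PB : (P (\bigcup_N bad N) <= eps%:E)%E.
  have : P (bad N) @[N --> \oo] --> P (\bigcup_N bad N).
    apply: nondecreasing_cvg_mu => // N N' NN'; apply/subsetPset => w /lt_le_trans; apply.
    exact: feature_sum_homo.
  by move/cvge_to_le; apply; exact: nearW.
exists (~` \bigcup_N bad N); split; first exact: measurableC.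
  rewrite probability_setC// -[X in (_ < _ - X)%E]fineK ?fin_num_measure//.
  rewrite -EFinB lte_fin ltrD2l ltrN2 (le_lt_trans _ eps_delta)//.
  by rewrite -lee_fin fineK ?fin_num_measure.
move=> w nbad s sdec N.
have Sr : fnorm (@S N w) <= r by rewrite leNgt; apply/negP => rS; apply: nbad; exists N.
have k_gt0 : 0 < k%:R :> R by rewrite ltr0n.
rewrite -(ler_pM2l k_gt0) (le_trans (cov_emp_deviation N sdec))//.
apply: (le_trans (ler_wpM2l (sqrtr_ge0 2) Sr)).
by rewrite /r mulrC divfK// gt_eqF// sqrtr_gt0.
Qed.

End concentration.

(** * Convergence of the tail covariance *)

Lemma sum_square_restrict (R : realType) (F : nat -> nat -> R) K M : (K <= M)%N ->
  \sum_(ij : 'I_M * 'I_M) ((ij.1 < K)%N && (ij.2 < K)%N)%:R * F ij.1 ij.2 =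
  \sum_(ij : 'I_K * 'I_K) F ij.1 ij.2.
Proof.
move=> KM; rewrite -(pair_bigA _ (fun i j : 'I_K => F i j))/=.
rewrite -(pair_bigA _ (fun i j : 'I_M => ((i < K)%N && (j < K)%N)%:R * F i j))/=.
rewrite (big_ord_widen M (fun i => \sum_(j < K) F i j) KM) [RHS]big_mkcond/=.
apply: eq_bigr => i _; case: (i < K)%N; last by rewrite big1// => j _; rewrite mul0r.
rewrite (big_ord_widen M (fun j => F i j) KM) [RHS]big_mkcond/=.
by apply: eq_bigr => j _; case: (j < K)%N; rewrite ?mul1r ?mul0r.
Qed.

Section conditional_second_moments.
Context {R : realType} {H : completeNormedModType R} (dot : {dot H for idfun}).
Hypothesis dot_norm : forall x : H, dot x x = `|x| ^+ 2.
Variables (b : nat -> H) (hb : hs_basis dot b).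
Context d (T : measurableType d) (P : probability T R).
Variables (D : set T) (mD : measurable D) (PD : 0 < fine (P D)) (phi : T -> H).
Hypotheses (mphi : forall i, measurable_fun setT (fun w => dot (phi w) (b i)))
  (phi1 : forall w, D w -> `|phi w| <= 1).

(** Used both for [angle X] under [P] given a tail event and for the identity under [Q] given the
    sphere, so that one estimate serves [tail_entry] and [limit_entry]. *)
Definition cond_Ex (f : T -> R) := (fine (P D))^-1 * Ex P (fun w => \1_D w * f w).

Let bm (f : T -> R) := bounded_measurable (fun w => \1_D w * f w).

Let bmD f g : bm f -> bm g -> bm (f \+ g).
Proof.
by move=> bf bg; rewrite /bm; under eq_fun do rewrite mulrDr; exact: bounded_measurableD.
Qed.

Let bmZ c f : bm f -> bm (fun w => c * f w).
Proof. by move=> bf; rewrite /bm; under eq_fun do rewrite mulrCA; exact: bounded_measurableZ. Qed.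

Let bmM f g : bm f -> bm g -> bm (f \* g).
Proof.
move=> bf bg; rewrite /bm (_ : (fun w => _) = (fun w => \1_D w * f w) \* (fun w => \1_D w * g w)).
  exact: bounded_measurableM.
by apply/funext => w /=; rewrite indicE; case: (w \in D); rewrite !(mul1r, mul0r).
Qed.

Let bm_cst c : bm (fun=> c).
Proof.
apply: bounded_measurableM (bounded_measurable_cst _ _); exact: bounded_measurable_indic.
Qed.

Let bm_sum (J : Type) (s : seq J) (f : J -> T -> R) :
  (forall j, bm (f j)) -> bm (fun w => \sum_(j <- s) f j w).
Proof.
by move=> bf; rewrite /bm; under eq_fun do rewrite mulr_sumr; exact: bounded_measurable_sum.
Qed.

Lemma cond_ExD f g : bm f -> bm g -> cond_Ex (f \+ g) = cond_Ex f + cond_Ex g.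
Proof.
move=> bf bg; rewrite /cond_Ex -mulrDr -ExD//; congr (_ * Ex _ _).
by apply/funext => w; rewrite mulrDr.
Qed.

Lemma cond_ExZ c f : bm f -> cond_Ex (fun w => c * f w) = c * cond_Ex f.
Proof.
move=> bf; rewrite /cond_Ex mulrCA -(ExZ P c bf); congr (_ * Ex _ _).
by apply/funext => w; rewrite mulrCA.
Qed.

Lemma cond_Ex_cst c : cond_Ex (fun=> c) = c.
Proof.
rewrite /cond_Ex (_ : (fun w => _) = fun w => c * \1_D w); last by apply/funext => w; rewrite mulrC.
rewrite ExZ ?Ex_indic//; last exact: bounded_measurable_indic.
by rewrite mulrCA mulVf ?mulr1// gt_eqF.
Qed.

Lemma cond_Ex_sum (J : Type) (s : seq J) (f : J -> T -> R) : (forall j, bm (f j)) ->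
  cond_Ex (fun w => \sum_(j <- s) f j w) = \sum_(j <- s) cond_Ex (f j).
Proof.
move=> bf; rewrite /cond_Ex -mulr_sumr -Ex_sum//; congr (_ * Ex _ _).
by apply/funext => w; rewrite mulr_sumr.
Qed.

Lemma cond_Ex_le f g : bm f -> bm g -> (forall w, D w -> f w <= g w) -> cond_Ex f <= cond_Ex g.
Proof.
move=> bf bg fg; rewrite /cond_Ex ler_wpM2l ?invr_ge0 ?(ltW PD)// Ex_le// => w.
rewrite indicE; have [/set_mem Dw|_] := boolP (w \in D); last by rewrite !mul0r.
by rewrite !mul1r fg.
Qed.

Lemma sqr_cond_Ex_le f : bm f -> cond_Ex f ^+ 2 <= cond_Ex (f \* f).
Proof.
move=> bf; set m := cond_Ex f.
have bff := bmM bf bf; have bc := bm_cst (m ^+ 2); have bz := bmZ (- (2 * m)) bf.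
have : cond_Ex (fun=> 0) <= cond_Ex (f \* f \+ (fun w => - (2 * m) * f w) \+ (fun=> m ^+ 2)).
  apply: cond_Ex_le; first exact: bm_cst.
    by apply: bmD => //; exact: bmD.
  move=> w _ /=; rewrite (_ : _ + _ = (f w - m) ^+ 2) ?sqr_ge0//; ring.
rewrite cond_ExD//; last exact: bmD.
rewrite !cond_Ex_cst cond_ExD// (cond_ExZ (- (2 * m)) bf) -/m; lra.
Qed.

Let bm_phi i j : bm (fun w => dot (phi w) (b i) * dot (phi w) (b j)).
Proof. exact: (bounded_measurable_tensor dot_norm hb mD mphi phi1). Qed.

Definition head_mass K (x : H) := \sum_(i < K) dot x (b i) ^+ 2.

Lemma bounded_measurable_head_mass K :
  bounded_measurable (fun w => \1_D w * head_mass K (phi w) ^+ 2).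
Proof.
have h : bm (fun w => head_mass K (phi w)).
  rewrite /head_mass; apply: bm_sum => i.
  by rewrite /bm; under eq_fun do rewrite expr2; exact: bm_phi.
by rewrite -/(bm _) (_ : (fun w => _) =
  (fun w => head_mass K (phi w)) \* (fun w => head_mass K (phi w)))//;
  exact: bmM.
Qed.

Let e i j := cond_Ex (fun w => dot (phi w) (b i) * dot (phi w) (b j)).

(** By Jensen's inequality each squared entry is at most the conditional mean of the squared entry
    of the tensor. Inside a large square, the squared entries of the tensor of [x] with itself sum
    to at most [|x|^4 <= 1], and those in the corner of size [K] sum to [head_mass K x ^+ 2]. *)
Lemma cond_entry_tail K N :
  \sum_(ij : 'I_N * 'I_N) (~~ ((ij.1 < K)%N && (ij.2 < K)%N))%:R * e ij.1 ij.2 ^+ 2 <=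
  1 - cond_Ex (fun w => head_mass K (phi w) ^+ 2).
Proof.
pose M := maxn K N.
pose chi i j : R := (~~ ((i < K)%N && (j < K)%N))%:R.
have chi0 i j : 0 <= chi i j by [].
have be2 i j : bm ((fun w => dot (phi w) (b i) * dot (phi w) (b j)) \*
    (fun w => dot (phi w) (b i) * dot (phi w) (b j))) by exact: bmM.
apply: (@le_trans _ _ (\sum_(ij : 'I_M * 'I_M) chi ij.1 ij.2 * e ij.1 ij.2 ^+ 2)).
  apply: (@ler_sum_square _ (fun i j => chi i j * e i j ^+ 2)); last exact: leq_maxr.
  by move=> i j; rewrite mulr_ge0// sqr_ge0.
apply: (@le_trans _ _ (cond_Ex (fun w => \sum_(ij : 'I_M * 'I_M) chi ij.1 ij.2 *
    ((fun w => dot (phi w) (b ij.1) * dot (phi w) (b ij.2)) \*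
    (fun w => dot (phi w) (b ij.1) * dot (phi w) (b ij.2))) w))).
  rewrite cond_Ex_sum => [|ij]; last exact: bmZ.
  apply: ler_sum => ij _; rewrite cond_ExZ//.
  by apply: ler_wpM2l => //; apply: sqr_cond_Ex_le; exact: bm_phi.
have bh := bounded_measurable_head_mass K.
have -> : 1 - cond_Ex (fun w => head_mass K (phi w) ^+ 2) =
    cond_Ex ((fun=> 1) \+ (fun w => -1 * head_mass K (phi w) ^+ 2)).
  by rewrite (cond_ExD (bm_cst 1) (bmZ (-1) bh)) cond_Ex_cst (cond_ExZ (-1) bh) mulN1r.
apply: cond_Ex_le.
- by apply: bm_sum => ij; exact: bmZ.
- by apply: bmD; [exact: bm_cst|exact: bmZ].
move=> w Dw /=; pose a i := dot (phi w) (b i) ^+ 2.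
have sq n : head_mass n (phi w) ^+ 2 = \sum_(ij : 'I_n * 'I_n) a ij.1 * a ij.2.
  rewrite expr2 /head_mass mulr_suml -(pair_bigA _ (fun i j : 'I_n => a i * a j))/=.
  by apply: eq_bigr => i _; rewrite mulr_sumr.
have a0 i : 0 <= a i by exact: sqr_ge0.
have le1 : head_mass M (phi w) ^+ 2 <= 1.
  have h0 : 0 <= head_mass M (phi w) by apply: sumr_ge0 => i _; exact: a0.
  rewrite expr_le1// (le_trans (bessel_nat dot_norm hb M (phi w)))//.
  by rewrite expr_le1// phi1.
have : \sum_(ij : 'I_M * 'I_M) ((ij.1 < K)%N && (ij.2 < K)%N)%:R * (a ij.1 * a ij.2) =
    head_mass K (phi w) ^+ 2.
  by rewrite sq; apply: (@sum_square_restrict _ (fun i j => a i * a j)); exact: leq_maxl.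
move: le1; rewrite sq => le1 <-.
rewrite mulN1r lerBrDr -big_split/= (le_trans _ le1)//; apply: ler_sum => ij _.
rewrite le_eqVlt; apply/orP; left; apply/eqP; rewrite /chi /a.
by case: (_ && _); rewrite /= !(mul1r, mul0r, add0r, addr0)//; ring.
Qed.

End conditional_second_moments.

Section tail_limit.
Context {R : realType} {H : completeNormedModType R} (dot : {dot H for idfun}).
Hypothesis dot_norm : forall x : H, dot x x = `|x| ^+ 2.
Variables (b : nat -> H) (hb : hs_basis dot b).
Context d (T : measurableType d) (P : probability T R).
Variables (X : {RV P >-> borelType H}) (Q : probability (borelType H) R).
Hypothesis X_angular : limit_angular_measure P X Q.

(** If the tail were null at [t], the normalized integral of the constant 1 would be 0 at every
    higher level, by the convention on the inverse of 0, yet it tends to [Q sphere = 1]. *)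
Lemma tail_prob_gt0 t : 0 < fine (P (tail X t)).
Proof.
have mt s := measurable_tail X s.
rewrite lt_neqAle eq_sym fine_ge0// andbT; apply/eqP => Pt0.
have [Q1 lim] := X_angular.
have c1 : {within @sphere R H, continuous (fun=> 1 : R)}.
  by apply: continuous_subspaceT => x; exact: cvg_cst.
have b1 : exists M : R, forall x : H, sphere x -> `|1 : R| <= M by exists 1 => x _; rewrite normr1.
have := lim _ c1 b1.
rewrite [X in _ --> X](_ : _ = 1%:E); last first.
  by rewrite integral_cst ?mul1e; [exact: Q1|exact: measurable_sphere].
move=> /fine_cvgP[_ /cvgrPdist_lt/(_ 1 ltr01)] [M [_ Mt]].
have := Mt (Num.max t (M + 1)).
rewrite lt_max ltrDl ltr01 orbT => /(_ isT).
rewrite /= (_ : P (tail X _) = 0%E); last first.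
  apply/eqP; rewrite eq_le measure_ge0 andbT.
  rewrite (@le_trans _ _ (P (tail X t)))//.
    apply: le_measure; rewrite ?inE//.
    by move=> w; rewrite /tail /= gt_max => /andP[].
  by rewrite -[leLHS]fineK ?fin_num_measure// Pt0.
by rewrite invr0 mul0e /= subr0 normr1 ltxx.
Qed.

Let Qs : fine (Q (@sphere R H)) = 1.
Proof. by have [-> _] := X_angular. Qed.

Let Qs_gt0 : 0 < fine (Q (@sphere R H)).
Proof. by rewrite Qs. Qed.

Let sphere_le1 (x : borelType H) : @sphere R H x -> `|x : H| <= 1.
Proof. by rewrite /sphere/= => ->. Qed.

Let tail_le1 t w : tail X t w -> `|angle (X w : H)| <= 1.
Proof. by move=> _; exact: normr_angle_le1. Qed.

Lemma cond_Ex_tail_cvg (f : H -> R) M : continuous f ->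
  measurable_fun setT (fun x : borelType H => f (angle (x : H))) ->
  (forall x, `|x| <= 1 -> `|f x| <= M) ->
  cond_Ex P (tail X t) (fun w => f (angle (X w : H))) @[t --> +oo] -->
  cond_Ex Q (@sphere R H) f.
Proof.
move=> cf mf fM; have [_ lim] := X_angular.
have cfs : {within @sphere R H, continuous f} by exact: continuous_subspaceT.
have bfs : exists M : R, forall x : H, sphere x -> `|f x| <= M.
  by exists M => x sx; exact/fM/sphere_le1.
have := lim f cfs bfs.
have M0 : 0 <= M by rewrite (le_trans _ (fM 0 _))// normr0.
have bt t : bounded_measurable (fun w => \1_(tail X t) w * f (angle (X w : H))).
  split; last first.
    exists M => w; rewrite normrM -[leRHS]mul1r; apply: ler_pM => //.
      by rewrite indicE; case: (_ \in _); rewrite /= ?normr1 ?normr0.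
    exact/fM/normr_angle_le1.
  apply: measurable_funM; first by apply: measurable_indic; exact: measurable_tail.
  exact: (measurableT_comp mf).
have bs : bounded_measurable (fun x : borelType H => \1_(@sphere R H : set (borelType H)) x * f x).
  split; last first.
    exists M => x; rewrite indicE; have [/set_mem sx|_] := boolP (x \in _).
      by rewrite mul1r; exact/fM/sphere_le1.
    by rewrite mul0r normr0.
  apply: measurable_funM; first by apply: measurable_indic; exact: measurable_sphere.
  exact: continuous_borel_measurable.
rewrite -(EFin_Ex_indic Q bs) => cvgf.
have : (cond_Ex P (tail X t) (fun w => f (angle (X w : H))))%:E @[t --> +oo] -->
    (cond_Ex Q (@sphere R H) f)%:E.
  rewrite [X in _ --> X%:E](_ : _ =
    Ex Q (fun x : borelType H => \1_(@sphere R H : set (borelType H)) x * f x)); last first.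
    by rewrite /cond_Ex Qs invr1 mul1r.
  apply: cvg_trans cvgf; apply: near_eq_cvg; near=> t.
  by rewrite /cond_Ex EFinM -(EFin_Ex_indic P (bt t)).
by move/fine_cvg.
Unshelve. all: by end_near. Qed.

Let f_entry i j (x : H) := dot x (b i) * dot x (b j).

Let c_entry i j : continuous (f_entry i j).
Proof. by move=> x; apply: cvgM; exact: continuous_dotl. Qed.

Let m_entry i j : measurable_fun setT (fun x : borelType H => f_entry i j (angle (x : H))).
Proof. by apply: measurable_funM; exact: measurable_dot_angle. Qed.

Let b_le1 i : `|b i| <= 1.
Proof.
rewrite -ler_sqr ?nnegrE// -dot_norm hb.1.1 eqxx expr1n.
by case: (b i != 0).
Qed.

Let entry_le1 i j x : `|x| <= 1 -> `|f_entry i j x| <= 1.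
Proof.
have h k : `|x| <= 1 -> `|dot x (b k)| <= 1.
  by move=> x1; rewrite (le_trans (dot_le dot_norm _ _))// mulr_ile1.
by move=> x1; rewrite normrM mulr_ile1 ?h.
Qed.

Let mass K (x : H) := head_mass dot b K x ^+ 2.

Let c_mass K : continuous (mass K).
Proof.
rewrite (_ : mass K = fun x => (\sum_(i < K) f_entry i i x) * (\sum_(i < K) f_entry i i x)).
  by move=> x; apply: cvgM; apply: cvg_sumr => i; exact: c_entry.
by apply/funext => x; rewrite /mass /head_mass -expr2.
Qed.

Let m_mass K : measurable_fun setT (fun x : borelType H => mass K (angle (x : H))).
Proof.
apply: measurable_funX; apply: measurable_sum => i; apply: measurable_funX.
exact: measurable_dot_angle.
Qed.

Let head_mass_ge0 K x : 0 <= head_mass dot b K x.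
Proof. by apply: sumr_ge0 => i _; exact: sqr_ge0. Qed.

Let mass_le1 K x : `|x| <= 1 -> `|mass K x| <= 1.
Proof.
move=> x1; rewrite ger0_norm ?sqr_ge0// expr_le1//.
by rewrite (le_trans (bessel_nat dot_norm hb K x))// expr_le1.
Qed.

Let limit_entryE i j : limit_entry dot b Q i j = cond_Ex Q (@sphere R H) (f_entry i j).
Proof. by rewrite /cond_Ex Qs invr1 mul1r. Qed.

(** Monotone convergence: on the sphere [mass K] increases to [|x|^4 = 1] by Parseval. *)
Lemma cond_Ex_sphere_mass : cond_Ex Q (@sphere R H) (mass K) @[K --> \oo] --> (1 : R).
Proof.
have bm K : bounded_measurable (fun x : borelType H =>
  \1_(@sphere R H : set (borelType H)) x * mass K x).
  apply: (bounded_measurable_head_mass dot_norm hb measurable_sphere) => //.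
  by move=> i; exact: measurable_dot_borel.
have : (\int[Q]_(x in @sphere R H) (mass K x)%:E)%E @[K --> \oo] -->
    (\int[Q]_(x in @sphere R H) (limn (fun K => (mass K x)%:E)))%E.
  apply: cvg_monotone_convergence; first exact: measurable_sphere.
  - move=> n; apply/measurable_EFinP; apply: measurable_funTS.
    exact: (continuous_borel_measurable (@c_mass n)).
  - by move=> n x _; rewrite lee_fin sqr_ge0.
  - move=> x _ m n mn; rewrite lee_fin ler_sqr ?nnegrE//.
    rewrite /head_mass (big_ord_widen n (fun i => dot x (b i) ^+ 2) mn) big_mkcond/=.
    by apply: ler_sum => i _; case: ifP => // _; exact: sqr_ge0.
have -> : (\int[Q]_(x in @sphere R H) (limn (fun K => (mass K x)%:E)))%E = 1%:E.
  rewrite (eq_integral (fun=> 1%E)).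
    have [Q1 _] := X_angular.
    by rewrite integral_cst ?mul1e; [exact: Q1|exact: measurable_sphere].
  move=> x; rewrite inE => sx; apply/cvg_lim => //.
  apply: cvg_EFin; first exact: nearW.
  rewrite (_ : 1 = `|x : H| ^+ 2 * `|x : H| ^+ 2); last by rewrite sx !expr1n mulr1.
  rewrite (_ : fine \o _ = fun K => head_mass dot b K x * head_mass dot b K x).
    by apply: cvgM; exact: (parseval_norm dot_norm hb).
  by apply/funext => K; rewrite /= /mass expr2.
move=> cvgm; rewrite (_ : (fun K => _) =
  fine \o (fun K => \int[Q]_(x in @sphere R H) (mass K x)%:E)%E).
  exact: fine_cvg.
apply/funext => K; rewrite /cond_Ex Qs invr1 mul1r /= -(EFin_Ex_indic Q (bm K)).
by [].
Qed.

(* The entries converge by weak convergence, and no mass escapes to infinity in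
   the matrix because the limit has trace 1. *)
Lemma tail_entry_cvg eps : 0 < eps -> exists t0, forall t, t0 < t -> forall N,
  fnorm (fun ij : 'I_N * 'I_N =>
    tail_entry dot b X t ij.1 ij.2 - limit_entry dot b Q ij.1 ij.2) <= eps.
Proof.
(* In units of [eps^2]: the corner costs [1/8]. Off the corner, [(x - y)^2 <= 2 x^2 + 2 y^2] costs
   twice the missing mass of each operator, less than [1/8] for the limit and [1/4] for the tail;
   the total is below [7/8]. *)
move=> eps0; have e8 : 0 < eps ^+ 2 / 8 by rewrite divr_gt0// exprn_gt0.
have /cvgrPdist_lt/(_ _ e8)[K _ /(_ K (leqnn _)) massK] := cond_Ex_sphere_mass.
pose D t ij := (tail_entry dot b X t ij.1 ij.2 - limit_entry dot b Q ij.1 ij.2) ^+ 2.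
have D_cvg : \sum_(ij : 'I_K * 'I_K) D t (ij.1 : nat, ij.2 : nat) @[t --> +oo] --> (0 : R).
  rewrite [X in _ --> X](_ : _ = \sum_(ij : 'I_K * 'I_K) 0); last by rewrite big1.
  apply: cvg_sumr => ij; rewrite /D -[X in _ --> X](mulr0 0) /=.
  under eq_fun do rewrite expr2.
  have h : tail_entry dot b X t ij.1 ij.2 - limit_entry dot b Q ij.1 ij.2 @[t --> +oo] --> (0 : R).
    rewrite -(subrr (limit_entry dot b Q ij.1 ij.2)); apply: cvgB; last exact: cvg_cst.
    rewrite {1}limit_entryE; apply: (@cond_Ex_tail_cvg (f_entry ij.1 ij.2) 1).
    + exact: c_entry.
    + exact: m_entry.
    + exact: entry_le1.
  exact: cvgM.
have mass_cvg := cond_Ex_tail_cvg (@c_mass K) (@m_mass K) (@mass_le1 K).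
have : \forall t \near +oo,
    `|0 - \sum_(ij : 'I_K * 'I_K) D t (ij.1 : nat, ij.2 : nat)| < eps ^+ 2 / 8 /\
    `|cond_Ex Q (@sphere R H) (mass K) -
      cond_Ex P (tail X t) (fun w => mass K (angle (X w : H)))| < eps ^+ 2 / 8.
  near=> t; split; near: t.
    by have /cvgrPdist_lt/(_ _ e8) := D_cvg.
  by have /cvgrPdist_lt/(_ _ e8) := mass_cvg.
move=> [t0 [_ ht]]; exists t0 => t /ht[Dt mt] N.
rewrite fnorm_le ?(ltW eps0)//.
pose M := maxn K N.
pose F i j := (tail_entry dot b X t i j - limit_entry dot b Q i j) ^+ 2.
pose chi i j : R := (~~ ((i < K)%N && (j < K)%N))%:R.
have tailP := cond_entry_tail dot_norm hb (measurable_tail X t) (tail_prob_gt0 t)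
  (fun i => measurable_dot_angle_RV dot_norm X (b i)) (@tail_le1 t) K M.
have tailQ := cond_entry_tail dot_norm hb measurable_sphere Qs_gt0
  (fun i => measurable_dot_borel dot_norm (b i)) sphere_le1 K M.
apply: (@le_trans _ _ (\sum_(ij : 'I_M * 'I_M) F ij.1 ij.2)).
  apply: (@ler_sum_square _ F); last exact: leq_maxr.
  by move=> i j; exact: sqr_ge0.
apply: (@le_trans _ _ (\sum_(ij : 'I_M * 'I_M) (((ij.1 < K)%N && (ij.2 < K)%N)%:R * F ij.1 ij.2 +
    (2 * (chi ij.1 ij.2 * tail_entry dot b X t ij.1 ij.2 ^+ 2) +
     2 * (chi ij.1 ij.2 * limit_entry dot b Q ij.1 ij.2 ^+ 2))))).
  apply: ler_sum => -[i j] _ /=; rewrite /chi /F.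
  set x := tail_entry _ _ _ _ _ _; set y := limit_entry _ _ _ _ _.
  have := sqr_ge0 (x + y); rewrite sqrrD sqrrB.
  by case: (_ && _) => /=; lra.
rewrite !big_split/= (sum_square_restrict F); last exact: leq_maxl.
rewrite -!mulr_sumr.
have -> : \sum_(ij : 'I_M * 'I_M) chi ij.1 ij.2 * limit_entry dot b Q ij.1 ij.2 ^+ 2 =
    \sum_(ij : 'I_M * 'I_M) chi ij.1 ij.2 * cond_Ex Q (@sphere R H) (f_entry ij.1 ij.2) ^+ 2.
  by apply: eq_bigr => ij _; rewrite limit_entryE.
have DF : \sum_(ij : 'I_K * 'I_K) D t (ij.1 : nat, ij.2 : nat) =
  \sum_(ij : 'I_K * 'I_K) F ij.1 ij.2 by [].
move: Dt mt massK; rewrite DF sub0r normrN !ltr_norml => /andP[_ Dt] /andP[_ mt] /andP[_ mK].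
by move: tailP tailQ; rewrite -/(mass K _); lra.
Unshelve. all: by end_near. Qed.

End tail_limit.

(** * Conclusion *)

Lemma deviation_bound_ge0 (R : realType) (k : nat) (delta : R) :
  0 < delta < 1 -> 0 <= deviation_bound k delta.
Proof.
move=> /andP[d0 d1].
have ln0 c : 1 <= c -> 0 <= ln (c / delta).
  by move=> c1; rewrite ln_ge0// ler_pdivlMr// mul1r; lra.
apply: addr_ge0; apply: divr_ge0 => //.
by apply: addr_ge0; apply: mulr_ge0 => //; apply: ln0; lra.
Qed.

Lemma deviation_bound_small (R : realType) (delta eps : R) : 0 < delta < 1 -> 0 < eps ->
  exists K : R, forall k : nat, K <= k%:R -> deviation_bound k delta <= eps.
Proof.
move=> d01 eps0.
pose c1 := 1 + 4 * Num.sqrt (ln (2 / delta)) + Num.sqrt (8 * ln (4 / delta)).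
pose c2 := 8 * ln (2 / delta) + 4 * ln (4 / delta).
have c2_ge0 : 0 <= c2.
  have /andP[d0 d1] := d01.
  by apply: addr_ge0; apply: mulr_ge0 => //; rewrite ln_ge0// ler_pdivlMr// mul1r; lra.
have c1_ge0 : 0 <= c1 by rewrite addr_ge0// addr_ge0// mulr_ge0.
exists (1 + ((c1 + c2) / eps) ^+ 2) => k kK.
have k1 : 1 <= k%:R :> R by rewrite (le_trans _ kK)// lerDl sqr_ge0.
pose q : R := Num.sqrt k%:R.
have q1 : 1 <= q by rewrite -[leLHS]sqrtr1 ler_wsqrtr.
have q2 : q * q = k%:R by rewrite -expr2 sqr_sqrtr// (le_trans _ k1).
have q0 : 0 < q by rewrite (lt_le_trans _ q1).
have qge : (c1 + c2) / eps <= q.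
  rewrite -(ger0_norm (divr_ge0 (addr_ge0 c1_ge0 c2_ge0) (ltW eps0))) -sqrtr_sqr ler_wsqrtr//.
  by rewrite (le_trans _ kK)// lerDr.
rewrite /deviation_bound -/c1 -/c2 -/q.
apply: (@le_trans _ _ (c1 / q + c2 / q)).
  rewrite lerD2l ler_wpM2l// lef_pV2 ?posrE// -?q2; last by rewrite mulr_gt0// mulr_gt0.
  have : q * 1 <= q * q by rewrite ler_pM2l.
  have : 0 <= q * q by rewrite mulr_ge0 ?ltW.
  lra.
by rewrite -mulrDl ler_pdivrMr// mulrC -ler_pdivrMr.
Qed.

Section outer_probability.
Context {R : realType} d (T : measurableType d) (P : probability T R).

Lemma outer_prob_ge0 (E : set T) : (0 <= outer_prob P E)%E.
Proof. by apply/ereal_infP => _ [A _ <-]. Qed.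

Lemma outer_prob_le (E A : set T) : measurable A -> E `<=` A -> (outer_prob P E <= P A)%E.
Proof. by move=> mA EA; apply: ereal_inf_lbound; exists A. Qed.

Lemma inner_prob_ge (E A : set T) : measurable A -> A `<=` E -> (P A <= inner_prob P E)%E.
Proof. by move=> mA EA; apply: ereal_sup_ubound; exists A. Qed.

Lemma outer_prob_cvg0 (E : nat -> set T) :
  (forall delta, 0 < delta < 1 -> \forall n \near \oo, (outer_prob P (E n) <= delta%:E)%E) ->
  outer_prob P (E n) @[n --> \oo] --> 0%E.
Proof.
move=> Edelta.
have fin n delta : (outer_prob P (E n) <= delta%:E)%E -> outer_prob P (E n) \is a fin_num.
  by move=> le_d; rewrite ge0_fin_numE ?outer_prob_ge0// (le_lt_trans le_d) ?ltry.
apply/fine_cvgP; split.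
  have half : 0 < (2^-1 : R) < 1 by lra.
  by near=> n; apply: (fin n 2^-1); near: n; exact: Edelta.
apply/cvgrPdist_le => eps eps0.
pose delta : R := Num.min eps 2^-1.
have d01 : 0 < delta < 1 by rewrite lt_min gt_min eps0 /=; lra.
near=> n.
have le_d : (outer_prob P (E n) <= delta%:E)%E by near: n; exact: Edelta.
rewrite sub0r normrN ger0_norm ?fine_ge0 ?outer_prob_ge0//.
rewrite -lee_fin fineK ?(fin _ _ le_d)// (le_trans le_d)// lee_fin.
by rewrite /delta ge_min lexx.
Unshelve. all: by end_near. Qed.

End outer_probability.

Theorem corollary4p3 (R : realType) (H : completeNormedModType R)
  (dot : {dot H for idfun})
  (dot_norm : forall x : H, dot x x = `|x| ^+ 2)
  (H_separable : @separable R H)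
  (d : measure_display) (T : measurableType d) (P : probability T R)
  (X : {RV P >-> borelType H}) (X_ : nat -> {RV P >-> borelType H})
  (alpha : R) (Pinf : probability (borelType H) R)
  (alpha_gt0 : 0 < alpha)
  (X_rv : regularly_varying P X alpha)
  (X_angular : limit_angular_measure P X Pinf)
  (X_copies : independent_copies P X (fun i => X_ i))
  (X_quantile : forall n k : nat, (1 <= k <= n)%N ->
     P [set w | threshold P X n k <= `|(X w : H)|] = (k%:R / n%:R)%:E /\
     P [set w | threshold P X n k < `|(X w : H)|] = (k%:R / n%:R)%:E)
  (p : nat) (p_ge1 : (1 <= p)%N)
  (gap_inf : 0 < half_gap dot (cov_limit dot Pinf) p) :
  (forall (n k : nat) (delta : R), (1 <= k <= n)%N -> 0 < delta < 1 ->
     0 < half_gap dot (cov_tail dot P X (threshold P X n k)) p ->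
     forall V : set H,
     leading_eigenspace dot (cov_tail dot P X (threshold P X n k)) p V ->
     ((1 - delta)%:E <
      inner_prob P [set w | forall (s : 'S_n) (W : set H),
        norm_decreasing (fun i => X_ i w : H) s ->
        leading_eigenspace dot (cov_emp dot (fun i => X_ i w : H) s k) p W ->
        rho dot W V <=
          (deviation_bound k delta /
           half_gap dot (cov_tail dot P X (threshold P X n k)) p)%:E])%E) /\
  (forall k : nat -> nat,
     k n @[n --> \oo] --> \oo ->
     (k n)%:R / n%:R @[n --> \oo] --> (0 : R) ->
     forall V : set H, leading_eigenspace dot (cov_limit dot Pinf) p V ->
     forall eps : R, 0 < eps ->
     outer_prob P [set w | exists (s : 'S_n) (W : set H),
       [/\ norm_decreasing (fun i => X_ i w : H) s,
           leading_eigenspace dot (cov_emp dot (fun i => X_ i w : H) s (k n)) p W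
         & (eps%:E < rho dot W V)%E]] @[n --> \oo] --> 0%E).
Proof.
have [onbE|nonb] := pselect (orthonormal_basis dot (xget set0 (orthonormal_basis dot))); last first.
  have rho0 U W : rho dot U W = 0%E by exact: hs_norm_junk.
  split=> [n k delta _ d01 gap V _|k _ _ V _ eps eps0].
    apply: (@lt_le_trans _ _ (P setT)).
      by rewrite probability_setT lte_fin; have /andP[] := d01; lra.
    apply: inner_prob_ge => // w _ s W _ _.
    by rewrite rho0 lee_fin divr_ge0 ?deviation_bound_ge0// ltW.
  apply: outer_prob_cvg0 => delta /andP[d0 _]; apply: nearW => n.
  rewrite (le_trans (outer_prob_le P measurable0 _))//; last first.
    by rewrite measure0 lee_fin ltW.
  by move=> w [s [W [_ _]]]; rewrite rho0 lte_fin ltNge (ltW eps0).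
have [b hb] := exists_hs_basis dot_norm H_separable onbE.
have tailP n k : (1 <= k <= n)%N ->
    P (tail X (threshold P X n k)) = (k%:R / n%:R)%:E.
  by move=> kn; have [_ ->] := X_quantile _ _ kn.
split=> [n k delta kn d01 gap V leadV|k k_oo kn0 V leadV eps eps0].
  have /andP[k0 kn'] := kn.
  have [A [mA PA good]] := concentration dot_norm hb X_copies k0 kn' (tailP _ _ kn) d01.
  apply: (lt_le_trans PA); apply: inner_prob_ge => // w Aw s W sdec leadW.
  have [psdC entC] := cov_tail_spec dot_norm hb p_ge1 gap.
  apply: (davis_kahan dot_norm hb p_ge1 psdC _ gap leadV leadW).
    exact: psd_hs_cov_emp.
  move=> N; apply: le_trans (good w Aw s sdec N).
  rewrite /fnorm ler_wsqrtr//; apply: ler_sum => ij _.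
  by rewrite /corner /= dotBl entC -sqrrN opprB.
have [psdC entC] := cov_limit_spec dot_norm hb p_ge1 gap_inf.
(* One [eta] for the sampling error and one for the distance from the tail entries to the limit. *)
pose eta := eps * half_gap dot (cov_limit dot Pinf) p / 2.
have eta0 : 0 < eta by rewrite divr_gt0// mulr_gt0.
have [t0 tail_close] := tail_entry_cvg dot_norm hb X_angular eta0.
have p0 := tail_prob_gt0 X_angular t0.
apply: outer_prob_cvg0 => delta d01.
have [K smallK] := deviation_bound_small d01 eta0.
have k_gt0 : \forall n \near \oo, (0 < k n)%N.
  by apply: (k_oo [set m | (0 < m)%N]); exists 1%N.
have k_geK : \forall n \near \oo, K <= (k n)%:R.
  exact: (k_oo [set m | K <= m%:R] (nbhs_infty_ger K)).
near=> n.
have kn : (1 <= k n <= n)%N.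
  apply/andP; split; first by near: n.
  have n0 : (0 < n)%N by near: n; exact: nbhs_infty_gt.
  have : (k n)%:R / n%:R < 1 :> R.
    by near: n; move/cvgrPdist_lt : kn0 => /(_ 1 ltr01); apply: filterS => n;
      rewrite sub0r normrN ger0_norm.
  by rewrite ltr_pdivrMr ?ltr0n// mul1r ltr_nat => /ltnW.
have /andP[k0 kn'] := kn.
have kK : K <= (k n)%:R by near: n.
(* A threshold at most [t0] would give [k / n >= P (tail X t0)], a fixed positive number, whereas
   [k / n] tends to 0. *)
have thr : t0 < threshold P X n (k n).
  rewrite ltNge; apply/negP => le_t0.
  have : (k n)%:R / n%:R < fine (P (tail X t0)).
    by near: n; move/cvgrPdist_lt : kn0 => /(_ _ p0); apply: filterS => n;
      rewrite sub0r normrN ger0_norm.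
  apply/negP; rewrite -leNgt -lee_fin -tailP// fineK ?fin_num_measure//;
    last exact: measurable_tail.
  apply: le_measure; rewrite ?inE; try exact: measurable_tail.
  by move=> w; exact: le_lt_trans.
have [A [mA PA good]] := concentration dot_norm hb X_copies k0 kn' (tailP _ _ kn) d01.
apply: (@le_trans _ _ (P (~` A))); last first.
  rewrite probability_setC// -[X in (_ - X)%E]fineK ?fin_num_measure// -EFinB lee_fin.
  by move: PA; rewrite -[X in (_ < X)%E]fineK ?fin_num_measure// lte_fin; lra.
apply: outer_prob_le; first exact: measurableC.
move=> w [s [W [sdec leadW]]] + Aw; apply/negP; rewrite -leNgt.
have -> : eps = (eta + eta) / half_gap dot (cov_limit dot Pinf) p.
  by rewrite /eta -mulr2n -[X in X / _]mulr_natr divfK// mulfK// gt_eqF.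
apply: (davis_kahan dot_norm hb p_ge1 psdC _ gap_inf leadV leadW).
  exact: psd_hs_cov_emp.
move=> N.
pose x ij : R := dot (cov_emp dot (fun i : 'I_n => X_ i w : H) s (k n) (b ij.1)) (b ij.2).
(* The intermediate matrix is [tail_entry], since no gap of [cov_tail] is available at this
   threshold to guarantee its Bochner integral. *)
pose y ij := tail_entry dot b X (threshold P X n (k n)) ij.1 ij.2.
pose z ij := limit_entry dot b Pinf ij.1 ij.2.
have -> : fnorm (@corner _ _ dot b N (cov_limit dot Pinf \-
      cov_emp dot (fun i : 'I_n => X_ i w : H) s (k n))) =
    fnorm ((fun ij : 'I_N * 'I_N => x (ij.1 : nat, ij.2 : nat) - y (ij.1 : nat, ij.2 : nat)) \+
           (fun ij : 'I_N * 'I_N => y (ij.1 : nat, ij.2 : nat) - z (ij.1 : nat, ij.2 : nat))).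
  rewrite /fnorm; congr Num.sqrt; apply: eq_bigr => ij _.
  by rewrite /corner /= dotBl entC addrA subrK -sqrrN opprB.
apply: (le_trans (fnormD _ _)); apply: lerD; last exact: tail_close.
exact: le_trans (good w Aw s sdec N) (smallK _ kK).
Unshelve. all: by end_near. Qed.
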